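(* Let $\Omega\subset\mathbb{R}^n$ be open, let $R>0$, $c>0$, $p\in[1,\infty)$, $k\in\{0,\dots,n\}$, and let $\omega\in L^p(\wedge^kT^*\Omega)$, where $\omega$ is extended to an element of $L^p(\wedge^kT^*\mathbb{R}^n)$ by setting $\omega=0$ outside $\Omega$. Let $\|\cdot\|_{p,k}$ be one of the four seminorms $\|\cdot\|_{L^pM^{k}(\Omega)}$, $\|\cdot\|_{L^pM^{k}(\Omega\mid R)}$, $\|\cdot\|_{L^pM^{k,c}(\Omega)}$, $\|\cdot\|_{L^pM^{k,c}(\Omega\mid R)}$, and let $[\cdot]_{p,k}$ be its $\liminf$-version. If $\|\cdot\|_{p,k}=\|\cdot\|_{L^pM^k(\Omega)}$ or $\|\cdot\|_{p,k}=\|\cdot\|_{L^pM^{k,c}(\Omega)}$, assume additionally that $\Omega$ is bounded. Then $$[I_\omega]_{p,k}=\|I_\omega\|_{p,k}=K\,\bigl\||\omega|_{\mathbb{S},p}\bigr\|_{L^p(\Omega)},$$ where $K=K(p,n,k)>0$ is a constant depending only on $p$, $n$ and $k$ (the same for all four seminorms).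
   Context: Differential forms. For $U\subset\mathbb{R}^n$ open, a measurable $k$-form is $\omega=\sum_I \omega_I\,dx_{I_1}\wedge\dots\wedge dx_{I_k}$ with $I=(I_1<\dots<I_k)$ and measurable coefficients; its pointwise norm is $|\omega_x|=(\sum_I|\omega_I(x)|^2)^{1/2}$. $L^p(\wedge^kT^*U)$ is the space of (a.e.-equivalence classes of) measurable $k$-forms with $\|\omega\|_{L^p(U)}:=\||\omega|\|_{L^p(U)}<\infty$. Forms are regarded as alternating multilinear maps, with $(dx_{1}\wedge\dots\wedge dx_{k})(e_1,\dots,e_k)=1$. Integration function. Let $\Delta_k=\{s\in\mathbb{R}^k: s_i\ge0,\ s_1+\dots+s_k\le1\}$ and $\phi_{x_0,\dots,x_k}(s)=x_0+\sum_{i=1}^k s_i(x_i-x_0)$; $\Delta(x_0,\dots,x_k)$ is the oriented simplex $\phi_{x_0,\dots,x_k}(\Delta_k)$. Choosing a Borel representative of the zero-extended $\omega$, $$I_\omega(x_0,\dots,x_k)=\int_{\Delta(x_0,\dots,x_k)}\omega=\int_{\Delta_k}\phi_{x_0,\dots,x_k}^*\omega=\int_{\Delta_k}\omega_{\phi_{x_0,\dots,x_k}(s)}(x_1-x_0,\dots,x_k-x_0)\,ds ,$$ defined and finite for a.e. $(x_0,\dots,x_k)\in\Omega^{k+1}$ and independent of the representative up to null-sets. For $k=0$, $I_\omega(x_0)=\omega(x_0)$. Seminorms. For measurable $E\subset\Omega$, $R>0$, $c>0$, put $\mathbb{B}(E,k,R)=\{(x_0,\dots,x_k)\in E^{k+1}:\max_{1\le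 i\le k}|x_0-x_i|<R\}$ and $E(k,c)=\{(x_0,\dots,x_k)\in E^{k+1}:\max_{1\le i\le k}|x_0-x_i|<c\,\mathrm{dist}(x_0,\partial E)\}$, with $\mathrm{dist}(x_0,\emptyset)=\infty$; for $k=0$ both sets equal $E$. For measurable $F:\Omega^{k+1}\to\mathbb{R}$ and measurable $A\subset \Omega^{k+1}$ let $$N_\theta(F;A)=\int_A\frac{(1-\theta)^k|F(x_0,\dots,x_k)|^p}{(|x_1-x_0|\cdots|x_k-x_0|)^{n+\theta p}}\,dx_0\cdots dx_k$$ (empty products equal $1$). Then $\|F\|^p_{L^pM^k(E)}$, $\|F\|^p_{L^pM^k(E\mid R)}$, $\|F\|^p_{L^pM^{k,c}(E)}$, $\|F\|^p_{L^pM^{k,c}(E\mid R)}$ are defined as $\limsup_{\theta\to1^-}N_\theta(F;A)$ with $A=E^{k+1}$, $A=\mathbb{B}(E,k,R)$, $A=E(k,c)$, $A=\mathbb{B}(E,k,R)\cap E(k,c)$, respectively. The $\liminf$-versions, written with $[\cdot]$ in place of $\|\cdot\|$, are defined in the same way with $\limsup$ replaced by $\liminf$. Norm $|\cdot|_{\mathbb{S},p}$. For an alternating $k$-linear form $\alpha$ on $\mathbb{R}^n$, $$|\alpha|_{\mathbb{S},p}^p=\int_{\{|v_1|=\dots=|v_k|=1\}}|\alpha(v_1,\dots,v_k)|^p\,d\mathcal{H}^{n-1}(v_1)\cdots d\mathcal{H}^{n-1}(v_k)$$ (and $|\alpha|_{\mathbb{S},p}=|\alpha|$ if $k=0$), with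 $\mathcal{H}^{n-1}$ the $(n-1)$-dimensional Hausdorff measure on the unit sphere; $|\omega|_{\mathbb{S},p}$ is the function $x\mapsto|\omega_x|_{\mathbb{S},p}$. *)

(* Defs.v *)
From HB Require Import structures.
From mathcomp Require Import all_boot all_order all_algebra.
From mathcomp Require Import all_classical all_reals all_analysis.

Set Implicit Arguments.
Unset Strict Implicit.
Unset Printing Implicit Defensive.

Import Order.TTheory GRing.Theory Num.Theory.
Import numFieldNormedType.Exports.

Local Open Scope classical_set_scope.
Local Open Scope ring_scope.

(* The sigma-algebra on row vectors generated by the coordinates; on 'rV[R]_n
   it is the Borel sigma-algebra of R^n. *)
Definition row_display : measure_display -> measure_display.
Proof. exact. Qed.

Section measurable_row.
Context {d} {T : sigmaRingType d} (n : nat).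

Let coord (i : 'I_n) (v : 'rV[T]_n) : T := v ord0 i.

Let row_set0 : g_sigma_preimage coord set0.
Proof. exact: sigma_algebra0. Qed.

Let row_setC A : g_sigma_preimage coord A -> g_sigma_preimage coord (~` A).
Proof. exact: sigma_algebraC. Qed.

Let row_bigcup (F : (set 'rV[T]_n)^nat) :
  (forall i, g_sigma_preimage coord (F i)) ->
  g_sigma_preimage coord (\bigcup_i (F i)).
Proof. exact: sigma_algebra_bigcup. Qed.

HB.instance Definition _ := @isMeasurable.Build (row_display d)
  'rV[T]_n (g_sigma_preimage coord) row_set0 row_setC row_bigcup.

End measurable_row.

(* The n-fold product m \x ... \x m on n.-tuple T. It is defined for bare set
   functions because it is also applied to the Hausdorff measure below. *)
Definition tcons (T : Type) (n : nat) (z : T * n.-tuple T) : n.+1.-tuple T :=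
  [tuple of z.1 :: z.2].

Fixpoint tuple_product d (T : measurableType d) (R : realType)
    (m : set T -> \bar R) (n : nat) : set (n.-tuple T) -> \bar R :=
  match n with
  | 0 => \d_[tuple]
  | n'.+1 => pushforward (m \x tuple_product m (n := n'))%E (@tcons T n')
  end.
Arguments tuple_product {d T R} m n.

Section sigma_finite_measure_ex.
Local Open Scope ereal_scope.

Lemma sigma_finite_measure_ex d (T : measurableType d) (R : realType)
    (nu : set T -> \bar R) :
  nu set0 = 0 -> (forall A, 0 <= nu A) -> semi_sigma_additive nu ->
  sigma_finite setT nu ->
  exists M : {sigma_finite_measure set T -> \bar R}, nu = M.
Proof.
move=> nu0 nu_ge0 nu_sadd nu_sf.
pose nu_measure := isMeasure.Build _ _ _ nu nu0 nu_ge0 nu_sadd.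
pose nu' : {measure set T -> \bar R} := HB.pack nu nu_measure.
pose nu_sigma_finite := Measure_isSigmaFinite.Build _ _ _ nu' nu_sf.
pose M : {sigma_finite_measure set T -> \bar R} :=
  HB.pack nu nu_measure nu_sigma_finite.
by exists M.
Qed.

Lemma product_sigma_finite d1 d2 (T1 : measurableType d1)
    (T2 : measurableType d2) (R : realType)
    (m1 : {sigma_finite_measure set T1 -> \bar R})
    (m2 : {sigma_finite_measure set T2 -> \bar R}) :
  sigma_finite setT (m1 \x m2).
Proof.
have /sigma_finiteP[F [TF ndF Foo]] := sigma_finiteT m1.
have /sigma_finiteP[G [TG ndG Goo]] := sigma_finiteT m2.
exists (fun k => F k `*` G k).
  rewrite -setXTT TF TG predeqE => -[x y]; split.
    move=> [/= [i _ Fix] [j _ Gjy]]; exists (maxn i j) => //; split.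
    - by move: x Fix; exact/subsetPset/ndF/leq_maxl.
    - by move: y Gjy; exact/subsetPset/ndG/leq_maxr.
  by move=> [k _ []/= ? ?]; split; exists k.
move=> k; have [? ?] := Foo k; have [? ?] := Goo k.
split; first exact: measurableX.
by rewrite product_measure1E// lte_mul_pinfty// ge0_fin_numE.
Qed.

Lemma pushforward_sigma_finite_ex d1 d2 (T1 : measurableType d1)
    (T2 : measurableType d2) (R : realType)
    (m : {measure set T1 -> \bar R}) (f : T1 -> T2) (g : T2 -> T1) :
  sigma_finite setT m -> measurable_fun setT f -> measurable_fun setT g -> cancel f g ->
  exists M : {sigma_finite_measure set T2 -> \bar R}, pushforward m f = M.
Proof.
move=> [F TF Foo] mf mg fK; apply: sigma_finite_measure_ex.
- exact: measure0.
- by move=> A; exact: measure_ge0.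
- exact: measure_semi_sigma_additive.
- exists (fun k => g @^-1` F k).
    by rewrite -preimage_bigcup -TF preimage_setT.
  move=> k; have [mFk Fk] := Foo k; split.
    by rewrite -[X in measurable X]setTI; exact: mg.
  rewrite /pushforward -comp_preimage.
  by rewrite (_ : g \o f = id) //; apply/funext => x /=; rewrite fK.
Qed.

End sigma_finite_measure_ex.

Section tuple_product_measure.
Local Open Scope ereal_scope.
Context d (T : measurableType d) (R : realType).
Variable m : {sigma_finite_measure set T -> \bar R}.

Lemma measurable_tcons n : measurable_fun setT (@tcons T n).
Proof. exact: measurable_cons. Qed.

Lemma tuple_product_ex n :
  exists M : {sigma_finite_measure set (n.-tuple T) -> \bar R},
    tuple_product m n = M.
Proof.
elim: n => [|n [M ME]]; first by exists \d_[tuple].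
pose tsplit (t : n.+1.-tuple T) := (thead t, [tuple of behead t]).
have msplit : measurable_fun setT tsplit.
  apply: measurable_fun_pair; first exact: measurable_tnth.
  exact: measurable_behead.
have split_tcons : cancel (@tcons T n) tsplit.
  by move=> [x t]; congr pair; apply/val_inj.
rewrite /= ME.
exact: (pushforward_sigma_finite_ex (product_sigma_finite m M)
  (measurable_tcons (n := n)) msplit).
Qed.

Section instance.
Variable n : nat.

Let tuple_product0 : tuple_product m n set0 = 0.
Proof. by have [M ->] := tuple_product_ex n; exact: measure0. Qed.

Let tuple_product_ge0 A : 0 <= tuple_product m n A.
Proof. by have [M ->] := tuple_product_ex n; exact: measure_ge0. Qed.

Let tuple_product_sigma_additive : semi_sigma_additive (tuple_product m n).
Proof.
by have [M ->] := tuple_product_ex n; exact: measure_semi_sigma_additive.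
Qed.

HB.instance Definition _ := isMeasure.Build _ _ _ (tuple_product m n)
  tuple_product0 tuple_product_ge0 tuple_product_sigma_additive.

Let tuple_product_sigma_finite : sigma_finite setT (tuple_product m n).
Proof. by have [M ->] := tuple_product_ex n; exact: sigma_finiteT. Qed.

HB.instance Definition _ := Measure_isSigmaFinite.Build _ _ _
  (tuple_product m n) tuple_product_sigma_finite.

End instance.
End tuple_product_measure.

Section lebesgue_rV.
Local Open Scope ereal_scope.
Variables (R : realType) (n : nat).

Definition row_of_tuple (t : n.-tuple R) : 'rV[R]_n := (\row_i tnth t i)%R.

Definition lebesgue_rV : set 'rV[R]_n -> \bar R :=
  pushforward (tuple_product (@lebesgue_measure R) n) row_of_tuple.

Let tuple_of_row (v : 'rV[R]_n) : n.-tuple R := [tuple v ord0 i | i < n].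

Lemma measurable_coord (i : 'I_n) :
  measurable_fun setT (fun v : 'rV[R]_n => v ord0 i).
Proof.
move=> _ Y mY; rewrite setTI; apply: sub_sigma_algebra => /=.
rewrite -bigcup_seq/=; exists i => /=; first by rewrite mem_index_enum.
by exists Y => //; rewrite setTI.
Qed.

Lemma measurable_row_of_tuple : measurable_fun setT row_of_tuple.
Proof.
move=> _ Y mY; rewrite setTI.
suff: g_sigma_preimage (fun (i : 'I_n) (v : 'rV[R]_n) => v ord0 i) `<=`
  [set A | measurable (row_of_tuple @^-1` A)] by exact.
apply: smallest_sub.
  split => /=.
  - by rewrite preimage_set0.
  - by move=> A mA; rewrite setTD preimage_setC; exact: measurableC.
  - by move=> F mF; rewrite preimage_bigcup; exact: bigcupT_measurable.
move=> A; rewrite -bigcup_seq => -[i _ [B mB <-]] /=; rewrite setTI.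
have := @measurable_tnth _ R n i measurableT B mB; rewrite setTI.
by congr (measurable _); apply/seteqP; split => t /=; rewrite /row_of_tuple mxE.
Qed.

Let measurable_tuple_of_row : measurable_fun setT tuple_of_row.
Proof.
apply/measurable_fun_tnthP => i.
rewrite (_ : (fun t => tnth t i) \o _ = fun v : 'rV[R]_n => v ord0 i).
  exact: measurable_coord.
by apply/funext => v /=; rewrite tnth_mktuple.
Qed.

Let row_of_tupleK : cancel row_of_tuple tuple_of_row.
Proof.
by move=> t; apply: eq_from_tnth => i; rewrite tnth_mktuple mxE.
Qed.

Let lebesgue_rV_ex :
  exists M : {sigma_finite_measure set 'rV[R]_n -> \bar R}, lebesgue_rV = M.
Proof.
exact: (pushforward_sigma_finite_ex
  (sigma_finiteT (tuple_product (@lebesgue_measure R) n))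
  measurable_row_of_tuple measurable_tuple_of_row row_of_tupleK).
Qed.

Let lebesgue_rV0 : lebesgue_rV set0 = 0.
Proof. by have [M ->] := lebesgue_rV_ex; exact: measure0. Qed.

Let lebesgue_rV_ge0 A : 0 <= lebesgue_rV A.
Proof. by have [M ->] := lebesgue_rV_ex; exact: measure_ge0. Qed.

Let lebesgue_rV_sigma_additive : semi_sigma_additive lebesgue_rV.
Proof.
by have [M ->] := lebesgue_rV_ex; exact: measure_semi_sigma_additive.
Qed.

HB.instance Definition _ := isMeasure.Build _ _ _ lebesgue_rV
  lebesgue_rV0 lebesgue_rV_ge0 lebesgue_rV_sigma_additive.

Let lebesgue_rV_sigma_finite : sigma_finite setT lebesgue_rV.
Proof. by have [M ->] := lebesgue_rV_ex; exact: sigma_finiteT. Qed.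

HB.instance Definition _ := Measure_isSigmaFinite.Build _ _ _
  lebesgue_rV lebesgue_rV_sigma_finite.

End lebesgue_rV.
Arguments lebesgue_rV {R} n.

(* The norm of the library on 'rV[R]_n is the sup norm, hence this one. *)
Definition enorm (R : realType) (n : nat) (v : 'rV[R]_n) : R :=
  Num.sqrt (\sum_i v ord0 i ^+ 2).

Section hausdorff.
Local Open Scope ereal_scope.
Variables (R : realType) (n : nat).
Implicit Types A : set 'rV[R]_n.

Definition ediam A : \bar R :=
  ereal_sup [set (enorm (x - y)%R)%:E | x in A & y in A].

(* alpha_d 2^-d diam(A)^d, where alpha_d is the volume of the Euclidean unit
   ball of R^d; diam(A)^0 = 1 for A nonempty, so that d = 0 gives the counting
   measure. *)
Definition hausdorff_gauge (d : nat) A : \bar R :=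
  if `[< A = set0 >] then 0
  else lebesgue_rV d [set v : 'rV[R]_d | (enorm v <= 1)%R]
       * ((2 ^+ d)^-1)%R%:E * ediam A ^+ d.

Definition hausdorff_pre (d : nat) (delta : R) A : \bar R :=
  ereal_inf [set \sum_(i <oo) hausdorff_gauge d (F i) |
    F in [set F : (set 'rV[R]_n)^nat |
      A `<=` \bigcup_i F i /\ forall i, ediam (F i) <= delta%:E]].

Definition hausdorff_measure (d : nat) A : \bar R :=
  ereal_sup [set hausdorff_pre d delta A | delta in [set delta | (0 < delta)%R]].

Definition unit_sphere : set 'rV[R]_n := [set v | enorm v = 1%R].

(* H^{n-1} restricted to the unit sphere; only its values on Borel sets, where
   it is a finite measure, matter for the integrals below. *)
Definition sphere_measure A : \bar R :=
  hausdorff_measure n.-1 (A `&` unit_sphere).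

End hausdorff.
Arguments unit_sphere {R} n.
Arguments sphere_measure {R} n.

Definition Lnorm_on (R : realType) (n : nat) (D : set 'rV[R]_n) (p : R)
    (f : 'rV[R]_n -> \bar R) : \bar R :=
  ('N[lebesgue_rV n]_(p%:E)[patch (fun=> 0) D f])%E.

Section forms.
Variables (R : realType) (n k : nat).

Definition multi_index : Type :=
  {I : k.-tuple 'I_n | sorted (fun i j : 'I_n => (i < j)%N) I}.

(* A k-covector \sum_I a_I dx_{I_1} /\ ... /\ dx_{I_k} on R^n, given by its
   coefficients. *)
Definition covector : Type := {ffun multi_index -> R}.

(* dx_{I_1} /\ ... /\ dx_{I_k} (v_1, ..., v_k) = det (dx_{I_j} (v_i))_{i, j} *)
Definition covector_eval (a : covector) (v : k.-tuple 'rV[R]_n) : R :=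
  \sum_I a I * \det (\matrix_(i < k, j < k) tnth v i ord0 (tnth (val I) j)).

Definition covector_norm (a : covector) : R := Num.sqrt (\sum_I a I ^+ 2).

(* For k = 0 the product measure is the Dirac mass at the empty tuple, and this
   is |a|. *)
Definition covector_snorm (p : R) (a : covector) : \bar R :=
  ((\int[tuple_product (sphere_measure n) k]_(v in
      [set v | forall i, unit_sphere n (tnth v i)])
    (`|covector_eval a v| `^ p)%:E) `^ p^-1)%E.

Definition dform : Type := 'rV[R]_n -> covector.

Definition measurable_form (D : set 'rV[R]_n) (w : dform) : Prop :=
  forall I, measurable_fun D (fun x => w x I).

Definition zero_extend (D : set 'rV[R]_n) (w : dform) : dform :=
  patch (fun=> [ffun=> 0]) D w.

Definition Lp_form (D : set 'rV[R]_n) (p : R) (w : dform) : Prop :=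
  measurable_form D w /\
  (Lnorm_on D p (fun x => (covector_norm (w x))%:E) < +oo)%E.

Definition zero_extension_representative (D : set 'rV[R]_n) (w wB : dform) :
    Prop :=
  measurable_form setT wB /\
  {ae lebesgue_rV n, forall x, wB x = zero_extend D w x}.

(* A point (x_0, ..., x_k) of (R^n)^(k+1) is a tuple x : k.+1.-tuple 'rV_n. *)
Definition base_point (x : k.+1.-tuple 'rV[R]_n) : 'rV[R]_n := tnth x ord0.

Definition edges (x : k.+1.-tuple 'rV[R]_n) : k.-tuple 'rV[R]_n :=
  [tuple tnth x (lift ord0 i) - base_point x | i < k].

Definition simplex_map (x : k.+1.-tuple 'rV[R]_n) (s : 'rV[R]_k) :
    'rV[R]_n :=
  base_point x + \sum_(i < k) s ord0 i *: tnth (edges x) i.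

Definition std_simplex : set 'rV[R]_k :=
  [set s | (forall i, 0 <= s ord0 i) /\ \sum_i s ord0 i <= 1].

(* Real valued integral: its value is 0 where the integrand has infinite
   integral, which happens for almost no x when w is in L^p. *)
Definition integration (w : dform) (x : k.+1.-tuple 'rV[R]_n) : R :=
  \int[lebesgue_rV k]_(s in std_simplex)
    covector_eval (w (simplex_map x s)) (edges x).

End forms.

Inductive seminorm_kind := LpM | LpM_R | LpM_c | LpM_c_R.

Section seminorms.
Variables (R : realType) (n k : nat).
Implicit Types (E : set 'rV[R]_n) (A : set (k.+1.-tuple 'rV[R]_n)).
Implicit Types F : k.+1.-tuple 'rV[R]_n -> R.

(* The distance to the empty set is +oo. *)
Definition dist_boundary E (x : 'rV[R]_n) : \bar R :=
  ereal_inf [set (enorm (x - y))%:E | y in closure E `\` interior E].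

Definition pow_set E : set (k.+1.-tuple 'rV[R]_n) :=
  [set x | forall i, E (tnth x i)].

Definition ball_set E (r : R) : set (k.+1.-tuple 'rV[R]_n) :=
  [set x | pow_set E x /\ forall i, enorm (tnth (edges x) i) < r].

Definition cone_set E (c : R) : set (k.+1.-tuple 'rV[R]_n) :=
  [set x | pow_set E x /\
    forall i, ((enorm (tnth (edges x) i))%:E
               < c%:E * dist_boundary E (base_point x))%E].

Definition seminorm_domain (s : seminorm_kind) E (r c : R) :=
  match s with
  | LpM => pow_set E
  | LpM_R => ball_set E r
  | LpM_c => cone_set E c
  | LpM_c_R => ball_set E r `&` cone_set E c
  end.

(* The quotient is 0 where some x_i = x_0 with i >= 1, a null set. *)
Definition Ntheta (p theta : R) F A : \bar R :=
  (\int[tuple_product (lebesgue_rV n) k.+1]_(x in A)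
    ((1 - theta) ^+ k * `|F x| `^ p
     / (\prod_(i < k) enorm (tnth (edges x) i)) `^ (n%:R + theta * p))%:E)%E.

Definition seminorm (s : seminorm_kind) E (r c p : R) F : \bar R :=
  (limf_esup (fun theta : R => Ntheta p theta F (seminorm_domain s E r c)) 1^'-
   `^ p^-1)%E.

Definition liminf_seminorm (s : seminorm_kind) E (r c p : R) F : \bar R :=
  (limf_einf (fun theta : R => Ntheta p theta F (seminorm_domain s E r c)) 1^'-
   `^ p^-1)%E.

End seminorms.

(* Main.v *)
Require Import Defs.
From HB Require Import structures.
From mathcomp Require Import all_boot all_order all_algebra.
From mathcomp Require Import all_classical all_reals all_analysis.
From mathcomp Require Import measurable_realfun.
From mathcomp Require Import perm ring lra zify.
Set Implicit Arguments.
Unset Strict Implicit.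
Unset Printing Implicit Defensive.

Import Order.TTheory GRing.Theory Num.Theory.
Import numFieldNormedType.Exports.

Local Open Scope classical_set_scope.
Local Open Scope ring_scope.

(** Write [Phi x] for the [p]-th power of the spherical norm of [w x], the integral
    of [|w x (u_1, ..., u_k)|^p] over all [k]-tuples of unit vectors ([snorm_pow]).

    Put [x_i = x_0 + h_i] and [h_i = |h_i| u_i]. Since [w x] is multilinear, the
    integrand of the seminorm is a mean of [w] over a simplex, evaluated at the
    frame [u] and raised to the power [p], times the product over the edges of the
    kernel [(1 - theta) |h_i|^p / |h_i|^(n + theta p)]. The kernel is barely
    integrable: its mass on the ball of radius [delta] is finite for [theta < 1]
    and, as [theta] tends to 1, converges to a positive limit independent of
    [delta] ([mass_limit]); so the kernel concentrates at [h = 0], where the mean of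
    [w] over the simplex is [w x_0] times the volume [v] of the standard simplex.
    The directions [u_i] being uniformly distributed on the sphere, the seminorm
    tends to a constant times the integral of [Phi].

    This is made precise by two bounds for simplices with edges shorter than
    [delta]. From above ([Ntheta_le]), Jensen's inequality on the simplex and the
    translation invariance of Lebesgue measure give the expected constant without
    error. From below ([Ntheta_ge]), the mean is compared with [w x_0], and the
    error is small with [delta] because translations are continuous in [L^p]
    ([translation_continuous]). Each of the four domains of integration lies
    between the short simplices based well inside [Omega] and the simplices with
    edges shorter than some fixed length, which exists because [Omega] is bounded
    or because the domain bounds the edges; the integral increases with the domain
    ([nonneg_integral_le]). The statement follows by letting [theta] tend to 1 and
    then exhausting [Omega] ([Ntheta_squeeze]).

    The uniform distribution of directions ([radial_transfer]) avoids any formula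
    for the area of the sphere. The image of a radial density under [x |-> x / |x|]
    and the Hausdorff measure of the sphere are both invariant under reflections,
    which act transitively on the sphere, so that both give balls centred on the
    sphere a measure depending on the radius only; by Christensen's theorem
    ([uniform_measure_proportional]) they are proportional. This requires the
    Hausdorff measure to be a measure on Borel sets, by Caratheodory's criterion
    ([hausdorff_caratheodory]), and the sphere to have positive finite measure
    ([sphere_measure_gt0], [sphere_measure_lty]). *)


(** * Euclidean norm and balls *)

Section euclid.
Variables (R : realType) (n : nat).
Implicit Types (x y v : 'rV[R]_n) (U : set 'rV[R]_n).

Lemma enorm_ge0 v : 0 <= enorm v. Proof. exact: sqrtr_ge0. Qed.

Lemma enorm_sqr v : enorm v ^+ 2 = \sum_i v ord0 i ^+ 2.
Proof. by rewrite sqr_sqrtr// sumr_ge0// => i _; rewrite sqr_ge0. Qed.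

Lemma enormZ (a : R) v : enorm (a *: v) = `|a| * enorm v.
Proof.
rewrite /enorm (eq_bigr (fun i => a ^+ 2 * v ord0 i ^+ 2)); last first.
  by move=> i _; rewrite mxE exprMn.
by rewrite -mulr_sumr sqrtrM ?sqr_ge0// sqrtr_sqr.
Qed.

Lemma enormN v : enorm (- v) = enorm v.
Proof. by rewrite -scaleN1r enormZ normrN1 mul1r. Qed.

Lemma enorm0 : enorm (0 : 'rV[R]_n) = 0.
Proof. by rewrite -(scale0r 0) enormZ normr0 mul0r. Qed.

Lemma enormC x y : enorm (x - y) = enorm (y - x).
Proof. by rewrite -enormN opprB. Qed.

Lemma coord_le_enorm v i : `|v ord0 i| <= enorm v.
Proof.
rewrite -(@ler_pXn2r _ 2)// ?nnegrE ?enorm_ge0// enorm_sqr real_normK ?num_real//.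
by rewrite (bigD1 i)//= lerDl sumr_ge0// => j _; rewrite sqr_ge0.
Qed.

Lemma enorm_eq0 v : enorm v = 0 -> v = 0.
Proof.
move=> v0; apply/rowP => i; rewrite mxE; apply/eqP.
by rewrite -normr_le0 -v0 coord_le_enorm.
Qed.

Lemma enorm_gt0 v : (0 < enorm v) = (v != 0).
Proof.
rewrite lt_def enorm_ge0 andbT; congr negb; apply/eqP/eqP => [/enorm_eq0//|->].
exact: enorm0.
Qed.

Definition dotp x y := \sum_i x ord0 i * y ord0 i.

Lemma enormD_sqr x y :
  enorm (x + y) ^+ 2 = enorm x ^+ 2 + 2 * dotp x y + enorm y ^+ 2.
Proof.
rewrite !enorm_sqr /dotp mulr_sumr -!big_split/=; apply: eq_bigr => i _.
by rewrite mxE; ring.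
Qed.

(** Cauchy-Schwarz, from [2 ab <= a^2 + b^2] applied to normalised vectors. *)
Lemma dotp_le x y : dotp x y <= enorm x * enorm y.
Proof.
have [->|x0] := eqVneq x 0.
  by rewrite enorm0 mul0r /dotp big1// => i _; rewrite mxE mul0r.
have [->|y0] := eqVneq y 0.
  by rewrite enorm0 mulr0 /dotp big1// => i _; rewrite mxE mulr0.
have := sqr_ge0 (enorm (enorm y *: x + (- enorm x) *: y)).
rewrite -enorm_gt0 in x0; rewrite -enorm_gt0 in y0.
rewrite enormD_sqr !enormZ normrN !ger0_norm ?enorm_ge0//.
have -> : dotp (enorm y *: x) (- enorm x *: y) = - (enorm x * enorm y) * dotp x y.
  by rewrite /dotp mulr_sumr; apply: eq_bigr => i _; rewrite !mxE; ring.
have xy0 : 0 < enorm x * enorm y by rewrite mulr_gt0.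
by nra.
Qed.

Lemma enormD x y : enorm (x + y) <= enorm x + enorm y.
Proof.
rewrite -(@ler_pXn2r _ 2)// ?nnegrE ?addr_ge0 ?enorm_ge0// enormD_sqr.
by have := dotp_le x y; nra.
Qed.

Lemma enormB_le x y v : enorm (x - y) <= enorm (x - v) + enorm (v - y).
Proof. by rewrite (le_trans _ (enormD _ _))// addrA subrK. Qed.

Lemma enorm_le_sum v : enorm v <= \sum_i `|v ord0 i|.
Proof.
rewrite -(@ler_pXn2r _ 2)// ?nnegrE ?enorm_ge0 ?sumr_ge0// enorm_sqr.
rewrite expr2 mulr_suml; apply: ler_sum => i _.
rewrite -[leLHS]real_normK ?num_real// expr2 ler_wpM2l//.
by rewrite (bigD1 i)//= lerDl sumr_ge0.
Qed.

Definition eball x (r : R) : set 'rV[R]_n := [set y | enorm (y - x) < r].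

(** Open sets in terms of Euclidean balls; [open_eopen] compares them with those of
    the sup norm. *)
Definition eopen U := forall x, U x -> exists2 e : R, 0 < e & eball x e `<=` U.

(** The points at distance at least [1/(m+1)] from the complement of [U]; these
    sets exhaust an open [U] from inside. *)
Definition inner U (m : nat) : set 'rV[R]_n :=
  [set x | eball x m.+1%:R^-1 `<=` U].

Lemma eball_center x r : 0 < r -> eball x r x.
Proof. by rewrite /eball/= subrr enorm0. Qed.

Lemma eball_sym x y r : eball x r y -> eball y r x.
Proof. by rewrite /eball/= enormC. Qed.

Lemma eopen_eball x r : eopen (eball x r).
Proof.
move=> y xy; exists (r - enorm (y - x)); first by rewrite subr_gt0.
move=> z yz; rewrite /eball/= (le_lt_trans (enormB_le _ _ y))//.
by move: yz; rewrite /eball/= ltrBrDr.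
Qed.

Lemma eopenI U V : eopen U -> eopen V -> eopen (U `&` V).
Proof.
move=> oU oV x [/oU[e e0 eU] /oV[f f0 fV]].
exists (Order.min e f); first by rewrite lt_min e0.
by move=> y; rewrite /eball/= lt_min => /andP[? ?]; split; [apply: eU|apply: fV].
Qed.

Lemma open_eopen U : open U -> eopen U.
Proof.
move=> oU x Ux; have /nbhs_ballP[e /= e0 eU] : nbhs x U by exact: open_nbhs_nbhs.
exists e => // y xy; apply: eU; split => // i j; rewrite /ball/= (ord1 i).
have := coord_le_enorm (y - x) j; rewrite !mxE distrC => /le_lt_trans; exact.
Qed.

Lemma inner_sub U m : inner U m `<=` U.
Proof. by move=> x; apply; apply: eball_center; rewrite invr_gt0. Qed.

Lemma inner_nd U : nondecreasing_seq (inner U).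
Proof.
move=> i j ij; apply/subsetPset => x xi y xy; apply: xi.
move: xy; rewrite /eball/= => /lt_le_trans; apply.
by rewrite lef_pV2 ?posrE// ler_nat.
Qed.

Lemma bigcup_inner U : eopen U -> \bigcup_m inner U m = U.
Proof.
move=> oU; apply/seteqP; split => [x [m _ /inner_sub]//|x Ux].
have [e e0 eU] := oU x Ux.
have := @near_infty_natSinv_lt R (PosNum e0); case=> N _ /(_ N (leqnn N)) /= Ne.
by exists N => // y xy; apply: eU; move: xy; rewrite /eball/= => /lt_trans; apply.
Qed.

Lemma rat_row_dense x e : 0 < e ->
  exists q : 'rV[rat]_n, enorm (x - map_mx ratr q) < e.
Proof.
move=> e0; pose d := e / n.+1%:R.
have d0 : 0 < d by rewrite divr_gt0.
have hq i : exists q : rat, `|x ord0 i - ratr q| < d.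
  have [q] := @rat_in_itvoo R (x ord0 i) (x ord0 i + d) ltac:(lra).
  by rewrite in_itv/= => /andP[? ?]; exists q; rewrite ltr_norml; lra.
have [q Hq] := choice hq; exists (\row_i q i).
apply: le_lt_trans (enorm_le_sum _) _.
apply: (@le_lt_trans _ _ (\sum_(i < n) d)).
  by apply: ler_sum => i _; rewrite !mxE ltW.
rewrite sumr_const card_ord -mulr_natr /d -mulrA -[ltRHS]mulr1 ltr_pM2l//.
by rewrite mulrC ltr_pdivrMr// mul1r ltr_nat.
Qed.

End euclid.

(** * Borel sets *)

Section borel.
Variables (R : realType) (n : nat).
Implicit Types (x y v : 'rV[R]_n) (U : set 'rV[R]_n).

Lemma measurable_rowP d (T : measurableType d) (f : T -> 'rV[R]_n) :
  (forall i, measurable_fun setT (fun t => f t ord0 i)) -> measurable_fun setT f.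
Proof.
move=> mf _ Y mY; rewrite setTI.
suff: g_sigma_preimage (fun (i : 'I_n) (v : 'rV[R]_n) => v ord0 i) `<=`
  [set A | measurable (f @^-1` A)] by exact.
apply: smallest_sub.
  split => /=.
  - by rewrite preimage_set0.
  - by move=> A mA; rewrite setTD preimage_setC; exact: measurableC.
  - by move=> F mF; rewrite preimage_bigcup; exact: bigcupT_measurable.
move=> A; rewrite -bigcup_seq => -[i _ [B mB <-]] /=; rewrite setTI.
by have := mf i measurableT B mB; rewrite setTI.
Qed.

Lemma measurable_coord_comp d (T : measurableType d) (f : T -> 'rV[R]_n) i :
  measurable_fun setT f -> measurable_fun setT (fun t => f t ord0 i).
Proof. by move=> mf; exact: measurableT_comp (@measurable_coord R n i) mf. Qed.

Lemma measurable_sqrt : measurable_fun setT (@Num.sqrt R).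
Proof.
apply: continuous_measurable_fun; exact: sqrt_continuous.
Qed.

Lemma measurable_enorm : measurable_fun setT (@enorm R n).
Proof.
apply: measurableT_comp measurable_sqrt _.
apply: measurable_sum => i; apply: measurable_funX; exact: measurable_coord.
Qed.

Lemma measurable_rowD d (T : measurableType d) (f g : T -> 'rV[R]_n) :
  measurable_fun setT f -> measurable_fun setT g ->
  measurable_fun setT (fun t => f t + g t).
Proof.
move=> mf mg; apply: measurable_rowP => i; under eq_fun do rewrite mxE.
by apply: measurable_funD; exact: measurable_coord_comp.
Qed.

Lemma measurable_rowZ d (T : measurableType d) (a : T -> R) (g : T -> 'rV[R]_n) :
  measurable_fun setT a -> measurable_fun setT g ->
  measurable_fun setT (fun t => a t *: g t).
Proof.
move=> ma mg; apply: measurable_rowP => i; under eq_fun do rewrite mxE.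
by apply: measurable_funM => //; exact: measurable_coord_comp.
Qed.

Lemma measurable_rowB d (T : measurableType d) (f g : T -> 'rV[R]_n) :
  measurable_fun setT f -> measurable_fun setT g ->
  measurable_fun setT (fun t => f t - g t).
Proof.
move=> mf mg; apply: measurable_rowP => i; under eq_fun do rewrite 2!mxE.
by apply: measurable_funB; exact: measurable_coord_comp.
Qed.

Lemma measurable_enorm_comp d (T : measurableType d) (f : T -> 'rV[R]_n) :
  measurable_fun setT f -> measurable_fun setT (fun t => enorm (f t)).
Proof. by move=> mf; exact: measurableT_comp measurable_enorm mf. Qed.

Lemma measurable_ltr_set d (T : measurableType d) (f g : T -> R) :
  measurable_fun setT f -> measurable_fun setT g ->
  measurable [set t | f t < g t].
Proof.
move=> mf mg; have := measurable_fun_ltr mf mg.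
by move=> /(_ measurableT [set true] I); rewrite setTI.
Qed.

Lemma measurable_ler_set d (T : measurableType d) (f g : T -> R) :
  measurable_fun setT f -> measurable_fun setT g ->
  measurable [set t | f t <= g t].
Proof.
move=> mf mg; have := measurable_fun_ler mf mg.
by move=> /(_ measurableT [set true] I); rewrite setTI.
Qed.

Lemma measurable_eball x r : measurable (eball x r).
Proof.
apply: measurable_ltr_set => //; apply: measurable_enorm_comp.
by apply: measurable_rowB => //; exact: measurable_cst.
Qed.

(** An open set is a union of balls with rational centres and radii [1/(m+1)]. *)
Lemma eopen_measurable U : eopen U -> measurable U.
Proof.
move=> oU; pose q (i : 'rV[rat]_n) : 'rV[R]_n := map_mx ratr i.
have -> : U = \bigcup_(m : nat) \bigcup_(i in [set: 'rV[rat]_n])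
    (if `[< eball (q i) m.+1%:R^-1 `<=` U >] then eball (q i) m.+1%:R^-1 else set0).
  apply/seteqP; split => [x Ux|x [m _ [i _]]]; last by case: asboolP => // h /h.
  have [e e0 eU] := oU x Ux.
  have e20 : 0 < e / 2 by rewrite divr_gt0.
  have := @near_infty_natSinv_lt R (PosNum e20); case=> N _ /(_ N (leqnn N)) /= Ne.
  exists N => //; have [|i xi] := @rat_row_dense R n x N.+1%:R^-1.
    by rewrite invr_gt0.
  exists i => //; case: asboolP => //; case=> y; rewrite /eball/= => yi.
  apply: eU; rewrite /eball/= (le_lt_trans (enormB_le _ _ (q i)))//.
  move: Ne yi xi; rewrite (enormC x) /q; set a := enorm _; set b := enorm _; set t := _^-1.
  by move=> *; lra.
apply: bigcupT_measurable => m; apply: countable_bigcupT_measurable.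
  exact: countableP.
by move=> i; case: asboolP => _ //; exact: measurable_eball.
Qed.

(** Coordinates are continuous, hence Borel, and conversely open sets are
    measurable. *)
Lemma measurable_eopenE : @measurable _ 'rV[R]_n = <<s [set U | eopen U] >>.
Proof.
apply/seteqP; split; last first.
  apply: smallest_sub; first exact: sigma_algebra_measurable.
  by move=> U; exact: eopen_measurable.
apply: smallest_sub; first exact: smallest_sigma_algebra.
move=> A; rewrite -bigcup_seq => -[i _ [B mB <-]]; rewrite setTI.
pose T := g_sigma_algebraType [set U : set 'rV[R]_n | eopen U].
have : measurable_fun setT (fun v : T => v ord0 i).
  apply: (measurability _ (RGenOInfty.measurableE R)) => _ [_ [a ->] <-].
  rewrite setTI; apply: sub_gen_smallest => x /=; rewrite in_itv/= andbT => ax.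
  exists (x ord0 i - a); first by rewrite subr_gt0.
  move=> y; rewrite /eball/= in_itv/= andbT => xy.
  have := coord_le_enorm (y - x) i; rewrite !mxE ler_norml => /andP[]; lra.
by move=> /(_ measurableT B mB); rewrite setTI.
Qed.

(** Open sets are a pi-system generating the Borel sets; the exhaustion by balls
    reduces to bounded ones and provides sigma-finiteness. *)
Lemma eopen_measure_unique (m1 m2 : {measure set 'rV[R]_n -> \bar R}) :
  (forall r, m1 (eball 0 r) < +oo)%E ->
  (forall U r, eopen U -> U `<=` eball 0 r -> m1 U = m2 U) ->
  forall A, measurable A -> m1 A = m2 A.
Proof.
move=> m1oo m12.
have cover : \bigcup_(k : nat) eball 0 k%:R = [set: 'rV[R]_n].
  apply/seteqP; split => // x _.
  exists (Num.truncn (enorm x)).+1 => //; rewrite /eball/= subr0.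
  by rewrite truncnS_gt.
have cvg_ball (m : {measure set 'rV[R]_n -> \bar R}) U : eopen U ->
    m (U `&` eball 0 k%:R) @[k --> \oo] --> m U.
  move=> oU; have {2}-> : U = \bigcup_(k : nat) (U `&` eball 0 k%:R).
    by rewrite -setI_bigcupr cover setIT.
  have mU k : measurable (U `&` eball 0 k%:R).
    by apply: measurableI; [exact: eopen_measurable|exact: measurable_eball].
  apply: nondecreasing_cvg_mu => //; first exact: bigcupT_measurable.
  move=> i j ij; apply/subsetPset => x [Ux xi]; split => //.
  by move: xi; rewrite /eball/= => /lt_le_trans; apply; rewrite ler_nat.
apply: (measure_unique [set U | eopen U] (fun k : nat => eball 0 k%:R)) => //.
- exact: measurable_eopenE.
- by move=> U V; exact: eopenI.
- by move=> k; exact: eopen_eball.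
- move=> U oU; apply: (cvg_unique _ (cvg_ball m1 U oU)) => //.
  apply: cvg_trans (cvg_ball m2 U oU); apply: near_eq_cvg; near=> k.
  apply/esym; apply: (m12 _ k%:R); last exact: subIsetr.
  by apply: eopenI => //; exact: eopen_eball.
Unshelve. all: by end_near. Qed.

End borel.

(** * Powers of a measure *)

Lemma tnth_tcons0 (T : Type) n (z : T * n.-tuple T) : tnth (tcons z) ord0 = z.1.
Proof. exact: tnth0. Qed.

Lemma tnth_tconsS (T : Type) n (z : T * n.-tuple T) i :
  tnth (tcons z) (lift ord0 i) = tnth z.2 i.
Proof. by rewrite /tcons tnthS. Qed.

Section tuple_product_integral.
Local Open Scope ereal_scope.

Lemma ge0_integral_pushforwardT d1 d2 (X : measurableType d1)
    (Y : measurableType d2) (R : realType) (mu : {measure set X -> \bar R})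
    (phi : X -> Y) (f : Y -> \bar R) :
  measurable_fun setT phi -> measurable_fun setT f -> (forall y, 0 <= f y) ->
  \int[pushforward mu phi]_y f y = \int[mu]_x f (phi x).
Proof.
by move=> mphi mf f0; rewrite (ge0_integral_pushforward mphi) ?preimage_setT.
Qed.

Lemma tuple_product0_integral d (T : measurableType d) (R : realType)
    (m : set T -> \bar R) (f : 0.-tuple T -> \bar R) :
  measurable_fun setT f -> \int[tuple_product m 0]_t f t = f [tuple].
Proof. by move=> mf; rewrite /= integral_dirac// diracT mul1e. Qed.

Context d (T : measurableType d) (R : realType).
Variable m : {sigma_finite_measure set T -> \bar R}.

Lemma tuple_product_integral n (f : n.+1.-tuple T -> \bar R) :
  measurable_fun setT f -> (forall t, 0 <= f t) ->
  \int[tuple_product m n.+1]_t f t =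
  \int[m]_x \int[tuple_product m n]_t f (tcons (x, t)).
Proof.
move=> mf f0.
have mft : measurable_fun setT (f \o @tcons T n).
  exact: measurableT_comp mf (@measurable_tcons _ T n).
rewrite [LHS](@ge0_integral_pushforwardT _ _ _ _ _ (m \x tuple_product m n)%E)//.
  exact: fubini_tonelli1.
exact: measurable_tcons.
Qed.

Lemma measurable_tuple_product_inner n (f : n.+1.-tuple T -> \bar R) :
  measurable_fun setT f -> (forall t, 0 <= f t) ->
  measurable_fun setT (fun x => \int[tuple_product m n]_t f (tcons (x, t))).
Proof.
move=> mf f0.
have mft : measurable_fun setT (f \o @tcons T n).
  exact: measurableT_comp mf (@measurable_tcons _ T n).
exact: (@measurable_fun_fubini_tonelli_F _ _ _ _ _ (tuple_product m n) _ mft (fun=> f0 _)).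
Qed.

End tuple_product_integral.

Section tuple_product_transfer.
Local Open Scope ereal_scope.
Context d d' (T : measurableType d) (T' : measurableType d') (R : realType).
Variables (m : {sigma_finite_measure set T -> \bar R}).
Variables (m' : {sigma_finite_measure set T' -> \bar R}).
Variables (rho : T -> R) (c : R).
Hypotheses (mrho : measurable_fun setT rho) (rho0 : forall x, (0 <= rho x)%R).
Hypothesis c0 : (0 <= c)%R.

Definition tuple_map n (phi : 'I_n -> T -> T') (t : n.-tuple T) : n.-tuple T' :=
  [tuple phi i (tnth t i) | i < n].

Lemma measurable_tuple_map n (phi : 'I_n -> T -> T') :
  (forall i, measurable_fun setT (phi i)) -> measurable_fun setT (tuple_map phi).
Proof.
move=> mphi; apply/measurable_fun_tnthP => i.
rewrite (_ : _ \o _ = phi i \o fun t => tnth t i); last first.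
  by apply/funext => t /=; rewrite tnth_mktuple.
by apply: measurableT_comp => //; exact: measurable_tnth.
Qed.

Lemma measurable_prod_tnth n :
  measurable_fun setT (fun t : n.-tuple T => \prod_i rho (tnth t i))%R.
Proof.
apply: measurable_prod => i _; apply: measurableT_comp => //.
exact: measurable_tnth.
Qed.

(** By induction on [n] through Fubini. The lemma serves for translating the
    vertices of a simplex, for polar coordinates in each edge and, with [phi]
    constant, for computing the total mass of a product density. *)
Lemma tuple_product_transfer n (phi : 'I_n -> T -> T') :
  (forall i, measurable_fun setT (phi i)) ->
  (forall i (u : T' -> \bar R), measurable_fun setT u -> (forall y, 0 <= u y) ->
    \int[m]_x ((rho x)%:E * u (phi i x)) = c%:E * \int[m']_y u y) ->
  forall g : n.-tuple T' -> \bar R, measurable_fun setT g -> (forall t, 0 <= g t) ->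
  \int[tuple_product m n]_t ((\prod_i rho (tnth t i))%:E * g (tuple_map phi t)) =
  (c ^+ n)%:E * \int[tuple_product m' n]_t g t.
Proof.
elim: n phi => [|n IHn] phi mphi H g mg g0.
  rewrite !tuple_product0_integral//; last first.
    apply: emeasurable_funM; first by apply/measurable_EFinP; exact: measurable_prod_tnth.
    by apply: measurableT_comp => //; exact: measurable_tuple_map.
  by rewrite big_ord0 expr0 !mul1e; congr g; rewrite tuple0.
rewrite tuple_product_integral//; last 2 first.
- apply: emeasurable_funM; first by apply/measurable_EFinP; exact: measurable_prod_tnth.
  by apply: measurableT_comp => //; exact: measurable_tuple_map.
- by move=> t; rewrite mule_ge0// lee_fin prodr_ge0.
pose phi' i := phi (lift ord0 i).
pose u y := \int[tuple_product m' n]_t g (tcons (y, t)).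
have mg' y : measurable_fun setT (fun t => g (tcons (y, t))).
  apply: measurableT_comp => //; apply: measurableT_comp; first exact: measurable_tcons.
  exact: measurable_fun_pair.
have u0 y : 0 <= u y by exact: integral_ge0.
have mu : measurable_fun setT u by exact: measurable_tuple_product_inner.
transitivity (\int[m]_x ((c ^+ n)%:E * ((rho x)%:E * u (phi ord0 x)))).
  apply: eq_integral => x _; rewrite muleCA /u.
  rewrite -(IHn phi' _ _ (fun t => g (tcons (phi ord0 x, t))))//; last 2 first.
  - by move=> i; exact: mphi.
  - by move=> i; exact: H.
  rewrite -ge0_integralZl//; last 3 first.
  - apply: emeasurable_funM; first by apply/measurable_EFinP; exact: measurable_prod_tnth.
    apply: (measurableT_comp (mg' (phi ord0 x))).
    by apply: measurable_tuple_map => i; exact: mphi.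
  - by move=> t _; rewrite mule_ge0// lee_fin prodr_ge0.
  - by rewrite lee_fin.
  apply: eq_integral => t _; rewrite big_ord_recl EFinM -muleA.
  congr (_ * (_ * _)).
    by congr EFin; apply: eq_bigr => i _; rewrite tnth_tconsS.
  congr g; apply: eq_from_tnth => i; rewrite tnth_mktuple.
  case: (unliftP ord0 i) => [j ->|->]; last by rewrite !tnth_tcons0.
  by rewrite !tnth_tconsS tnth_mktuple.
rewrite ge0_integralZl//; last 3 first.
- apply: emeasurable_funM; first exact/measurable_EFinP.
  exact: measurableT_comp.
- by move=> x _; rewrite mule_ge0// lee_fin.
- by rewrite lee_fin exprn_ge0.
rewrite H// [in RHS]tuple_product_integral// exprSr EFinM muleA.
by congr (_ * _); rewrite muleC.
Qed.

End tuple_product_transfer.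

(** * Lebesgue measure *)

Section lebesgue_line.
Local Open Scope ereal_scope.
Context {R : realType}.
Notation mu := (@lebesgue_measure R).

Lemma lebesgue_integral_translate (a : R) (f : R -> \bar R) :
  measurable_fun setT f -> (forall y, 0 <= f y) ->
  \int[mu]_x f (x + a)%R = \int[mu]_x f x.
Proof.
move=> mf f0.
have ma : measurable_fun setT ((fun x => x + a)%R : measurableTypeR R -> measurableTypeR R).
  exact: measurable_funD.
rewrite -(ge0_integral_pushforwardT mu ma mf f0).
apply: eq_measure_integral => //= A mA _; apply/esym.
apply: lebesgue_measure_unique => //= _ [[b c]] _ <-.
rewrite /pushforward (_ : _ @^-1` _ = `]b - a, c - a]%classic)%R; last first.
  by apply/seteqP; split => x /=; rewrite !in_itv/= => /andP[? ?]; lra.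
rewrite !lebesgue_measure_itv/= !lte_fin ltrD2r; case: ifP => // _.
by rewrite !EFinN -!EFinD; congr EFin; lra.
Qed.

Lemma lebesgue_integral_dilate (s : R) (f : R -> \bar R) : (0 < s)%R ->
  measurable_fun setT f -> (forall y, 0 <= f y) ->
  \int[mu]_x f (s * x)%R = (s^-1)%:E * \int[mu]_x f x.
Proof.
move=> s0 mf f0.
have ms : measurable_fun setT ((fun x => s * x)%R : measurableTypeR R -> measurableTypeR R).
  exact: measurable_funM.
have s10 : (0 <= s^-1)%R by rewrite invr_ge0 ltW.
rewrite -(ge0_integral_pushforwardT mu ms mf f0).
rewrite -[s^-1%R]/((NngNum s10)%:num)%R -ge0_integral_mscale//.
apply: eq_measure_integral => A mA _.
pose fs : measurableTypeR R -> measurableTypeR R := (fun x => s * x)%R.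
have : mu A = pushforward (mscale (NngNum (ltW s0)) mu) fs A.
  apply: lebesgue_measure_unique => //= _ [[b c]] _ <-.
  rewrite /pushforward /mscale/= (_ : _ @^-1` _ = `]b / s, c / s]%classic)%R; last first.
    apply/seteqP; split => x /=; rewrite !in_itv/= ltr_pdivrMr// ler_pdivlMr//;
      by rewrite mulrC.
  rewrite !lebesgue_measure_itv/= !lte_fin ltr_pM2r ?invr_gt0//; case: ifP => // _.
    by rewrite -EFinM; congr EFin; field; rewrite gt_eqF.
  by rewrite mule0.
move=> muA; rewrite /= /mscale/= [in RHS]muA /pushforward /mscale/= muleA -EFinM.
by rewrite mulVf ?mul1e// gt_eqF.
Qed.

End lebesgue_line.

Section lebesgue_space.
Local Open Scope ereal_scope.
Variables (R : realType) (n : nat).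
Notation L := (@lebesgue_rV R n).
Implicit Types (v : 'rV[R]_n) (f : 'rV[R]_n -> \bar R).

Lemma lebesgue_rV_integral f : measurable_fun setT f -> (forall v, 0 <= f v) ->
  \int[L]_v f v = \int[tuple_product (@lebesgue_measure R) n]_t f (row_of_tuple t).
Proof.
move=> mf f0; rewrite [LHS]ge0_integral_pushforwardT//.
exact: measurable_row_of_tuple.
Qed.

Lemma measurable_row_of_tuple_comp f : measurable_fun setT f ->
  measurable_fun setT (fun t => f (row_of_tuple t)).
Proof. by move=> mf; exact: measurableT_comp mf (@measurable_row_of_tuple R n). Qed.

Lemma integral_translate (a : 'rV[R]_n) f :
  measurable_fun setT f -> (forall y, 0 <= f y) ->
  \int[L]_x f (x + a)%R = \int[L]_x f x.
Proof.
move=> mf f0; rewrite !lebesgue_rV_integral//; last first.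
  by apply: measurableT_comp => //; exact: measurable_rowD.
pose phi (i : 'I_n) := (fun x => x + a ord0 i)%R : measurableTypeR R -> measurableTypeR R.
have := @tuple_product_transfer _ _ (measurableTypeR R) (measurableTypeR R) R
  (@lebesgue_measure R) (@lebesgue_measure R) (cst 1%R) 1%R (measurable_cst _)
  (fun=> ler01) ler01 n phi _ _ _ (measurable_row_of_tuple_comp mf) (fun=> f0 _).
rewrite expr1n mul1e => <-.
- apply: eq_integral => t _; rewrite big1// mul1e; congr f.
  by apply/rowP => i; rewrite !mxE tnth_mktuple.
- by move=> i; exact: measurable_funD.
- move=> i u mu u0; rewrite mul1e -[RHS](lebesgue_integral_translate (a ord0 i))//.
  by apply: eq_integral => x _; rewrite mul1e.
Qed.

Lemma integral_dilate (s : R) f : (0 < s)%R ->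
  measurable_fun setT f -> (forall y, 0 <= f y) ->
  \int[L]_x f (s *: x)%R = (s^-1 ^+ n)%:E * \int[L]_x f x.
Proof.
move=> s0 mf f0; rewrite !lebesgue_rV_integral//; last first.
  by apply: measurableT_comp => //; exact: measurable_rowZ.
pose phi (i : 'I_n) := (fun x => s * x)%R : measurableTypeR R -> measurableTypeR R.
have s10 : (0 <= s^-1)%R by rewrite invr_ge0 ltW.
have := @tuple_product_transfer _ _ (measurableTypeR R) (measurableTypeR R) R
  (@lebesgue_measure R) (@lebesgue_measure R) (cst 1%R) (s^-1)%R (measurable_cst _)
  (fun=> ler01) s10 n phi _ _ _ (measurable_row_of_tuple_comp mf) (fun=> f0 _).
move=> <-.
- apply: eq_integral => t _; rewrite big1// mul1e; congr f.
  by apply/rowP => i; rewrite !mxE tnth_mktuple.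
- by move=> i; exact: measurable_funM.
- move=> i u mu u0; rewrite -(lebesgue_integral_dilate s0)//.
  by apply: eq_integral => x _; rewrite mul1e.
Qed.

Lemma measure_integral_indic (A : set 'rV[R]_n) : measurable A ->
  L A = \int[L]_v (\1_A v)%:E.
Proof. by move=> mA; rewrite integral_indic// setIT. Qed.

Lemma measurable_preimageT d d' (X : measurableType d) (Y : measurableType d')
  (f : X -> Y) (A : set Y) : measurable_fun setT f -> measurable A ->
  measurable (f @^-1` A).
Proof. by move=> mf mA; rewrite -[X in measurable X]setTI; exact: mf. Qed.

Lemma lebesgue_rV_translate (a : 'rV[R]_n) (A : set 'rV[R]_n) : measurable A ->
  L ((fun x => x + a)%R @^-1` A) = L A.
Proof.
move=> mA; rewrite !measure_integral_indic//; last first.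
  by apply: measurable_preimageT => //; exact: measurable_rowD.
rewrite -[RHS](integral_translate a)//.
exact/measurable_EFinP.
Qed.

Lemma tuple_product_box d (T : measurableType d)
    (m : {sigma_finite_measure set T -> \bar R}) k (A : 'I_k -> set T) :
  (forall i, measurable (A i)) ->
  tuple_product m k [set t | forall i, A i (tnth t i)] = \prod_i m (A i).
Proof.
elim: k A => [|k IH] A mA.
  by rewrite big_ord0 /= diracE mem_set//= => -[].
rewrite big_ord_recl -IH//= /pushforward.
rewrite -product_measure1E//; last first.
  have -> : [set t : k.-tuple T | forall i, A (lift ord0 i) (tnth t i)] =
            \bigcap_(i in [set: 'I_k]) (fun t : k.-tuple T => tnth t i) @^-1` A (lift ord0 i).
    by apply/seteqP; split => t /= h i; [move=> _|]; exact: h.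
  apply: fin_bigcap_measurable => // i _.
  apply: measurable_preimageT => //; exact: measurable_tnth.
congr (_ _); apply/seteqP; split => -[x t]/=.
  move=> h; split; first by have := h ord0; rewrite tnth_tcons0.
  by move=> i; have := h (lift ord0 i); rewrite tnth_tconsS.
move=> [h0 h] i; case: (unliftP ord0 i) => [j ->|->].
  by rewrite tnth_tconsS; exact: h.
by rewrite tnth_tcons0.
Qed.

Lemma measurable_box (r : 'I_n -> R) :
  measurable [set v : 'rV[R]_n | forall i, `|v ord0 i| <= r i]%R.
Proof.
have -> : [set v : 'rV[R]_n | forall i, `|v ord0 i| <= r i]%R =
    \bigcap_(i in [set: 'I_n]) [set v : 'rV[R]_n | `|v ord0 i| <= r i]%R.
  by apply/seteqP; split => t /= h i; [move=> _|]; exact: h.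
apply: fin_bigcap_measurable => // i _; apply: measurable_ler_set => //.
by apply: measurableT_comp => //; exact: measurable_coord.
Qed.

Lemma lebesgue_rV_box (r : 'I_n -> R) : (forall i, 0 <= r i)%R ->
  L [set v | forall i, `|v ord0 i| <= r i]%R = (\prod_i (2 * r i))%R%:E.
Proof.
move=> r0; rewrite /lebesgue_rV /pushforward.
transitivity (\prod_i (@lebesgue_measure R) `[(- r i)%R, r i]%classic); last first.
  rewrite -prodEFin; apply: eq_bigr => i _.
  rewrite lebesgue_measure_itv/= lte_fin; case: ltP => h.
    by rewrite -EFinD; congr EFin; lra.
  by congr EFin; have := r0 i; lra.
rewrite -tuple_product_box//; congr (_ _); apply/seteqP; split => t /= h i.
  by have := h i; rewrite mxE in_itv/= ler_norml.
by have := h i; rewrite mxE in_itv/= ler_norml.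
Qed.

Lemma lebesgue_eball_lty (x : 'rV[R]_n) r : L (eball x r) < +oo.
Proof.
rewrite -(lebesgue_rV_translate x); last exact: measurable_eball.
have [r0|r0] := ltP r 0%R.
  rewrite (_ : _ @^-1` _ = set0) ?measure0//.
  apply/seteqP; split => // y; rewrite /eball/= => /(le_lt_trans (enorm_ge0 _)).
  by move/(lt_trans r0); rewrite ltxx.
apply: (@le_lt_trans _ _ (L [set v | forall i, `|v ord0 i| <= r]%R)).
  apply: le_measure; rewrite ?inE.
  - apply: measurable_preimageT; first exact: measurable_rowD.
    exact: measurable_eball.
  - exact: (@measurable_box (fun=> _)).
  - move=> v; rewrite /eball/= addrK => vr i.
    by rewrite (le_trans (coord_le_enorm _ _))// ltW.
by rewrite (@lebesgue_rV_box (fun=> r))// ltry.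
Qed.

Lemma lebesgue_eball_gt0 (x : 'rV[R]_n) r : (0 < r)%R -> 0 < L (eball x r).
Proof.
move=> r0; rewrite -(lebesgue_rV_translate x); last exact: measurable_eball.
pose e := (r / n.+1%:R)%R.
have e0 : (0 < e)%R by rewrite divr_gt0.
apply: (@lt_le_trans _ _ (L [set v | forall i, `|v ord0 i| <= e]%R)).
  rewrite (@lebesgue_rV_box (fun=> e)) ?lte_fin ?prodr_gt0// => i.
    by move=> _; rewrite mulr_gt0.
  exact: ltW.
apply: le_measure; rewrite ?inE.
- exact: (@measurable_box (fun=> _)).
- apply: measurable_preimageT; first exact: measurable_rowD.
  exact: measurable_eball.
- move=> v vr; rewrite /eball/= addrK (le_lt_trans (enorm_le_sum _))//.
  apply: (@le_lt_trans _ _ (\sum_(i < n) e)%R); first exact: ler_sum.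
  rewrite sumr_const card_ord -mulr_natr /e -mulrA -[ltRHS]mulr1 ltr_pM2l//.
  by rewrite mulrC ltr_pdivrMr// mul1r ltr_nat.
Qed.

End lebesgue_space.

(** * Uniformly distributed measures *)

Section uniformly_distributed.
Local Open Scope ereal_scope.
Variables (R : realType) (n : nat).
Implicit Types (U V S : set 'rV[R]_n).

Lemma measurable_inner U k : measurable (inner U k).
Proof.
rewrite -[inner U k]setCK; apply: measurableC; apply: eopen_measurable => x.
move=> /existsNP[y /not_implyP[xy Uy]].
have : eball y k.+1%:R^-1 x by exact: eball_sym.
move=> /(@eopen_eball R n)[e e0 he]; exists e => // z /he zy; apply/existsNP; exists y.
by apply/not_implyP; split => //; exact: eball_sym.
Qed.

Lemma cvg_measure_inner (m : {measure set 'rV[R]_n -> \bar R}) U : eopen U ->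
  m (inner U k) @[k --> \oo] --> m U.
Proof.
move=> oU; rewrite -[in m U](bigcup_inner oU).
apply: nondecreasing_cvg_mu.
- exact: measurable_inner.
- by rewrite bigcup_inner//; exact: eopen_measurable.
- exact: inner_nd.
Qed.

(** Countably many balls of radius [r] centred on [S] cover [S]. *)
Lemma uniform_ball_gt0 (m : {measure set 'rV[R]_n -> \bar R}) S (r : R) :
  measurable S -> (0 < r)%R -> 0 < m S -> exists2 x, S x & 0 < m (eball x r).
Proof.
move=> mS r0 mS0; apply: contrapT => no.
have m0 x : S x -> m (eball x r) = 0.
  move=> Sx; apply/eqP; rewrite eq_le measure_ge0 andbT leNgt; apply/negP => h.
  by apply: no; exists x.
pose q (i : 'rV[rat]_n) : 'rV[R]_n := map_mx ratr i.
have hF k : exists A, [/\ m A = 0, measurable A &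
    forall i x, unpickle k = Some i -> S x -> eball (q i) (r / 2) x -> A x].
  case: (unpickle k) => [i|]; last by exists set0; split.
  have [[y [Sy iy]]|ny] := pselect (exists y, S y /\ eball (q i) (r / 2) y); last first.
    exists set0; split => //.
    by move=> j x [ij] Sx jx; apply: ny; exists x; rewrite ij.
  exists (eball y r); split; [exact: m0|exact: measurable_eball|].
  move=> j x [<-] _; move: iy; rewrite /eball/= => iy ix.
  rewrite (le_lt_trans (enormB_le _ _ (q i)))// [ltRHS]splitr ltrD//.
  by rewrite enormC.
have [F HF] := choice hF.
have : m S <= m (\bigcup_k F k).
  apply: le_measure; rewrite ?inE//.
    by apply: bigcupT_measurable => k; have [] := HF k.
  move=> x Sx; have [|i xi] := @rat_row_dense R n x (r / 2)%R.
    by rewrite divr_gt0.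
  exists (pickle i) => //; have [_ _] := HF (pickle i).
  by apply; [exact: pickleK|exact: Sx|exact: xi].
rewrite (_ : m (\bigcup_k F k) = 0) ?leNgt ?mS0//.
apply/negligibleP; first by apply: bigcupT_measurable => k; have [] := HF k.
by apply: negligible_bigcup => k; apply/negligibleP; have [] := HF k.
Qed.

Section two_measures.
Variables (m1 m2 : {sigma_finite_measure set 'rV[R]_n -> \bar R}).
Variables (S : set 'rV[R]_n) (g1 g2 : R -> \bar R).
Hypothesis mS : measurable S.
Hypotheses (m1S : forall A, measurable A -> m1 A = m1 (A `&` S))
           (m2S : forall A, measurable A -> m2 A = m2 (A `&` S)).
Hypotheses (m1B : forall x (r : R), S x -> (0 < r)%R -> m1 (eball x r) = g1 r)
           (m2B : forall x (r : R), S x -> (0 < r)%R -> m2 (eball x r) = g2 r).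

(** Both sides bound the [m1 \x m2]-measure of the pairs of points of [S] at
    distance less than [1/(k+1)] with second point in [U]. *)
Lemma uniform_inner_le U k : measurable U ->
  m1 (inner U k) * g2 (k.+1%:R^-1)%R <= g1 (k.+1%:R^-1)%R * m2 U.
Proof.
move=> mU; set r : R := (k.+1%:R^-1)%R; have r0 : (0 < r)%R by rewrite invr_gt0.
pose W : set ('rV[R]_n * 'rV[R]_n) :=
  [set z | [/\ S z.1, (U `&` S) z.2 & (enorm (z.1 - z.2) < r)%R]].
have mW : measurable W.
  have -> : W = (S `*` (U `&` S)) `&` [set z | (enorm (z.1 - z.2) < r)%R].
    by apply/seteqP; split => -[x y]/= [] //; case.
  apply: measurableI; first by apply: measurableX => //; exact: measurableI.
  apply: measurable_ltr_set; last exact: measurable_cst.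
  by apply: measurable_enorm_comp; apply: measurable_rowB.
have mf : measurable_fun setT (fun z => (\1_W z)%:E : \bar R).
  by apply/measurable_EFinP.
have E1 x : \int[m2]_y (\1_W (x, y))%:E = m2 [set y | W (x, y)].
  rewrite -[RHS](_ : \int[m2]_y (\1_[set y | W (x, y)] y)%:E = _)//.
  rewrite integral_indic ?setIT//.
  by have := measurable_xsection x mW; rewrite /xsection; under eq_set do rewrite in_setE.
have E2 y : \int[m1]_x (\1_W (x, y))%:E = m1 [set x | W (x, y)].
  rewrite -[RHS](_ : \int[m1]_x (\1_[set x | W (x, y)] x)%:E = _)//.
  rewrite integral_indic ?setIT//.
  by have := measurable_ysection y mW; rewrite /ysection; under eq_set do rewrite in_setE.
have := @fubini_tonelli _ _ _ _ _ m1 m2 _ mf (fun=> ltac:(by rewrite lee_fin)).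
under eq_integral do rewrite E1; under [RHS]eq_integral do rewrite E2.
have m1W : measurable_fun setT (fun x => m2 [set y | W (x, y)]).
  under eq_fun do rewrite -E1.
  exact: (@measurable_fun_fubini_tonelli_F _ _ _ _ _ m2 _ mf (fun=> ltac:(by rewrite lee_fin))).
have m2W : measurable_fun setT (fun y => m1 [set x | W (x, y)]).
  under eq_fun do rewrite -E2.
  exact: (@measurable_fun_fubini_tonelli_G _ _ _ _ _ m1 _ mf (fun=> ltac:(by rewrite lee_fin))).
move=> E.
apply: (@le_trans _ _ (\int[m1]_x m2 [set y | W (x, y)])).
  rewrite m1S; last exact: measurable_inner.
  have mI : measurable (inner U k `&` S).
    by apply: measurableI => //; exact: measurable_inner.
  apply: (@le_trans _ _ (\int[m1]_(x in inner U k `&` S) m2 [set y | W (x, y)])); last first.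
    exact: ge0_subset_integral.
  rewrite (eq_integral (fun=> g2 r)); last first.
    move=> x /[!inE] -[ix Sx]; rewrite -(m2B Sx r0) [RHS]m2S; last exact: measurable_eball.
    congr (m2 _); apply/seteqP; split => y /=.
      by move=> [_ [_ Sy] xy]; split => //; rewrite /eball/= enormC.
    move=> [xy Sy]; split => //; first by split => //; exact: ix.
    by rewrite enormC.
  have [->|/set0P[x [_ Sx]]] := eqVneq (inner U k `&` S) set0.
    by rewrite measure0 mul0e integral_ge0// => x [].
  rewrite -(m2B Sx r0) (muleC (m1 _)); have := integral_cst m1 mI (m2 (eball x r)).
  by rewrite /cst => ->.
rewrite E (m2S mU).
apply: (@le_trans _ _ (\int[m2]_(y in U `&` S) m1 [set x | W (x, y)])).
  rewrite [leRHS]integral_mkcond; apply: ge0_le_integral => //.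
  - by apply/(measurable_restrictT _ _).1 => //; [exact: measurableI|exact: measurable_funTS].
  - move=> y _; rewrite patchE; case: ifPn => //; rewrite notin_setE => Uy.
    rewrite (_ : [set x | W (x, y)] = set0) ?measure0//.
    by apply/seteqP; split => // x [].
have mI : measurable (U `&` S) by exact: measurableI.
rewrite (eq_integral (fun=> g1 r)); last first.
  move=> y /[!inE] -[Uy Sy]; rewrite -(m1B Sy r0) [RHS]m1S; last exact: measurable_eball.
  congr (m1 _); apply/seteqP; split => x /=.
    by move=> [Sx _ xy].
  by move=> [xy Sx].
have [->|/set0P[x [_ Sx]]] := eqVneq (U `&` S) set0.
  by rewrite measure0 mule0 integral_set0.
by rewrite -(m1B Sx r0); have := integral_cst m2 mI (m1 (eball x r)); rewrite /cst => ->.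
Qed.

End two_measures.

Section proportional.
Variables (m1 m2 : {sigma_finite_measure set 'rV[R]_n -> \bar R}).
Variables (S : set 'rV[R]_n) (g1 g2 : R -> \bar R).
Hypothesis mS : measurable S.
Hypotheses (m1S : forall A, measurable A -> m1 A = m1 (A `&` S))
           (m2S : forall A, measurable A -> m2 A = m2 (A `&` S)).
Hypotheses (m1B : forall x (r : R), S x -> (0 < r)%R -> m1 (eball x r) = g1 r)
           (m2B : forall x (r : R), S x -> (0 < r)%R -> m2 (eball x r) = g2 r).
Hypotheses (m1oo : forall r : R, m1 (eball 0 r) < +oo)
           (m2oo : forall r : R, m2 (eball 0 r) < +oo).
Hypotheses (m10 : 0 < m1 S) (m20 : 0 < m2 S).

Lemma eball_fin (m : {measure set 'rV[R]_n -> \bar R}) U r :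
  (forall r, m (eball 0 r) < +oo) -> measurable U -> U `<=` eball 0 r ->
  m U \is a fin_num.
Proof.
move=> moo mU Ur; rewrite ge0_fin_numE// (le_lt_trans _ (moo r))//.
by apply: le_measure; rewrite ?inE//; exact: measurable_eball.
Qed.

Lemma eball_sub0 (x : 'rV[R]_n) (r : R) : eball x r `<=` eball 0 (r + enorm x).
Proof.
move=> y; rewrite /eball/= subr0 => yx; rewrite -[y](subrK x).
by rewrite (le_lt_trans (enormD _ _))// ltrD2r.
Qed.

(** Multiply the inequality of [uniform_inner_le] for [(m1, m2, U)] by the one for
    [(m2, m1, V)]: the measures of balls cancel, and [k] tends to infinity. *)
Lemma uniform_open_cross_le U V (a b : R) : eopen U -> eopen V ->
  U `<=` eball 0 a -> V `<=` eball 0 b -> m1 U * m2 V <= m1 V * m2 U.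
Proof.
move=> oU oV Ua Vb.
have mU := eopen_measurable oU; have mV := eopen_measurable oV.
have [x1 Sx1 _] := uniform_ball_gt0 mS ltr01 m10.
have g1oo (r : R) : (0 < r)%R -> g1 r \is a fin_num /\ 0 < g1 r.
  move=> r0; split; last first.
    by have [x Sx h] := uniform_ball_gt0 mS r0 m10; rewrite -(m1B Sx r0).
  rewrite -(m1B Sx1 r0); apply: (eball_fin m1oo); first exact: measurable_eball.
  exact: eball_sub0.
have g2oo (r : R) : (0 < r)%R -> g2 r \is a fin_num /\ 0 < g2 r.
  move=> r0; split; last first.
    by have [x Sx h] := uniform_ball_gt0 mS r0 m20; rewrite -(m2B Sx r0).
  rewrite -(m2B Sx1 r0); apply: (eball_fin m2oo); first exact: measurable_eball.
  exact: eball_sub0.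
have main k : m1 (inner U k) * m2 (inner V k) <= m1 V * m2 U.
  have r0 : (0 < k.+1%:R^-1 :> R)%R by rewrite invr_gt0.
  have [f1 p1] := g1oo _ r0; have [f2 p2] := g2oo _ r0.
  have h1 := uniform_inner_le mS m1S m2S m1B m2B k mU.
  have h2 := uniform_inner_le mS m2S m1S m2B m1B k mV.
  have := lee_pmul (mule_ge0 (measure_ge0 _ _) (ltW p2))
     (mule_ge0 (measure_ge0 _ _) (ltW p1)) h1 h2.
  rewrite muleACA (muleACA (g1 _)) (muleC (g2 _) (g1 _)) (muleC (m2 U)).
  by rewrite (muleC (m1 _ * _)) lee_pmul2l// ?fin_numM// mule_gt0.
have cU := cvg_measure_inner (m := m1) oU; have cV := cvg_measure_inner (m := m2) oV.
have cUV : m1 (inner U k) * m2 (inner V k) @[k --> \oo] --> m1 U * m2 V.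
  apply: cvgeM => //; apply: mule_def_fin; first exact: (eball_fin m1oo mU Ua).
  exact: (eball_fin m2oo mV Vb).
by apply: (cvge_le _ cUV); near=> k; exact: main.
Unshelve. all: by end_near. Qed.

End proportional.

(** Christensen's uniqueness theorem, from [uniform_open_cross_le] used in both
    directions. [V] is a reference set through which the factor is expressed. *)
Lemma uniform_measure_proportional
    (m1 m2 : {sigma_finite_measure set 'rV[R]_n -> \bar R}) S (g1 g2 : R -> \bar R)
    V (b : R) :
  measurable S ->
  (forall A, measurable A -> m1 A = m1 (A `&` S)) ->
  (forall A, measurable A -> m2 A = m2 (A `&` S)) ->
  (forall x (r : R), S x -> (0 < r)%R -> m1 (eball x r) = g1 r) ->
  (forall x (r : R), S x -> (0 < r)%R -> m2 (eball x r) = g2 r) ->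
  (forall r : R, m1 (eball 0 r) < +oo) -> (forall r : R, m2 (eball 0 r) < +oo) ->
  0 < m1 S -> 0 < m2 S ->
  eopen V -> V `<=` eball 0 b -> 0 < m2 V ->
  forall A, measurable A -> m1 A = (fine (m1 V) / fine (m2 V))%:E * m2 A.
Proof.
move=> mS m1S m2S m1B m2B m1oo m2oo m10 m20 oV Vb V0.
have mV := eopen_measurable oV.
have f1 : m1 V \is a fin_num := eball_fin m1oo mV Vb; have f2 : m2 V \is a fin_num := eball_fin m2oo mV Vb.
have c0 : (0 <= fine (m1 V) / fine (m2 V))%R.
  by rewrite divr_ge0// fine_ge0.
have [c cE] : exists c : {nonneg R}, c%:num%R = (fine (m1 V) / fine (m2 V))%R.
  by exists (NngNum c0).
rewrite -cE.
apply: (@eopen_measure_unique R n m1 (mscale c m2)) => // U r oU Ur.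
have mU := eopen_measurable oU.
have F1 : m1 U \is a fin_num := eball_fin m1oo mU Ur; have F2 : m2 U \is a fin_num := eball_fin m2oo mU Ur.
have := uniform_open_cross_le mS m1S m2S m1B m2B m1oo m2oo m10 m20 oU oV Ur Vb.
have := uniform_open_cross_le mS m1S m2S m1B m2B m1oo m2oo m10 m20 oV oU Vb Ur.
suff : m1 V * m2 U <= m1 U * m2 V -> m1 U * m2 V <= m1 V * m2 U ->
    m1 U = (fine (m1 V) / fine (m2 V))%:E * m2 U by rewrite -cE; exact.
move: V0 F1 F2 f1 f2.
case: (m1 U) => // u1; case: (m2 U) => // u2; case: (m1 V) => // v1.
case: (m2 V) => // v2; rewrite lte_fin => v20 _ _ _ _.
rewrite -!EFinM !lee_fin/= => h1 h2; congr EFin.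
have /eqP e : (v1 * u2 == u1 * v2)%R by rewrite eq_le h1.
by rewrite mulrAC e mulfK// gt_eqF.
Qed.

End uniformly_distributed.

(** * Reflections *)

Section reflections.
Variables (R : realType) (n : nat).
Implicit Types (x y z w : 'rV[R]_n) (A : set 'rV[R]_n).

(** The reflection in the hyperplane orthogonal to [w], and the identity for
    [w = 0]; these act transitively on each sphere centred at the origin. *)
Definition refl w z := z - (2 * dotp z w / enorm w ^+ 2) *: w.

Lemma dotpB x y w : dotp (x - y) w = dotp x w - dotp y w.
Proof. by rewrite /dotp -sumrB; apply: eq_bigr => i _; rewrite !mxE mulrBl. Qed.

Lemma dotpZ (a : R) x w : dotp (a *: x) w = a * dotp x w.
Proof. by rewrite /dotp mulr_sumr; apply: eq_bigr => i _; rewrite !mxE mulrA. Qed.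

Lemma dotpC x w : dotp x w = dotp w x.
Proof. by apply: eq_bigr => i _; rewrite mulrC. Qed.

Lemma dotpxx x : dotp x x = enorm x ^+ 2.
Proof. by rewrite enorm_sqr; apply: eq_bigr => i _; rewrite expr2. Qed.

Lemma reflB w x y : refl w (x - y) = refl w x - refl w y.
Proof. by apply/rowP => i; rewrite !mxE dotpB; ring. Qed.

Lemma reflZ w (a : R) x : refl w (a *: x) = a *: refl w x.
Proof. by apply/rowP => i; rewrite !mxE dotpZ; ring. Qed.

Lemma enorm_refl w z : enorm (refl w z) = enorm z.
Proof.
apply/eqP; rewrite -(@eqrXn2 _ 2)// ?enorm_ge0//; apply/eqP.
have [->|w0] := eqVneq w 0; first by rewrite /refl scaler0 subr0.
rewrite /refl -scaleNr enormD_sqr enormZ exprMn real_normK ?num_real// dotpC dotpZ.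
by rewrite (dotpC w); field; rewrite gt_eqF// enorm_gt0.
Qed.

Lemma reflK w : involutive (refl w).
Proof.
move=> z; have [->|w0] := eqVneq w 0; first by rewrite /refl !scaler0 !subr0.
apply/rowP => i; rewrite /refl !mxE dotpB dotpZ dotpxx; field.
by rewrite gt_eqF// enorm_gt0.
Qed.

Lemma refl_swap x y : enorm x = enorm y -> refl (x - y) x = y.
Proof.
move=> xy; have [/eqP|w0] := eqVneq (x - y) 0.
  by rewrite subr_eq0 => /eqP ->; rewrite /refl subrr scaler0 subr0.
rewrite /refl; suff -> : 2 * dotp x (x - y) / enorm (x - y) ^+ 2 = 1.
  by rewrite scale1r opprB addrC subrK.
have h : enorm (x - y) ^+ 2 != 0 by rewrite expf_eq0/= gt_eqF// enorm_gt0.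
apply: (mulIf h); rewrite divfK// mul1r.
have -> : dotp x (x - y) = enorm x ^+ 2 - dotp x y.
  by rewrite dotpC dotpB dotpxx dotpC.
have -> : enorm (x - y) ^+ 2 = enorm x ^+ 2 - 2 * dotp x y + enorm y ^+ 2.
  by rewrite enormD_sqr enormN dotpC -scaleN1r dotpZ dotpC; ring.
by rewrite xy; ring.
Qed.

Lemma measurable_refl w : measurable_fun setT (refl w).
Proof.
apply: measurable_rowB => //; apply: measurable_rowZ => //.
apply: measurable_funM => //; apply: measurable_funM => //.
by apply: measurable_sum => i; apply: measurable_funM => //; exact: measurable_coord.
Qed.

Lemma refl_eball w x r : refl w @^-1` eball x r = eball (refl w x) r.
Proof.
by apply/seteqP; split => y; rewrite /eball/= -(enorm_refl w (y - refl w x)) reflB reflK.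
Qed.

Lemma lebesgue_eball_translate x r : lebesgue_rV n (eball x r) = lebesgue_rV n (eball 0 r).
Proof.
rewrite -(lebesgue_rV_translate x); last exact: measurable_eball.
by congr (lebesgue_rV n _); apply/seteqP; split => y; rewrite /eball/= addrK subr0.
Qed.

(** The image of Lebesgue measure under a reflection gives each ball the measure of
    any ball of the same radius, so that it is a multiple of Lebesgue measure, and the
    unit ball, being invariant, shows that the factor is 1. *)
Lemma lebesgue_rV_refl w A : measurable A ->
  lebesgue_rV n (refl w @^-1` A) = lebesgue_rV n A.
Proof.
have [M ME] := pushforward_sigma_finite_ex (sigma_finiteT (lebesgue_rV n))
  (measurable_refl w) (measurable_refl w) (reflK w).
move=> mA; have {1}-> : lebesgue_rV n (refl w @^-1` A) = M A by rewrite -ME.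
have MB x r : M (eball x r) = lebesgue_rV n (eball 0 r).
  rewrite -ME /pushforward refl_eball; exact: lebesgue_eball_translate.
rewrite (@uniform_measure_proportional R n M (lebesgue_rV n) setT
  (fun r => lebesgue_rV n (eball 0 r)) (fun r => lebesgue_rV n (eball 0 r))
  (eball 0 1) 1)//.
- by rewrite MB divff ?mul1e// gt_eqF// fine_gt0// lebesgue_eball_gt0// lebesgue_eball_lty.
- by move=> B _; rewrite setIT.
- by move=> B _; rewrite setIT.
- by move=> x r _ _; exact: lebesgue_eball_translate.
- by move=> r; rewrite MB lebesgue_eball_lty.
- by move=> r; exact: lebesgue_eball_lty.
- rewrite (@lt_le_trans _ _ (M (eball 0 1)))//; first by rewrite MB lebesgue_eball_gt0.
  by apply: le_measure; rewrite ?inE//; exact: measurable_eball.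
- rewrite (@lt_le_trans _ _ (lebesgue_rV n (eball 0 1)))//; first by rewrite lebesgue_eball_gt0.
  by apply: le_measure; rewrite ?inE//; exact: measurable_eball.
- exact: eopen_eball.
- exact: lebesgue_eball_gt0.
Qed.

Lemma integral_refl w (f : 'rV[R]_n -> \bar R) :
  measurable_fun setT f -> (forall x, 0 <= f x)%E ->
  (\int[lebesgue_rV n]_x f (refl w x) = \int[lebesgue_rV n]_x f x)%E.
Proof.
move=> mf f0; rewrite -(ge0_integral_pushforwardT _ (measurable_refl w) mf f0).
apply: eq_measure_integral; first exact: measurable_refl.
by move=> mw A mA _; exact: (lebesgue_rV_refl w mA).
Qed.

Lemma measurable_unit_sphere : measurable (unit_sphere n : set 'rV[R]_n).
Proof.
have -> : unit_sphere n = (@enorm R n) @^-1` [set 1] by [].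
by apply: measurable_preimageT => //; exact: measurable_enorm.
Qed.

(** On the unit sphere reflections carry any ball to any other of the same
    radius. *)
Lemma reflection_invariant_proportional
    (m1 m2 : {sigma_finite_measure set 'rV[R]_n -> \bar R}) :
  (forall A, measurable A -> m1 A = m1 (A `&` unit_sphere n)) ->
  (forall A, measurable A -> m2 A = m2 (A `&` unit_sphere n)) ->
  (forall w A, measurable A -> m1 (refl w @^-1` A) = m1 A) ->
  (forall w A, measurable A -> m2 (refl w @^-1` A) = m2 A) ->
  (m1 setT < +oo)%E -> (0 < m2 setT < +oo)%E ->
  forall A, measurable A -> m1 A = ((fine (m1 setT) / fine (m2 setT))%:E * m2 A)%E.
Proof.
move=> c1 c2 r1 r2 f1 /andP[p2 f2] A mA.
have mS := measurable_unit_sphere.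
have rB (m : {sigma_finite_measure set 'rV[R]_n -> \bar R}) x y r : unit_sphere n x ->
    unit_sphere n y -> (forall w B, measurable B -> m (refl w @^-1` B) = m B) ->
    m (eball x r) = m (eball y r).
  move=> Sx Sy rm; rewrite -(rm (x - y)); last exact: measurable_eball.
  by rewrite refl_eball refl_swap// Sx Sy.
have mle (m : {sigma_finite_measure set 'rV[R]_n -> \bar R}) B : measurable B ->
    (m B <= m setT)%E.
  by move=> mB; apply: le_measure; rewrite ?inE.
have V2 (m : {sigma_finite_measure set 'rV[R]_n -> \bar R}) :
    (forall B, measurable B -> m B = m (B `&` unit_sphere n)) ->
    m (eball 0 2) = m setT.
  move=> cm; rewrite cm; last exact: measurable_eball.
  rewrite [RHS]cm// setTI; congr (m _); apply/seteqP; split => x [] //.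
  by move=> Sx; split=> //; rewrite /eball/= subr0 Sx ltr1n.
have m2S : m2 (unit_sphere n) = m2 setT by rewrite [RHS]c2// setTI.
have m1S : m1 (unit_sphere n) = m1 setT by rewrite [RHS]c1// setTI.
have [x Sx _] : exists2 x, unit_sphere n x & (0 < m2 (eball x 1))%E.
  by apply: uniform_ball_gt0 => //; rewrite [ltRHS]m2S.
have [m10|m10] := eqVneq (m1 setT) 0%E.
  rewrite m10/= mul0r mul0e; apply/eqP; rewrite -measure_le0 -m10; exact: mle.
rewrite -{1}(V2 m1)// -(V2 m2)//.
apply: (@uniform_measure_proportional R n m1 m2 (unit_sphere n)
  (fun r => m1 (eball x r)) (fun r => m2 (eball x r)) (eball 0 2) 2) => //.
- by move=> y r Sy _; exact: rB.
- by move=> y r Sy _; exact: rB.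
- by move=> r; rewrite (le_lt_trans (mle _ _ (measurable_eball _ _))).
- by move=> r; rewrite (le_lt_trans (mle _ _ (measurable_eball _ _))).
- by rewrite m1S lt_def m10/=.
- by rewrite m2S.
- exact: eopen_eball.
- by rewrite (V2 m2).
Qed.

End reflections.

(** * Metric outer measures *)

Section metric_outer_measure.
Local Open Scope ereal_scope.
Variables (R : realType) (n : nat).
Variable mu : {outer_measure set 'rV[R]_n -> \bar R}.
Hypothesis mu_metric : forall (A B : set 'rV[R]_n) (d : R), (0 < d)%R ->
  (forall x y, A x -> B y -> (d <= enorm (x - y))%R) -> mu A + mu B <= mu (A `|` B).

Lemma inner_far (U : set 'rV[R]_n) i j x z : (i < j)%N -> inner U i x -> ~ inner U j z ->
  (i.+1%:R^-1 - j.+1%:R^-1 <= enorm (x - z) :> R)%R.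
Proof.
move=> ij xi /existsNP[y /not_implyP[zy Uy]].
have : ~ (enorm (y - x) < i.+1%:R^-1)%R by move=> h; exact/Uy/xi.
move/negP; rewrite -leNgt => h; move: zy; rewrite /eball/= => zy.
have := enormB_le y x z; rewrite (enormC z x); move: h zy.
set a := _^-1%R; set b := _^-1%R; set c := enorm _; set d := enorm _; set e := enorm _.
by move=> *; lra.
Qed.

Lemma inner_gap_gt0 i j : (i < j)%N -> (0 < i.+1%:R^-1 - j.+1%:R^-1 :> R)%R.
Proof. by move=> ij; rewrite subr_gt0 ltf_pV2 ?posrE// ltr_nat. Qed.

(** Only every second shell is summed, which makes the summands separated. *)
Lemma sum_shells_le (U X : set 'rV[R]_n) b N :
  \sum_(0 <= i < N) mu (X `&` (inner U (i.*2 + b).+2 `\` inner U (i.*2 + b).+1))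
  <= mu (X `&` inner U (N.*2 + b)).
Proof.
elim: N => [|N IH]; first by rewrite big_geq.
rewrite big_nat_recr//= (le_trans (leeD2r _ IH))//.
have lt12 : (N.*2 + b < (N.*2 + b).+1)%N by [].
apply: (le_trans (mu_metric (inner_gap_gt0 lt12) _)).
  by move=> x y [_ xi] [_ [_ yi]]; exact: inner_far yi.
apply: le_outer_measure => x [[Xx xi]|[Xx [xi _]]]; split => //.
  have le12 : (N.*2 + b <= N.+1.*2 + b)%N by rewrite leq_add2r leq_double.
  by have /subsetPset := inner_nd U le12; exact.
Qed.

(** Caratheodory's criterion: the measures of the shells between consecutive
    inner approximations of [U] have a finite sum, since shells that are not
    adjacent are a positive distance apart. *)
Lemma metric_outer_caratheodory U : eopen U -> mu.-caratheodory U.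
Proof.
move=> oU; apply: le_caratheodory_measurable => X.
have [->|Xoo] := eqVneq (mu X) +oo; first by rewrite leey.
have muX : mu X \is a fin_num by rewrite ge0_fin_numE ?outer_measure_ge0// ltey.
pose sh i := X `&` (inner U i.+1 `\` inner U i).
have le_muX A : mu (X `&` A) <= mu X by apply: le_outer_measure; exact: subIsetl.
have sum_sh : \sum_(0 <= i <oo) mu (sh i) < +oo.
  rewrite nneseries_recl// -(@nneseries_addn _ (mu \o sh) 1)//.
  apply: lte_add_pinfty.
    by rewrite (le_lt_trans (le_muX _))// ltey.
  apply: (@le_lt_trans _ _ (mu X + mu X)); last by rewrite lte_add_pinfty ?ltey.
  apply: lime_le; first by apply: is_cvg_nneseries => *; exact: outer_measure_ge0.
  apply: nearW => N.
  apply: (@le_trans _ _ (\sum_(0 <= i < N.*2) mu (sh i.+1))).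
    under eq_bigr do rewrite addn1/=.
    apply: lee_sum_nneg_natr => //; last by rewrite -addnn leq_addr.
  have -> : \sum_(0 <= i < N.*2) mu (sh i.+1) =
      \sum_(0 <= i < N) mu (sh (i.*2 + 0).+1) + \sum_(0 <= i < N) mu (sh (i.*2 + 1).+1).
    elim: (N) => [|k IH]; first by rewrite !big_geq// adde0.
    rewrite doubleS !big_nat_recr//= IH addn0 addn1 -!addeA; congr (_ + _).
    by rewrite addeCA.
  by apply: leeD; apply: (le_trans (sum_shells_le _ _ _ _)).
have tail : \sum_(N <= i <oo) mu (sh i) @[N --> \oo] --> 0.
  by apply: nneseries_tail_cvg => // *; exact: outer_measure_ge0.
apply/lee_addgt0Pr => e e0.
have /fine_cvgP[_ /cvgrPdist_lt /(_ _ e0)] := tail.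
have /fine_cvgP[+ _] := tail.
move=> fnum dist; have := filterI fnum dist => -[N _ /(_ N (leqnn N))[/= fN]].
rewrite sub0r normrN => dN.
have le1 : mu (X `&` U) <= mu (X `&` inner U N) + e%:E.
  apply: (@le_trans _ _ (mu (X `&` inner U N) + \sum_(N <= i <oo) mu (sh i))); last first.
    rewrite leeD2l// -(fineK fN) lee_fin ltW// (le_lt_trans (ler_norm _))//.
  apply: le_trans (leeD2l _ (outer_measure_sigma_subadditive_tail mu N sh)).
  apply: le_trans (outer_measureU2 _ _ _).
  apply: le_outer_measure => x [Xx]; rewrite -{1}(bigcup_inner oU) => -[j _ xj].
  have [xN|xN] := pselect (inner U N x); [by left|right].
  have ex : exists j, `[< inner U j x >] by exists j; exact/asboolP.
  case: (ex_minnP ex) => -[|m] /asboolP xm min.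
    exfalso; apply: xN; have /subsetPset := inner_nd U (leq0n N); exact.
  exists m => /=.
    apply/negP; rewrite -leqNgt leqNgt; apply/negP => mN.
    by apply: xN; have /subsetPset := inner_nd U mN; exact.
  split => //; split => // /asboolP /min; by rewrite ltnn.
apply: (@le_trans _ _ (mu (X `&` inner U N) + mu (X `&` ~` U) + e%:E)).
  by rewrite addeAC leeD2r.
rewrite leeD2r//.
have r0 : (0 < N.+1%:R^-1 :> R)%R by rewrite invr_gt0.
apply: le_trans (mu_metric r0 _) _.
  move=> x y [_ xN] [_ Uy]; rewrite leNgt; apply/negP => xy.
  by apply: Uy; apply: xN; rewrite /eball/= enormC.
by apply: le_outer_measure => x [[]|[]].
Qed.

End metric_outer_measure.

(** * Hausdorff measure *)

Section hausdorff_outer.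
Local Open Scope ereal_scope.
Variables (R : realType) (n d : nat).
Implicit Types (A B F : set 'rV[R]_n) (delta : R).

Lemma ediam_le A B : A `<=` B -> ediam A <= ediam B.
Proof.
move=> AB; apply: ereal_sup_le => _ [x Ax [y Ay <-]].
by exists x; [exact: AB|exists y => //; exact: AB].
Qed.

Lemma enorm_le_ediam A x y : A x -> A y -> (enorm (x - y))%:E <= ediam A.
Proof. by move=> Ax Ay; apply: ereal_sup_ubound; exists x => //; exists y. Qed.

Lemma ediam_ge0 A : A != set0 -> 0 <= ediam A.
Proof.
by move=> /set0P[x Ax]; rewrite (le_trans _ (enorm_le_ediam Ax Ax))// lee_fin enorm_ge0.
Qed.

Lemma lee_expe (x y : \bar R) k : 0 <= x -> x <= y -> x ^+ k <= y ^+ k.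
Proof.
move=> x0 xy; elim: k => // k IH; rewrite !expeS lee_pmul//.
exact: expe_ge0.
Qed.

Lemma hausdorff_gaugeE A : A != set0 -> hausdorff_gauge d A =
  lebesgue_rV d [set v : 'rV[R]_d | (enorm v <= 1)%R] * ((2 ^+ d)^-1)%R%:E * ediam A ^+ d.
Proof. by move=> /eqP A0; rewrite /hausdorff_gauge asboolF. Qed.

Lemma hausdorff_gauge0 : hausdorff_gauge d (set0 : set 'rV[R]_n) = 0.
Proof. by rewrite /hausdorff_gauge asboolT. Qed.

Lemma hausdorff_gauge_ge0 A : 0 <= hausdorff_gauge d A.
Proof.
have [->|A0] := eqVneq A set0; first by rewrite hausdorff_gauge0.
rewrite hausdorff_gaugeE// mule_ge0//; last exact/expe_ge0/ediam_ge0.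
by rewrite mule_ge0// lee_fin invr_ge0 exprn_ge0.
Qed.

Lemma hausdorff_gauge_le A B : A `<=` B -> hausdorff_gauge d A <= hausdorff_gauge d B.
Proof.
move=> AB; have [->|A0] := eqVneq A set0.
  by rewrite hausdorff_gauge0 hausdorff_gauge_ge0.
have B0 : B != set0.
  by move: A0 => /set0P[x Ax]; apply/set0P; exists x; exact: AB.
rewrite !hausdorff_gaugeE// lee_wpmul2l//.
  by rewrite mule_ge0// lee_fin invr_ge0 exprn_ge0.
by apply: lee_expe; [exact: ediam_ge0|exact: ediam_le].
Qed.

(** Every subset belongs to this sigma-algebra, so that the outer measure
    generated by a set function on it is an infimum over all covers. *)
Definition discrete_row := g_sigma_algebraType [set: set 'rV[R]_n].

Definition small_gauge delta (A : set discrete_row) : \bar R :=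
  if `[< @ediam R n A <= delta%:E >] then @hausdorff_gauge R n d A else +oo.

Lemma small_gauge_ge0 delta A : 0 <= small_gauge delta A.
Proof. by rewrite /small_gauge; case: asboolP => // _; exact: hausdorff_gauge_ge0. Qed.

Lemma small_gauge0 delta : small_gauge delta set0 = 0.
Proof.
rewrite /small_gauge asboolT ?hausdorff_gauge0//.
rewrite /ediam (_ : [set _ | _ in _ & _ in _] = set0) ?ereal_sup0 ?leNye//.
by apply/seteqP; split => // x [].
Qed.

(** The mesh condition is moved into the set function, so that countable
    subadditivity is inherited from the generic construction. *)
Lemma hausdorff_preE delta A : hausdorff_pre d delta A = mu_ext (small_gauge delta) A.
Proof.
have mD (B : set discrete_row) : measurable B by exact: sub_gen_smallest.
apply/eqP; rewrite eq_le; apply/andP; split.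
  apply: le_ereal_inf_tmp => _ [F [_ AF] <-].
  have [[i Fi]|/forallNP Fsmall] := pselect (exists i, ~ (@ediam R n (F i) <= delta%:E)).
    rewrite (eseries_pinfty _ (k := i)) ?leey//.
      by move=> j _; rewrite -ltNye (lt_le_trans _ (small_gauge_ge0 _ _)).
    by rewrite /small_gauge asboolF.
  have Fs i : @ediam R n (F i) <= delta%:E by apply: contrapT; exact: Fsmall.
  apply: ereal_inf_lbound; exists F; first by split.
  by apply: eq_eseriesr => i _; rewrite /small_gauge asboolT.
apply: le_ereal_inf_tmp => _ [F [AF Fsmall] <-].
apply: ereal_inf_lbound; exists F; first by split.
by apply: eq_eseriesr => i _; rewrite /small_gauge asboolT.
Qed.

Lemma hausdorff_pre_ge0 delta A : 0 <= hausdorff_pre d delta A.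
Proof. by rewrite hausdorff_preE mu_ext_ge0//; exact: small_gauge_ge0. Qed.

Lemma hausdorff_pre_le delta A B : A `<=` B -> hausdorff_pre d delta A <= hausdorff_pre d delta B.
Proof. by move=> AB; rewrite !hausdorff_preE; exact: le_mu_ext. Qed.

Lemma hausdorff_pre_mesh (a b : R) A : (a <= b)%R ->
  hausdorff_pre d b A <= hausdorff_pre d a A.
Proof.
move=> ab; apply: ereal_inf_le_tmp => _ [F [AF Fa] <-]; exists F => //; split => // i.
by rewrite (le_trans (Fa i))// lee_fin.
Qed.

Lemma hausdorff_pre_le_measure delta A : (0 < delta)%R ->
  hausdorff_pre d delta A <= hausdorff_measure d A.
Proof. by move=> d0; apply: ereal_sup_ubound; exists delta. Qed.

Lemma hausdorff_measure0 : hausdorff_measure d (set0 : set 'rV[R]_n) = 0.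
Proof.
apply/eqP; rewrite eq_le; apply/andP; split; last first.
  apply: le_trans (hausdorff_pre_le_measure _ ltr01); exact: hausdorff_pre_ge0.
apply: ge_ereal_sup => _ [e _ <-]; rewrite hausdorff_preE mu_ext0//.
- exact: small_gauge0.
- exact: small_gauge_ge0.
Qed.

Lemma hausdorff_measure_ge0 A : 0 <= hausdorff_measure d A.
Proof. by apply: le_trans (hausdorff_pre_le_measure _ ltr01); exact: hausdorff_pre_ge0. Qed.

Lemma hausdorff_measure_le : {homo @hausdorff_measure R n d : A B / A `<=` B >-> A <= B}.
Proof.
move=> A B AB; apply: ge_ereal_sup => _ [e e0 <-].
by apply: le_trans (hausdorff_pre_le_measure _ e0); exact: hausdorff_pre_le.
Qed.

Lemma hausdorff_measure_subadditive : sigma_subadditive (@hausdorff_measure R n d).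
Proof.
move=> F; apply: ge_ereal_sup => _ [e e0 <-].
apply: (@le_trans _ _ (\sum_(i <oo) hausdorff_pre d e (F i))).
  rewrite hausdorff_preE; under eq_eseriesr do rewrite hausdorff_preE.
  apply: mu_ext_sigma_subadditive; exact: small_gauge_ge0.
apply: lee_nneseries; first by move=> *; exact: hausdorff_pre_ge0.
by move=> i _; exact: hausdorff_pre_le_measure.
Qed.

HB.instance Definition _ := isOuterMeasure.Build R 'rV[R]_n (@hausdorff_measure R n d)
  hausdorff_measure0 hausdorff_measure_ge0 hausdorff_measure_le
  hausdorff_measure_subadditive.

(** A set of diameter less than [e] meets at most one of [A] and [B], so that a
    cover of the union splits. *)
Lemma hausdorff_pre_metric A B (e delta : R) : (delta < e)%R ->
  (forall x y, A x -> B y -> (e <= enorm (x - y))%R) ->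
  hausdorff_pre d delta A + hausdorff_pre d delta B <= hausdorff_pre d delta (A `|` B).
Proof.
move=> de AB; apply: le_ereal_inf_tmp => _ [F [ABF Fd] <-].
have sub (C : set 'rV[R]_n) : hausdorff_pre d delta (C `&` (A `|` B)) <=
    \sum_(i <oo) hausdorff_gauge d (C `&` F i).
  apply: ereal_inf_lbound; exists (fun i => C `&` F i) => //; split.
    by rewrite -setI_bigcupr => x [Cx ABx]; split => //; exact: ABF.
  by move=> i; rewrite (le_trans _ (Fd i))//; apply: ediam_le; exact: subIsetr.
have := leeD (sub A) (sub B).
rewrite setIUr setIid setUidl ?subIsetl// setIUr setIid setUidr ?subIsetl//.
move/le_trans; apply; rewrite -nneseriesD; last 2 first.
- by move=> *; exact: hausdorff_gauge_ge0.
- by move=> *; exact: hausdorff_gauge_ge0.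
apply: lee_nneseries => [i _ _|i _].
  by rewrite adde_ge0//; exact: hausdorff_gauge_ge0.
have [->|/set0P[x [Ax Fx]]] := eqVneq (A `&` F i) set0.
  by rewrite hausdorff_gauge0 add0e hausdorff_gauge_le//; exact: subIsetr.
have -> : B `&` F i = set0.
  apply/seteqP; split => // y [By Fy].
  have := le_trans (enorm_le_ediam Fx Fy) (Fd i); rewrite lee_fin leNgt.
  by rewrite (lt_le_trans de (AB _ _ Ax By)).
by rewrite hausdorff_gauge0 adde0 hausdorff_gauge_le//; exact: subIsetr.
Qed.

Lemma hausdorff_measure_metric A B (e : R) : (0 < e)%R ->
  (forall x y, A x -> B y -> (e <= enorm (x - y))%R) ->
  hausdorff_measure d A + hausdorff_measure d B <= hausdorff_measure d (A `|` B).
Proof.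
move=> e0 AB.
have [->|ABoo] := eqVneq (hausdorff_measure d (A `|` B)) +oo; first by rewrite leey.
have fin C : C `<=` A `|` B -> hausdorff_measure d C \is a fin_num.
  move=> CAB; rewrite ge0_fin_numE ?hausdorff_measure_ge0//.
  by rewrite (le_lt_trans (hausdorff_measure_le CAB))// ltey.
have fA := fin A ltac:(by left); have fB := fin B ltac:(by right).
apply/lee_addgt0Pr => r r0.
have r20 : (0 < r / 2)%R by rewrite divr_gt0.
have [_ [a a0 <-] ha] := ub_ereal_sup_adherent r20 fA.
have [_ [b b0 <-] hb] := ub_ereal_sup_adherent r20 fB.
pose m := Order.min (e / 2)%R (Order.min a b).
have m0 : (0 < m)%R by rewrite !lt_min divr_gt0//= a0 b0.
have me : (m < e)%R by rewrite gt_min ltr_pdivrMr// mulr_natr mulr2n ltrDl e0.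
have := hausdorff_pre_metric me AB.
move=> /le_trans /(_ (hausdorff_pre_le_measure _ m0)) hm.
have ma : (m <= a)%R by rewrite !ge_min lexx orbT.
have mb : (m <= b)%R by rewrite !ge_min lexx !orbT.
have := leeD (hausdorff_pre_mesh A ma) (hausdorff_pre_mesh B mb).
move=> /le_trans /(_ hm) h; rewrite (splitr r) EFinD.
apply: (@le_trans _ _ (hausdorff_pre d a A + hausdorff_pre d b B + ((r / 2)%:E + (r / 2)%:E))).
  rewrite addeACA; apply: leeD; rewrite -leeBlDr//; exact: ltW.
by rewrite leeD2r.
Qed.

Lemma hausdorff_caratheodory A : measurable A ->
  (@hausdorff_measure R n d).-caratheodory A.
Proof.
rewrite [X in X _ -> _]measurable_eopenE; move: A; apply: smallest_sub.
  split.
  - exact: caratheodory_measurable_set0.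
  - by move=> A mA; rewrite setTD; exact: caratheodory_measurable_setC.
  - by move=> F mF; exact: caratheodory_measurable_bigcup.
move=> U oU; apply: metric_outer_caratheodory => // A B e e0 AB.
exact: hausdorff_measure_metric AB.
Qed.

Lemma ediam_preimage (f : 'rV[R]_n -> 'rV[R]_n) A :
  (forall x y, enorm (f x - f y) = enorm (x - y)) -> ediam (f @^-1` A) <= ediam A.
Proof.
move=> isof; apply: ge_ereal_sup => _ [x Ax [y Ay <-]].
by rewrite -isof; exact: enorm_le_ediam.
Qed.

Lemma hausdorff_measure_refl w A :
  hausdorff_measure d (refl w @^-1` A) = hausdorff_measure d A.
Proof.
have isof x y : enorm (refl w x - refl w y) = enorm (x - y).
  by rewrite -reflB enorm_refl.
have dm B : ediam (refl w @^-1` B) = ediam B.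
  apply/eqP; rewrite eq_le ediam_preimage//=.
  rewrite -{1}(_ : refl w @^-1` (refl w @^-1` B) = B) ?ediam_preimage//.
  by apply/funext => x /=; rewrite reflK.
have gm B : hausdorff_gauge d (refl w @^-1` B) = hausdorff_gauge d B.
  have [->|B0] := eqVneq B set0; first by rewrite preimage_set0.
  rewrite !hausdorff_gaugeE// ?dm//; move: B0 => /set0P[x Bx].
  by apply/set0P; exists (refl w x); rewrite /= reflK.
have le B : hausdorff_measure d (refl w @^-1` B) <= hausdorff_measure d B.
  apply: ge_ereal_sup => _ [e e0 <-].
  apply: le_trans (hausdorff_pre_le_measure _ e0).
  apply: le_ereal_inf_tmp => _ [F [BF Fd] <-].
  apply: ereal_inf_lbound; exists (fun i => refl w @^-1` F i).
    split=> [x /BF [i _ Fx]|i]; first by exists i.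
    by rewrite dm.
  by apply: eq_eseriesr => i _; rewrite gm.
apply/eqP; rewrite eq_le le/=.
rewrite -{1}(_ : refl w @^-1` (refl w @^-1` A) = A) ?le//.
by apply/funext => x /=; rewrite reflK.
Qed.

End hausdorff_outer.

Section sphere.
Local Open Scope ereal_scope.
Variables (R : realType) (n : nat).
Implicit Types (A : set 'rV[R]_n).

Lemma sphere_measure_refl w A :
  sphere_measure n (refl w @^-1` A) = sphere_measure n A.
Proof.
rewrite /sphere_measure -[RHS](hausdorff_measure_refl _ w).
congr (hausdorff_measure _ _); apply/seteqP; split => x [Ax Sx]; split => //.
  by rewrite /unit_sphere/= enorm_refl.
by move: Sx; rewrite /unit_sphere/= enorm_refl.
Qed.

Lemma sphere_measure_restr A : sphere_measure n A = sphere_measure n (A `&` unit_sphere n).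
Proof. by rewrite /sphere_measure -setIA setIid. Qed.

Lemma sphere_measure_sigma_additive : semi_sigma_additive (@sphere_measure R n).
Proof.
move=> F mF tF mUF; rewrite /sphere_measure setI_bigcupl.
have mFS i : (@hausdorff_measure R n n.-1).-caratheodory (F i `&` unit_sphere n).
  apply: hausdorff_caratheodory; apply: measurableI => //.
  exact: measurable_unit_sphere.
have := @caratheodory_measure_sigma_additive R _ (@hausdorff_measure R n n.-1)
  (fun i => F i `&` unit_sphere n) mFS.
apply; first exact: trivIset_setIr.
exact: caratheodory_measurable_bigcup.
Qed.

End sphere.

(** * Finiteness of the measure of the sphere *)

Section sphere_finite.
Local Open Scope ereal_scope.
Variables (R : realType) (m : nat).
Notation n := m.+1.
Notation S := (@unit_sphere R n).

Definition unit_ball_volume (d : nat) : \bar R :=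
  lebesgue_rV d [set v : 'rV[R]_d | (enorm v <= 1)%R].

Lemma unit_ball_volume_lty d : unit_ball_volume d < +oo.
Proof.
apply: le_lt_trans (@lebesgue_eball_lty R d 0 2); apply: le_measure; rewrite ?inE.
- apply: measurable_ler_set; last exact: measurable_cst.
  exact: measurable_enorm.
- exact: measurable_eball.
- by move=> v /= v1; rewrite /eball/= subr0 (le_lt_trans v1)// ltr1n.
Qed.

Lemma unit_ball_volume_gt0 d : 0 < unit_ball_volume d.
Proof.
apply: (lt_le_trans (@lebesgue_eball_gt0 R d 0%R 1%R ltr01)); apply: le_measure; rewrite ?inE.
- exact: measurable_eball.
- apply: measurable_ler_set; last exact: measurable_cst.
  exact: measurable_enorm.
- by move=> v; rewrite /eball/= subr0 => /ltW.
Qed.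

(** A coordinate of largest modulus of a unit vector is a 1-Lipschitz function,
    for the l1-norm, of the other coordinates. *)
Lemma sphere_max_coord_le (i : 'I_n) (v w : 'rV[R]_n) : S v -> S w ->
  (forall j, `|v ord0 j| <= `|v ord0 i|)%R -> (forall j, `|w ord0 j| <= `|w ord0 i|)%R ->
  (0 <= v ord0 i * w ord0 i)%R ->
  (enorm (v - w) <= 2 * \sum_(j < m) `|v ord0 (lift i j) - w ord0 (lift i j)|)%R.
Proof.
move=> Sv Sw mv mw vw.
have sq (u : 'rV[R]_n) : S u ->
    (u ord0 i ^+ 2 = 1 - \sum_(j < m) u ord0 (lift i j) ^+ 2)%R.
  by move=> Su; rewrite -[1%R](expr1n _ 2) -Su enorm_sqr (bigD1_ord i)//= addrK.
pose s : R := (`|v ord0 i| + `|w ord0 i|)%R.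
have s_gt0 : (0 < s)%R.
  rewrite lt_def addr_ge0// andbT; apply/negP => /eqP s0.
  have v0 : `|v ord0 i|%R = 0%R by have := normr_ge0 (w ord0 i); move: s0; rewrite /s; have := normr_ge0 (v ord0 i); lra.
  have : v = 0%R.
    by apply/rowP => j; rewrite mxE; apply/eqP; rewrite -normr_le0 -v0.
  by move=> v00; move: Sv; rewrite /unit_sphere/= v00 enorm0 => /eqP; rewrite eq_sym oner_eq0.
have key : (s * `|v ord0 i - w ord0 i| <=
    s * \sum_(j < m) `|v ord0 (lift i j) - w ord0 (lift i j)|)%R.
  have -> : (s * `|v ord0 i - w ord0 i| = `|v ord0 i ^+ 2 - w ord0 i ^+ 2|)%R.
    rewrite subr_sqr normrM mulrC; congr (_ * _)%R.
    rewrite /s; case: (ler0P (v ord0 i)) => hv; case: (ler0P (w ord0 i)) => hw;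
      case: (ler0P (v ord0 i + w ord0 i)) => hvw; nra.
  rewrite !sq// (_ : (_ - _ = \sum_(j < m) (w ord0 (lift i j) ^+ 2 - v ord0 (lift i j) ^+ 2))%R); last first.
    by rewrite sumrB; lra.
  rewrite (le_trans (ler_norm_sum _ _ _))// mulr_sumr; apply: ler_sum => j _.
  rewrite subr_sqr normrM distrC mulrC ler_wpM2r// (le_trans (ler_normD _ _))//.
  by rewrite /s addrC lerD.
rewrite (ler_pM2l s_gt0) in key.
rewrite (le_trans (enorm_le_sum _))// (bigD1_ord i)//= !mxE mulr2n mulrDl mul1r.
by rewrite lerD//; apply: ler_sum => j _; rewrite !mxE.
Qed.

(** Unit vectors are sorted by the index of a coordinate of largest modulus, its sign,
    and the cell of a grid of mesh [1/N] containing the other coordinates. *)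
Definition sphere_cell N (z : 'I_n * bool * {ffun 'I_m -> 'I_(2 * N).+1}) : set 'rV[R]_n :=
  [set v | [/\ S v, (forall j, `|v ord0 j| <= `|v ord0 z.1.1|)%R,
    (0 <= (-1) ^+ z.1.2 * v ord0 z.1.1)%R &
    forall j, (`|v ord0 (lift z.1.1 j) - (-1 + (z.2 j)%:R / N%:R)| <= N%:R^-1)%R]].

Lemma sphere_cell_diam N z : (0 < N)%N ->
  ediam (@sphere_cell N z) <= (2 * (m%:R * (2 / N%:R)))%:E.
Proof.
move=> N0; apply: ge_ereal_sup => _ [v [Sv mv sv cv] [w [Sw mw sw cw] <-]].
rewrite lee_fin; apply: le_trans (sphere_max_coord_le Sv Sw mv mw _) _.
  have := mulr_ge0 sv sw; rewrite mulrACA -expr2 sqrr_sign mul1r; exact.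
rewrite ler_pM2l// mulr_natl -[X in (_ *+ X)%R](card_ord m) -sumr_const; apply: ler_sum => j _.
have := lerD (cv j) (cw j); rewrite (distrC (w _ _)) => h.
rewrite (le_trans _ (le_trans h _))//; last by rewrite mulr_natl mulr2n.
by rewrite (le_trans _ (ler_normD _ _))// addrA subrK.
Qed.

Lemma sphere_cell_cover N v : (0 < N)%N -> S v -> exists z, @sphere_cell N z v.
Proof.
move=> N0 Sv.
pose i := [arg max_(i > ord0) `|v ord0 i|%R]%O.
have mi j : (`|v ord0 j| <= `|v ord0 i|)%R.
  by rewrite /i; case: arg_maxP => // k _; apply.
have cell j : exists f : 'I_(2 * N).+1, (`|v ord0 (lift i j) - (-1 + f%:R / N%:R)| <= N%:R^-1)%R.
  have := coord_le_enorm v (lift i j); rewrite Sv ler_norml => /andP[v1 v2].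
  have N0' : (0 < N%:R :> R)%R by rewrite ltr0n.
  pose x := ((v ord0 (lift i j) + 1) * N%:R)%R.
  have x0 : (0 <= x)%R by rewrite mulr_ge0// -lerBlDr sub0r.
  have /andP[t1 t2] := truncn_itv x0.
  have ft : (Num.truncn x < (2 * N).+1)%N.
    rewrite ltnS -(ler_nat R) (le_trans t1)// natrM /x ler_pM2r//; lra.
  exists (Ordinal ft) => /=.
  have -> : (v ord0 (lift i j) - (-1 + (Num.truncn x)%:R / N%:R) = (x - (Num.truncn x)%:R) / N%:R)%R.
    by rewrite /x; field; rewrite gt_eqF.
  rewrite normrM normfV (ger0_norm (ltW N0')) ler_pdivrMr// mulVf ?gt_eqF//.
  by rewrite ger0_norm ?subr_ge0// lerBlDl -natr1 addrC in t2 *; rewrite ltW.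
have [f Hf] := choice cell.
exists (i, (v ord0 i < 0)%R, [ffun j => f j]); split => //=.
  by case: ltP => [/ltW h|h]; rewrite ?expr1 ?expr0 ?mulN1r ?mul1r ?oppr_ge0.
by move=> j; rewrite ffunE.
Qed.

Lemma hausdorff_pre_finite_cover (d : nat) (delta : R) (A : set 'rV[R]_n) (J : finType)
    (G : J -> set 'rV[R]_n) (c : R) :
  A `<=` \bigcup_j G j -> (forall j, ediam (G j) <= delta%:E) ->
  (forall j, hausdorff_gauge d (G j) <= c%:E) ->
  hausdorff_pre d delta A <= (c *+ #|J|)%R%:E.
Proof.
move=> AG Gd Gc; pose F k := nth set0 (map G (enum J)) k.
apply: (@le_trans _ _ (\sum_(k <oo) hausdorff_gauge d (F k))).
  apply: ereal_inf_lbound; exists F => //; split.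
    move=> x /AG[j _ Gx]; exists (index j (enum J)) => //.
    rewrite /F (nth_map j) ?nth_index ?mem_enum//.
    by rewrite index_mem mem_enum.
  move=> k; rewrite /F; have [ks|ks] := ltnP k (size (enum J)).
    have [j0 _] : exists j0 : J, true.
      by case: (enum J) ks => // j0 ? _; exists j0.
    by rewrite (nth_map j0).
  rewrite nth_default; last by rewrite size_map.
  rewrite /ediam (_ : [set _ | _ in _ & _ in _] = set0) ?ereal_sup0 ?leNye//.
  by apply/seteqP; split => // x [].
rewrite (@nneseries_split _ (fun k => hausdorff_gauge d (F k)) 0%N (size (enum J))); last by move=> *; exact: hausdorff_gauge_ge0.
rewrite [X in _ + X]eseries0; last first.
  by move=> k; rewrite add0n => ks _; rewrite /F nth_default; [exact: hausdorff_gauge0|rewrite size_map].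
rewrite adde0 add0n big_mkord cardE -[X in (_ <= (_ *+ X)%R%:E)](card_ord (size (enum J))).
rewrite -sumr_const -sumEFin; apply: lee_sum => k _.
rewrite /F; have [j0 _] : exists j0 : J, true.
  by case: (enum J) k => [[]//|j0 ? _]; exists j0.
by rewrite (nth_map j0).
Qed.

(** There are [2 (m+1) (2N+1)^m] cells, each of diameter [O(1/N)], so that the
    sum of the [m]-th powers of the diameters is bounded independently of [N]. *)
Lemma sphere_measure_lty : sphere_measure n [set: 'rV[R]_n] < +oo.
Proof.
pose al := fine (unit_ball_volume m).
have al0 : (0 <= al)%R by rewrite fine_ge0// ltW// unit_ball_volume_gt0.
pose C : R := (al * (2 ^+ m)^-1 * (n%:R * 2) * (12 * m%:R) ^+ m)%R.
apply: (@le_lt_trans _ _ C%:E); last exact: ltry.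
rewrite /sphere_measure setTI; apply: ge_ereal_sup => _ [delta d0 <-].
pose N := (Num.truncn (4 * m%:R / delta)%R).+1.
have hN : (4 * m%:R / delta < N%:R)%R by exact: truncnS_gt.
have N0 : (0 < N%:R :> R)%R by rewrite ltr0n.
pose D : R := (2 * (m%:R * (2 / N%:R)))%R.
have D0 : (0 <= D)%R by rewrite !mulr_ge0// invr_ge0.
have Dd : (D <= delta)%R.
  move: hN; rewrite ltr_pdivrMr// => hN; rewrite /D.
  rewrite -(ler_pM2r N0) (_ : (_ * N%:R = 4 * m%:R)%R); last by field; rewrite gt_eqF.
  by rewrite (le_trans (ltW hN))// mulrC.
pose c : R := (al * (2 ^+ m)^-1 * D ^+ m)%R.
have c0 : (0 <= c)%R by rewrite !mulr_ge0// ?invr_ge0 ?exprn_ge0.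
apply: le_trans (@hausdorff_pre_finite_cover m delta S _ (@sphere_cell N) c _ _ _) _.
- by move=> v Sv; have [//|z zv] := @sphere_cell_cover N v _ Sv; exists z.
- by move=> z; apply: le_trans (sphere_cell_diam z _) _ => //; rewrite lee_fin.
- move=> z; have [->|z0] := eqVneq (sphere_cell z) set0.
    by rewrite hausdorff_gauge0 lee_fin.
  rewrite hausdorff_gaugeE// /c !EFinM EFin_expe lee_pmul//.
  + by rewrite mule_ge0// lee_fin invr_ge0 exprn_ge0.
  + exact/expe_ge0/ediam_ge0.
  + rewrite /al fineK// ge0_fin_numE ?unit_ball_volume_lty//.
  + apply: lee_expe; [exact: ediam_ge0|exact: sphere_cell_diam].
rewrite lee_fin /c /C !card_prod card_ord card_bool card_ffun !card_ord.
rewrite -[leLHS]mulr_natr !natrM natrX -!mulrA ler_wpM2l// ler_wpM2l ?invr_ge0 ?exprn_ge0//.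
rewrite mulrC -!mulrA ler_wpM2l// ler_wpM2l// -exprMn lerXn2r ?nnegrE ?mulr_ge0//.
have -> : ((2 * N).+1%:R * D = 4 * m%:R * ((2 * N).+1%:R / N%:R))%R.
  by rewrite /D; move: (N%:R)%R ((2 * N).+1%:R)%R N0 => a b a0; field; rewrite gt_eqF.
rewrite (_ : (12 * m%:R = 4 * m%:R * 3)%R); last by ring.
rewrite ler_wpM2l ?mulr_ge0// ler_pdivrMr// -natrM ler_nat; lia.
Qed.

End sphere_finite.

(** * Positivity of the measure of the sphere *)

Section unit_direction.
Variables (R : realType) (n : nat).
Implicit Types (x y w : 'rV[R]_n).

Definition udir x : 'rV[R]_n := (enorm x)^-1 *: x.

Lemma enorm_udir x : x != 0 -> enorm (udir x) = 1.
Proof.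
rewrite -enorm_gt0 => x0; rewrite /udir enormZ ger0_norm ?invr_ge0 ?enorm_ge0//.
by rewrite mulVf// gt_eqF.
Qed.

Lemma udirK x : enorm x *: udir x = x.
Proof.
have [->|x0] := eqVneq x 0; first by rewrite enorm0 scale0r.
by rewrite /udir scalerA divff ?scale1r// gt_eqF// enorm_gt0.
Qed.

Lemma udir_refl w x : udir (refl w x) = refl w (udir x).
Proof. by rewrite /udir enorm_refl reflZ. Qed.

Lemma measurable_udir : measurable_fun setT udir.
Proof.
rewrite (_ : udir = fun x => (enorm x `^ (-1)) *: x); last first.
  by apply/funext => x; rewrite powR_inv1 ?enorm_ge0.
apply: measurable_rowZ => //.
exact: measurableT_comp (measurable_powR (-1)) (@measurable_enorm R n).
Qed.

End unit_direction.

Section sphere_positive.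
Local Open Scope ereal_scope.
Variables (R : realType) (m : nat).
Notation n := m.+1.
Notation S := (@unit_sphere R n).
Notation L := (@lebesgue_rV R n).

(** The truncated cone over a subset of the sphere, without its apex; its volume is a
    substitute for the area of the subset. *)
Definition cone (A : set 'rV[R]_n) : set 'rV[R]_n :=
  [set y | [/\ (enorm y < 1)%R, y != 0%R & A (udir y)]].

Lemma measurable_cone A : measurable A -> measurable (cone A).
Proof.
move=> mA.
have -> : cone A = eball 0%R 1%R `&` [set y | (0 < enorm y)%R] `&` @udir R n @^-1` A.
  apply/seteqP; split => y; rewrite /eball/= subr0 enorm_gt0; first by case.
  by move=> [[]].
apply: measurableI; last by apply: measurable_preimageT => //; exact: measurable_udir.
apply: measurableI; first exact: measurable_eball.
by apply: measurable_ltr_set; [exact: measurable_cst|exact: measurable_enorm].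
Qed.

Lemma enorm_delta (i : 'I_n) : enorm (delta_mx ord0 i : 'rV[R]_n) = 1%R.
Proof.
rewrite /enorm (bigD1 i)//= big1 ?addr0; last first.
  by move=> j ji; rewrite mxE eqxx (negbTE ji) expr0n.
by rewrite mxE !eqxx expr1n sqrtr1.
Qed.

Definition cball (x : 'rV[R]_n) (r : R) : set 'rV[R]_n := [set y | (enorm (y - x) <= r)%R].

Lemma measurable_cball x r : measurable (cball x r).
Proof.
apply: measurable_ler_set; last exact: measurable_cst.
by apply: measurable_enorm_comp; apply: measurable_rowB.
Qed.

(** After a reflection the centre is the first basis vector, and the cone over
    the cap of radius [D] lies in a box with one side 2 and [m] sides [2 D]. *)
Lemma lebesgue_cone_cball_le x (D : R) : (0 <= D)%R -> S x ->
  L (cone (cball x D)) <= (2 * (2 * D) ^+ m)%:E.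
Proof.
move=> D0 Sx; pose e : 'rV[R]_n := delta_mx ord0 ord0.
have [q xe] : exists q, refl q x = e.
  by exists (x - e)%R; apply: refl_swap; rewrite Sx enorm_delta.
have -> : cone (cball x D) = refl q @^-1` cone (cball e D).
  have refl_eq0 y : (refl q y != 0)%R = (y != 0)%R.
    by rewrite -!enorm_gt0 enorm_refl.
  apply/seteqP; split => y [y1 y0]; rewrite /cball/= => yx; split.
  - by rewrite enorm_refl.
  - by rewrite refl_eq0.
  - by rewrite /cball/= udir_refl -xe -reflB enorm_refl.
  - by rewrite -(enorm_refl q).
  - by rewrite -refl_eq0.
  - by rewrite /cball/= -(enorm_refl q) reflB -udir_refl xe.
rewrite lebesgue_rV_refl; last by apply: measurable_cone; exact: measurable_cball.
pose r (i : 'I_n) : R := if i == ord0 then 1%R else D.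
have r0 i : (0 <= r i)%R by rewrite /r; case: ifP.
apply: (@le_trans _ _ (L [set v | forall i, `|v ord0 i| <= r i]%R)).
  apply: le_measure; rewrite ?inE.
  - by apply: measurable_cone; exact: measurable_cball.
  - exact: measurable_box.
  move=> y [y1 y0 yD] i; rewrite /r; case: eqVneq => [->|i0].
    by rewrite (le_trans (coord_le_enorm _ _))// ltW.
  have ei : (udir y - e)%R ord0 i = udir y ord0 i.
    by rewrite mxE [(- e)%R _ _]mxE [e _ _]mxE (negbTE i0) andbF oppr0 addr0.
  have := coord_le_enorm (udir y - e)%R i; rewrite ei => /le_trans /(_ yD) h.
  have -> : y ord0 i = (enorm y * udir y ord0 i)%R by rewrite -[in LHS](udirK y) mxE.
  rewrite normrM ger0_norm ?enorm_ge0//.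
  by rewrite (le_trans (ler_pM _ _ (ltW y1) h)) ?enorm_ge0 ?mul1r.
rewrite lebesgue_rV_box// big_ord_recl {1}/r eqxx mulr1.
rewrite (eq_bigr (fun=> 2 * D)%R); last by move=> i _; rewrite /r.
by rewrite prodr_const card_ord.
Qed.

Lemma lebesgue_cone_sphere_gt0 : 0 < L (cone S).
Proof.
pose e : 'rV[R]_n := (2^-1)%R *: delta_mx ord0 ord0.
have ee : enorm e = (2^-1)%R by rewrite enormZ enorm_delta mulr1 ger0_norm.
apply: (lt_le_trans (@lebesgue_eball_gt0 R n e (4^-1)%R _)); first by rewrite invr_gt0.
apply: le_measure; rewrite ?inE; first exact: measurable_eball.
  by apply: measurable_cone; exact: measurable_unit_sphere.
move=> y; rewrite /eball/= => ye.
have y1 : (enorm y < 1)%R.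
  rewrite -(subrK e y) (le_lt_trans (enormD _ _))// ee; lra.
have y0 : y != 0%R.
  rewrite -enorm_gt0; have := enormB_le e 0 y; rewrite !subr0 ee (enormC e y); lra.
by split => //; rewrite /unit_sphere/= enorm_udir.
Qed.

(** A set of a cover of the sphere with diameter [D] lies in a cap of radius [D], whose
    cone has volume [O(D^m)]. Hence the volume of the cone over the sphere is at most
    a constant times the sum that defines the Hausdorff measure. *)
Lemma sphere_measure_gt0 : 0 < sphere_measure n [set: 'rV[R]_n].
Proof.
rewrite /sphere_measure setTI.
apply: lt_le_trans (hausdorff_pre_le_measure m S ltr01).
have b0 := lebesgue_cone_sphere_gt0.
have bfin : L (cone S) \is a fin_num.
  rewrite ge0_fin_numE// (le_lt_trans _ (@lebesgue_eball_lty R n 0%R 1%R))//.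
  apply: le_measure; rewrite ?inE; last by move=> y [y1 _ _]; rewrite /eball/= subr0.
    by apply: measurable_cone; exact: measurable_unit_sphere.
  exact: measurable_eball.
pose al := fine (unit_ball_volume R m).
have alfin : unit_ball_volume R m = al%:E.
  by rewrite fineK// ge0_fin_numE ?unit_ball_volume_lty.
have al0 : (0 < al)%R by rewrite -lte_fin -alfin unit_ball_volume_gt0.
pose ka : R := (al * (2 ^+ m)^-1)%R.
have ka0 : (0 < ka)%R by rewrite divr_gt0// exprn_gt0.
pose c : R := (2 * 2 ^+ m / ka)%R.
have c0 : (0 < c)%R by rewrite divr_gt0// mulr_gt0// exprn_gt0.
suff main (F : (set 'rV[R]_n)^nat) : S `<=` \bigcup_i F i -> (forall i, ediam (F i) <= 1%:E) ->
    L (cone S) <= c%:E * \sum_(i <oo) hausdorff_gauge m (F i).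
  apply: (@lt_le_trans _ _ ((fine (L (cone S)) / c)%:E)).
    by rewrite lte_fin divr_gt0// fine_gt0// b0 -ge0_fin_numE.
  apply: le_ereal_inf_tmp => _ [F [SF Fd] <-].
  have := main F SF Fd; rewrite -[in X in X -> _](fineK bfin).
  have : 0 <= \sum_(i <oo) hausdorff_gauge m (F i).
    by apply: nneseries_ge0 => *; exact: hausdorff_gauge_ge0.
  case: (\sum_(i <oo) _) => [r||//]; last by move=> _ _; rewrite leey.
  by rewrite -EFinM !lee_fin => _ h; rewrite ler_pdivrMr// mulrC.
move=> SF Fd.
have hG i : exists G, [/\ measurable G, F i `&` S `<=` G &
    L (cone G) <= c%:E * hausdorff_gauge m (F i)].
  have [F0|/set0P[x [Fx Sx]]] := eqVneq (F i `&` S) set0.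
    exists set0; split => //; first by rewrite F0.
    have -> : cone set0 = set0 by apply/seteqP; split => // y [].
    by rewrite measure0 mule_ge0 ?hausdorff_gauge_ge0// lee_fin ltW.
  have Fi0 : F i != set0 by apply/set0P; exists x.
  have dfin : ediam (F i) \is a fin_num.
    by rewrite ge0_fin_numE ?ediam_ge0// (le_lt_trans (Fd i))// ltry.
  pose D := fine (ediam (F i)).
  have D0 : (0 <= D)%R by rewrite fine_ge0// ediam_ge0.
  exists (cball x D); split; first exact: measurable_cball.
    by move=> y [Fy Sy]; rewrite /cball/= -lee_fin fineK//; exact: enorm_le_ediam.
  apply: le_trans (lebesgue_cone_cball_le D0 Sx) _.
  rewrite hausdorff_gaugeE// -/(unit_ball_volume R m) alfin -(fineK dfin) -/D.
  rewrite -EFin_expe -!EFinM lee_fin le_eqVlt; apply/orP; left; apply/eqP.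
  by rewrite -/ka mulrA /c divfK ?gt_eqF// exprMn mulrA.
have [G HG] := choice hG.
rewrite -nneseriesZl; last by move=> *; exact: hausdorff_gauge_ge0.
apply: (@le_trans _ _ (\sum_(i <oo) L (cone (G i)))); last first.
  by apply: lee_nneseries => // i _; have [] := HG i.
apply: measure_sigma_subadditive => //.
- by move=> i; apply: measurable_cone; have [] := HG i.
- by apply: measurable_cone; exact: measurable_unit_sphere.
- move=> y [y1 y0 Sy]; have [i _ Fy] := SF _ Sy.
  by exists i => //; split => //; have [_ + _] := HG i; apply.
Qed.

End sphere_positive.

(** * Polar coordinates *)

Section transfer.
Local Open Scope ereal_scope.
Context d d' (T : measurableType d) (T' : measurableType d') (R : realType).
Variables (m : {measure set T -> \bar R}) (m' : {measure set T' -> \bar R}).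
Variables (rho : T -> R) (c : R) (phi : T -> T').
Hypotheses (mrho : measurable_fun setT rho) (rho0 : forall x, (0 <= rho x)%R).
Hypotheses (c0 : (0 <= c)%R) (mphi : measurable_fun setT phi).
Hypothesis H : forall A, measurable A ->
  \int[m]_x ((rho x)%:E * (\1_A (phi x))%:E) = c%:E * m' A.

Import HBNNSimple.

Let transfer_nnsfun (f : {nnsfun T' >-> R}) :
  \int[m]_x ((rho x)%:E * (f (phi x))%:E) = c%:E * \int[m']_y (f y)%:E.
Proof.
have mpre r : measurable (f @^-1` [set r]) by exact: measurable_funPTI.
rewrite (eq_integral (fun x => \sum_(r \in range f)
    (r%:E * ((rho x)%:E * (\1_(f @^-1` [set r]) (phi x))%:E)))); last first.
  move=> x _; rewrite fimfunE -fsumEFin// ge0_mule_fsumr.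
    by apply: eq_fsbigr => r _; rewrite EFinM muleCA.
  by move=> r; rewrite nnfun_muleindic_ge0.
rewrite ge0_integral_fsum//; last 2 first.
- move=> r; apply: emeasurable_funM => //; apply: emeasurable_funM.
    exact/measurable_EFinP.
  apply/measurable_EFinP; apply: measurableT_comp => //.
- move=> r x _; have [r0|r0] := leP 0%R r.
    by apply: mule_ge0; rewrite lee_fin// mulr_ge0.
  by rewrite preimage_nnfun0// indic0 mule0 mule0.
rewrite integralT_nnsfun sintegralE ge0_mule_fsumr.
  apply: eq_fsbigr => r _.
  have [r0|r0] := leP 0%R r; last first.
    rewrite preimage_nnfun0// measure0 !mule0.
    by apply: integral0_eq => x _; rewrite indic0 !mule0.
  rewrite ge0_integralZl_EFin//.
  - by rewrite H// muleCA.
  - by move=> x _; rewrite mule_ge0// lee_fin.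
  - apply: emeasurable_funM; first exact/measurable_EFinP.
    by apply/measurable_EFinP; apply: measurableT_comp.
move=> r; have [r0|r0] := leP 0%R r; first by rewrite mule_ge0.
by rewrite preimage_nnfun0// measure0 mule0.
Qed.

Lemma integral_transfer (u : T' -> \bar R) : measurable_fun setT u -> (forall y, 0 <= u y) ->
  \int[m]_x ((rho x)%:E * u (phi x)) = c%:E * \int[m']_y u y.
Proof.
move=> mu u0; pose f := nnsfun_approx measurableT mu.
have fu y : (f k y)%:E @[k --> \oo] --> u y by exact: cvg_nnsfun_approx.
have ndf y : {homo (fun k => (f k y)%:E) : i j / (i <= j)%N >-> i <= j}.
  by move=> i j ij; rewrite lee_fin; exact/lefP/nd_nnsfun_approx.
have lim1 : \int[m]_x ((rho x)%:E * (f k (phi x))%:E) @[k --> \oo] -->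
    \int[m]_x ((rho x)%:E * u (phi x)).
  rewrite (eq_integral (fun x => limn (fun k => (rho x)%:E * (f k (phi x))%:E))); last first.
    move=> x _; apply/esym/cvg_lim => //; apply: cvgeMl => //; exact: fu.
  apply: cvg_monotone_convergence => //.
  - move=> k; apply: emeasurable_funM; first exact/measurable_EFinP.
    by apply/measurable_EFinP; exact: measurableT_comp.
  - by move=> k x _; rewrite mule_ge0// lee_fin.
  - by move=> x _ i j ij; rewrite lee_wpmul2l// ?lee_fin//; apply: ndf.
have lim2 : c%:E * \int[m']_y (f k y)%:E @[k --> \oo] --> c%:E * \int[m']_y u y.
  apply: cvgeMl => //.
  rewrite (eq_integral (fun y => limn (fun k => (f k y)%:E))); last first.
    by move=> y _; apply/esym/cvg_lim => //; exact: fu.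
  apply: cvg_monotone_convergence => //.
  - by move=> k; exact/measurable_EFinP.
  - by move=> k x _; rewrite lee_fin.
apply: (cvg_unique (@ereal_hausdorff R) lim1).
rewrite (_ : (fun k => _) = fun k => c%:E * \int[m']_y (f k y)%:E)//.
by apply/funext => k; exact: transfer_nnsfun.
Qed.

End transfer.

Section sphere_measure_structure.
Local Open Scope ereal_scope.
Variables (R : realType).

Lemma sphere_measure_setT_lty n : sphere_measure n [set: 'rV[R]_n] < +oo.
Proof.
case: n => [|m]; last exact: sphere_measure_lty.
rewrite /sphere_measure (_ : _ `&` _ = set0) ?hausdorff_measure0//.
apply/seteqP; split => // v [_]; rewrite /unit_sphere/= (_ : v = 0%R).
  by rewrite enorm0 => /eqP; rewrite eq_sym oner_eq0.
by apply/rowP => -[].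
Qed.

Lemma sphere_measure_ex n : exists M : {sigma_finite_measure set 'rV[R]_n -> \bar R},
  sphere_measure n = M.
Proof.
apply: sigma_finite_measure_ex.
- by rewrite /sphere_measure set0I hausdorff_measure0.
- by move=> A; exact: hausdorff_measure_ge0.
- exact: sphere_measure_sigma_additive.
- exists (fun=> setT); first by rewrite bigcup_const//; exists 0%N.
  by move=> _; split => //; exact: sphere_measure_setT_lty.
Qed.

End sphere_measure_structure.

Section density.
Local Open Scope ereal_scope.
Context d (T : measurableType d) (R : realType).
Variables (m : {measure set T -> \bar R}) (f : T -> \bar R).
Hypotheses (mf : measurable_fun setT f) (f0 : forall x, 0 <= f x).
Hypothesis foo : \int[m]_x f x < +oo.

(** The image of a measure with integrable density; finiteness of the integral makes it
    sigma-finite. *)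
Lemma pushforward_density_ex d' (T' : measurableType d') (phi : T -> T') :
  measurable_fun setT phi ->
  exists M : {sigma_finite_measure set T' -> \bar R},
    forall A, M A = \int[m]_(x in phi @^-1` A) f x.
Proof.
move=> mphi.
have [||||M ME] := @sigma_finite_measure_ex d' T' R (fun A => \int[m]_(x in phi @^-1` A) f x).
- by rewrite preimage_set0 integral_set0.
- by move=> A; exact: integral_ge0.
- move=> F mF tF mUF; rewrite preimage_bigcup ge0_integral_bigcup//.
  + by apply: is_cvg_ereal_nneg_natsum => k _; exact: integral_ge0.
  + by move=> k; exact: measurable_preimageT.
  + exact: measurable_funTS.
  + apply/trivIsetP => i j _ _ ij; rewrite -preimage_setI.
    by move/trivIsetP : tF => /(_ i j I I ij) ->; rewrite preimage_set0.
- exists (fun=> setT); first by rewrite bigcup_const//; exists 0%N.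
  by move=> _; split => //; rewrite preimage_setT.
by exists M => A; rewrite -ME.
Qed.

End density.

Section radial.
Local Open Scope ereal_scope.
Variables (R : realType) (m : nat).
Notation n := m.+1.
Notation L := (@lebesgue_rV R n).
Variable rho : 'rV[R]_n -> R.
Hypotheses (mrho : measurable_fun setT rho) (rho_ge0 : forall x, (0 <= rho x)%R).
Hypotheses (rho_refl : forall w x, rho (refl w x) = rho x) (rho0 : rho 0%R = 0%R).
Hypothesis rho_lty : \int[L]_x (rho x)%:E < +oo.

(** The image of a radial density under [udir] is invariant under reflections,
    hence proportional to the Hausdorff measure of the sphere. *)
Lemma radial_transfer (u : 'rV[R]_n -> \bar R) : measurable_fun setT u ->
  (forall y, 0 <= u y) ->
  \int[L]_x ((rho x)%:E * u (udir x)) =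
  (fine (\int[L]_x (rho x)%:E) / fine (sphere_measure n [set: 'rV[R]_n]))%:E *
  \int[sphere_measure n]_y u y.
Proof.
move=> mu u0.
have mrhoE : measurable_fun setT (fun x => (rho x)%:E : \bar R) by exact/measurable_EFinP.
have [N NE] := pushforward_density_ex mrhoE (fun x => ltac:(by rewrite lee_fin)) rho_lty (@measurable_udir R n).
have [H HE] := @sphere_measure_ex R n.
have NT : \int[L]_x (rho x)%:E = N setT by rewrite NE preimage_setT.
rewrite NT HE.
have HT : 0 < H setT < +oo.
  by rewrite -HE sphere_measure_gt0 sphere_measure_lty.
apply: integral_transfer => //.
  exact: measurable_udir.
move=> A mA.
have mudA := measurable_preimageT (@measurable_udir R n) mA.
rewrite -(@reflection_invariant_proportional R n N H)//.
- rewrite NE [RHS]integral_mkcond; apply: eq_integral => x _.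
  rewrite patchE; case: ifPn; rewrite ?inE ?notin_setE => h.
    by rewrite indicE mem_set// mule1.
  by rewrite indicE memNset// mule0.
- move=> B mB; rewrite !NE; rewrite integral_mkcond [RHS]integral_mkcond.
  apply: eq_integral => x _; rewrite !patchE.
  have [->|x0] := eqVneq x 0%R; first by rewrite rho0 !if_same.
  congr (if _ then _ else _); apply/idP/idP; rewrite !inE; last by case.
  by move=> Bx; split => //; rewrite /unit_sphere/= enorm_udir.
- by move=> B mB; rewrite -HE; exact: sphere_measure_restr.
- move=> w B mB; rewrite !NE integral_mkcond [RHS]integral_mkcond.
  rewrite -(@integral_refl _ _ w ((fun x => (rho x)%:E) \_ (@udir R n @^-1` B)))//.
  + apply: eq_integral => x _; rewrite !patchE rho_refl.
    congr (if _ then _ else _); apply/idP/idP; rewrite !inE/= udir_refl//.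
  + apply/(measurable_restrictT _ _).1; last exact: measurable_funTS.
    by apply: measurable_preimageT => //; exact: measurable_udir.
  + by move=> x; rewrite patchE; case: ifP => // _; rewrite lee_fin.
- by move=> w B mB; rewrite -HE; exact: sphere_measure_refl.
- by rewrite -NT.
Qed.

End radial.

(** * Powers of the norm integrated over balls *)

Section kernel.
Local Open Scope ereal_scope.
Variables (R : realType) (n : nat).
Notation L := (@lebesgue_rV R n).

(** Equal to [|x|^(p - s)] off the origin; keeping the quotient gives the value 0 at the
    origin, which is the convention of the seminorms for degenerate simplices. *)
Definition rquot (p s : R) (x : 'rV[R]_n) : R := (enorm x `^ p / enorm x `^ s)%R.

Lemma rquot_ge0 p s x : (0 <= rquot p s x)%R.
Proof. by rewrite divr_ge0// powR_ge0. Qed.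

Lemma rquot0 p s : p != 0%R -> rquot p s 0%R = 0%R.
Proof. by move=> p0; rewrite /rquot enorm0 powR0// mul0r. Qed.

Lemma rquotE p s x : x != 0%R -> rquot p s x = (enorm x `^ (p - s))%R.
Proof.
rewrite -enorm_gt0 => x0; rewrite /rquot powRD ?powRN//.
by rewrite (gt_eqF x0) implybT.
Qed.

Lemma measurable_rquot p s : measurable_fun setT (rquot p s).
Proof.
rewrite (_ : rquot p s = fun x => enorm x `^ p * enorm x `^ (- s))%R; last first.
  by apply/funext => x; rewrite powRN.
by apply: measurable_funM;
  exact: measurableT_comp (measurable_powR _) (@measurable_enorm R n).
Qed.

Lemma rquotZ p s (a : R) x : (0 < a)%R ->
  rquot p s (a *: x) = (a `^ (p - s) * rquot p s x)%R.
Proof.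
move=> a0; rewrite /rquot enormZ (gtr0_norm a0) !powRM ?enorm_ge0 ?ltW//.
rewrite powRD ?(gt_eqF a0) ?implybT// powRN invfM; ring.
Qed.

Variables (p s : R).
Hypotheses (p0 : p != 0%R).
Let e : R := (n%:R + p - s)%R.
Notation Q D := (\int[L]_(x in D) (rquot p s x)%:E).

Let mq D : measurable_fun D (fun x => (rquot p s x)%:E).
Proof. by apply: measurable_funTS; apply/measurable_EFinP; exact: measurable_rquot. Qed.

(** Homogeneity of Lebesgue measure. *)
Lemma Q_scale (a : R) (D : set 'rV[R]_n) : (0 < a)%R -> measurable D ->
  Q [set x | D (a^-1 *: x)%R] = (a `^ e)%:E * Q D.
Proof.
move=> a0 mD; pose f x : \bar R := ((fun x => (rquot p s x)%:E) \_ [set x | D (a^-1 *: x)%R]) x.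
have mD' : measurable [set x | D (a^-1 *: x)%R].
  by apply: (measurable_preimageT _ mD); apply: measurable_rowZ.
have mf : measurable_fun setT f by apply/(measurable_restrictT _ _).1.
have f0 x : 0 <= f x.
  by rewrite /f patchE; case: ifP => // _; rewrite lee_fin rquot_ge0.
have := integral_dilate a0 mf f0.
rewrite -[X in _ * X]integral_mkcond => h.
have : (a ^+ n)%:E * \int[L]_x f (a *: x)%R = Q [set x | D (a^-1 *: x)%R].
  by rewrite h muleA -EFinM -exprMn mulfV ?gt_eqF// expr1n mul1e.
move=> <-.
have -> : \int[L]_x f (a *: x)%R = (a `^ (p - s))%:E * Q D.
  rewrite -ge0_integralZl_EFin//; last 2 first.
  - by move=> x _; rewrite lee_fin rquot_ge0.
  - exact: powR_ge0.
  rewrite [RHS]integral_mkcond; apply: eq_integral => x _.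
  rewrite /f !patchE.
  have -> : (a *: x \in [set x | D (a^-1 *: x)%R])%R = (x \in D).
    by apply/idP/idP; rewrite !inE/= scalerA mulVf ?gt_eqF// scale1r.
  by case: ifP => // _; rewrite rquotZ.
rewrite muleA -EFinM; congr (_%:E * _).
rewrite /e -addrA [RHS]powRD; last by rewrite (gt_eqF a0) implybT.
by rewrite powR_mulrn ?ltW.
Qed.

Definition shell (r t : R) : set 'rV[R]_n := [set x | (r <= enorm x < t)%R].

Arguments shell (r t)%_ring_scope.

Lemma measurable_shell r t : measurable (shell r t).
Proof.
have -> : shell r t = [set x | (r <= enorm x)%R] `&` [set x | (enorm x < t)%R].
  by apply/seteqP; split => x /=; [move=> /andP[]|move=> [h1 h2]; rewrite /shell/= h1].
apply: measurableI.
  by apply: measurable_ler_set; [exact: measurable_cst|exact: measurable_enorm].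
by apply: measurable_ltr_set; [exact: measurable_enorm|exact: measurable_cst].
Qed.

Lemma shell_scale (a r t : R) : (0 < a)%R ->
  shell (a * r) (a * t) = [set x | shell r t (a^-1 *: x)%R].
Proof.
move=> a0; apply/seteqP; split => x; rewrite /shell/= enormZ gtr0_norm ?invr_gt0//;
  by rewrite ler_pdivlMl// ltr_pdivrMl.
Qed.

Lemma Q_shell_split (r t u : R) : (r <= t)%R -> (t <= u)%R ->
  Q (shell r u) = Q (shell t u) + Q (shell r t).
Proof.
move=> rt tu; rewrite -ge0_integral_setU//=.
- congr (integral _ _ _); apply/seteqP; split => x; rewrite /shell/=.
    by move=> /andP[h1 h2]; case: (leP t (enorm x)) => h; [left; rewrite h2|right; rewrite h1].
  move=> [/andP[h1 h2]|/andP[h1 h2]]; apply/andP; split => //.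
    by rewrite (le_trans rt).
  by rewrite (lt_le_trans h2).
- exact: measurable_shell.
- exact: measurable_shell.
- by move=> x _; rewrite lee_fin rquot_ge0.
- by apply/disj_setPS => x [/andP[h1 _] /andP[_ h2]]; move: h1; rewrite leNgt h2.
Qed.

Hypothesis e0 : (0 < e)%R.
Let z : R := (2^-1 `^ e)%R.
Let z0 : (0 < z)%R. Proof. by rewrite powR_gt0// invr_gt0. Qed.
Let z1 : (z < 1)%R.
Proof.
have h : (2^-1 < 1 :> R)%R by rewrite invf_lt1// ltr1n.
have := @gt0_ltr_powR R e e0 (2^-1)%R 1%R.
by rewrite !nnegrE invr_ge0 ler0n ler01 powR1 => /(_ isT isT h).
Qed.

Lemma Q_shell_half r (t : R) : Q (shell (r / 2) (t / 2)) = z%:E * Q (shell r t).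
Proof.
rewrite mulrC (mulrC t) shell_scale ?invr_gt0// Q_scale ?invr_gt0//.
exact: measurable_shell.
Qed.

Hypothesis A_fin : Q (shell 2^-1 1) < +oo.

Let A : R := fine (Q (shell 2^-1 1)).
Let AE : Q (shell 2^-1 1) = A%:E.
Proof.
rewrite fineK// ge0_fin_numE//; apply: integral_ge0 => x _.
by rewrite lee_fin rquot_ge0.
Qed.

(** Partial sums of a geometric series: halving a shell multiplies its integral by [z]. *)
Lemma Q_shell_le k : Q (shell (2^-1 ^+ k) 1) <= (A / (1 - z))%:E.
Proof.
have A0 : (0 <= A)%R.
  by rewrite fine_ge0//; apply: integral_ge0 => x _; rewrite lee_fin rquot_ge0.
elim: k => [|k IH].
  have -> : shell (2^-1 ^+ 0) 1 = set0.
    apply/seteqP; split => // x /andP[h1 h2].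
    by have := le_lt_trans h1 h2; rewrite expr0 ltxx.
  by rewrite integral_set0 lee_fin divr_ge0// subr_ge0 ltW.
rewrite (@Q_shell_split _ 2^-1%R); last 2 first.
- by rewrite exprS ler_piMr ?invr_ge0// exprn_ile1 ?invr_ge0// invf_le1// ler1n.
- by rewrite invf_le1// ler1n.
have -> : Q (shell (2^-1 ^+ k.+1) 2^-1) = z%:E * Q (shell (2^-1 ^+ k) 1).
  by rewrite -Q_shell_half exprSr mul1r.
rewrite AE.
have -> : (A / (1 - z) = A + z * (A / (1 - z)))%R.
  by field; rewrite subr_eq0 eq_sym lt_eqF.
by rewrite EFinD EFinM leeD2l// lee_pmul2l// lte_fin.
Qed.

Lemma Q_ball_shell (t : R) : (0 < t)%R -> Q (shell 0 t) = Q (\bigcup_k shell (2^-1 ^+ k) t).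
Proof.
move=> t0; rewrite integral_mkcond [RHS]integral_mkcond; apply: eq_integral => x _.
rewrite !patchE; have [->|x0] := eqVneq x 0%R; first by rewrite rquot0// !if_same.
congr (if _ then _ else _); apply/idP/idP; rewrite !inE; last first.
  by move=> [k _ /andP[h1 h2]]; rewrite /shell/= enorm_ge0.
move=> /andP[_ xt]; rewrite -enorm_gt0 in x0.
have /cvgrPdist_lt /(_ _ x0) : (2^-1 ^+ k : R)%R @[k --> \oo] --> (0 : R)%R.
  by apply: cvg_expr; rewrite ger0_norm ?invr_ge0// invf_lt1// ltr1n.
move=> [N _ /(_ N (leqnn N))]; rewrite /= sub0r normrN => h.
exists N => //; rewrite /shell/= xt andbT ltW// (le_lt_trans (ler_norm _) h)//.
Qed.

(** Removing the shell [1/2 <= |x| < 1] leaves the half-size ball, so that the integral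
    solves [Q = A + z Q]; it is finite by [Q_shell_le]. *)
Lemma Q_ball1 : Q (shell 0 1) = (A / (1 - z))%:E.
Proof.
have le1 : Q (shell 0 1) <= (A / (1 - z))%:E.
  rewrite Q_ball_shell//.
  have nd : {homo (fun k => shell (2^-1 ^+ k) 1) : i j / (i <= j)%N >-> (i <= j)%O}.
    move=> i j ij; apply/subsetPset => x /andP[h1 h2]; rewrite /shell/= h2 andbT.
    by rewrite (le_trans _ h1)// ler_wiXn2l// ?invr_ge0// invf_le1// ler1n.
  have := @ge0_nondecreasing_set_cvg_integral _ _ R _ (fun x => (rquot p s x)%:E) L nd
    (fun k => measurable_shell _ _) (fun k => @mq _) (fun i x _ => ltac:(by rewrite lee_fin rquot_ge0)).
  by apply: cvge_le; apply: nearW => k; exact: Q_shell_le.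
have fin : Q (shell 0 1) \is a fin_num.
  rewrite ge0_fin_numE; first by rewrite (le_lt_trans le1)// ltry.
  by apply: integral_ge0 => x _; rewrite lee_fin rquot_ge0.
have half0 : (0 <= 2^-1 :> R)%R by rewrite invr_ge0.
have half1 : (2^-1 <= 1 :> R)%R by rewrite invf_le1// ler1n.
have := Q_shell_split half0 half1.
have -> : Q (shell 0 2^-1) = z%:E * Q (shell 0 1) by rewrite -Q_shell_half mul0r mul1r.
rewrite AE.
rewrite -(fineK fin) -EFinM -EFinD => -[h]; congr EFin.
have nz : (1 - z != 0)%R by rewrite subr_eq0 eq_sym lt_eqF.
by apply: (mulIf nz); rewrite divfK// mulrBr mulr1 {1}h mulrC; ring.
Qed.

Lemma Q_ball (t : R) : (0 < t)%R -> Q (shell 0 t) = (t `^ e * (A / (1 - z)))%:E.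
Proof.
move=> t0; have -> : shell 0 t = shell (t * 0) (t * 1) by rewrite mulr0 mulr1.
by rewrite shell_scale// Q_scale//; [rewrite Q_ball1|exact: measurable_shell].
Qed.

End kernel.

(** * The mass of the kernel near [theta = 1] *)

Section kernel_mass.
Local Open Scope ereal_scope.
Variables (R : realType) (n : nat) (p : R).
Hypothesis p_ge1 : (1 <= p)%R.
Notation L := (@lebesgue_rV R n).

Let p_gt0 : (0 < p)%R. Proof. exact: lt_le_trans p_ge1. Qed.

(** The weight carried by each edge in the truncated seminorm. *)
Definition rho (theta delta : R) (x : 'rV[R]_n) : R :=
  if (enorm x < delta)%R then ((1 - theta) * rquot p (n%:R + theta * p) x)%R else 0%R.

Definition mass (theta delta : R) : R := fine (\int[L]_x (rho theta delta x)%:E).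

Lemma rho_ge0 theta delta x : (theta <= 1)%R -> (0 <= rho theta delta x)%R.
Proof.
by move=> t1; rewrite /rho; case: ifP => // _; rewrite mulr_ge0 ?subr_ge0// rquot_ge0.
Qed.

Lemma measurable_rho theta delta : measurable_fun setT (rho theta delta).
Proof.
apply: measurable_fun_ifT => //.
- by apply: measurable_fun_ltr => //; exact: measurable_enorm.
- by apply: measurable_funM => //; exact: measurable_rquot.
Qed.

Lemma rho_refl theta delta w x : rho theta delta (refl w x) = rho theta delta x.
Proof. by rewrite /rho /rquot enorm_refl. Qed.

Lemma rho0 theta delta : rho theta delta 0%R = 0%R.
Proof. by rewrite /rho rquot0 ?gt_eqF// mulr0 if_same. Qed.

Lemma integral_rho theta delta : (theta <= 1)%R ->
  \int[L]_x (rho theta delta x)%:E =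
  (1 - theta)%:E * \int[L]_(x in shell 0%R delta) (rquot p (n%:R + theta * p) x)%:E.
Proof.
move=> t1; rewrite -ge0_integralZl_EFin//.
- rewrite [RHS]integral_mkcond; apply: eq_integral => x _; rewrite patchE /rho.
  have -> : (x \in shell 0%R delta) = (enorm x < delta)%R.
    by apply/idP/idP; rewrite inE /shell/= enorm_ge0.
  by case: ifP.
- exact: measurable_shell.
- by move=> x _; rewrite lee_fin rquot_ge0.
- by apply: measurable_funTS; apply/measurable_EFinP; exact: measurable_rquot.
- by rewrite subr_ge0.
Qed.

End kernel_mass.

Section mass_limit.
Local Open Scope ereal_scope.
Variables (R : realType) (m : nat) (p : R).
Notation n := m.+1.
Hypothesis p_ge1 : (1 <= p)%R.
Notation L := (@lebesgue_rV R n).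

Let p_gt0 : (0 < p)%R. Proof. exact: lt_le_trans p_ge1. Qed.
Let p_neq0 : p != 0%R. Proof. by rewrite gt_eqF. Qed.

Let I (theta : R) := \int[L]_(x in shell 2^-1%R 1%R) (rquot p (n%:R + theta * p) x)%:E.

Let mq theta D : measurable_fun D (fun x : 'rV[R]_n => (rquot p (n%:R + theta * p) x)%:E).
Proof. by apply: measurable_funTS; apply/measurable_EFinP; exact: measurable_rquot. Qed.

Let half_le x : shell 2^-1%R 1%R x -> (x : 'rV[R]_n) != 0%R.
Proof.
move=> /andP[h _]; rewrite -enorm_gt0; apply: lt_le_trans h.
by rewrite invr_gt0.
Qed.

Let I1_lty : I 1%R < +oo.
Proof.
have le2 (x : 'rV[R]_n) : shell 2^-1%R 1%R x -> (rquot p (n%:R + 1 * p) x <= 2 ^+ n)%R.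
  move=> xs; rewrite rquotE ?half_le//.
  rewrite (_ : (p - (n%:R + 1 * p) = - n%:R)%R); last by ring.
  rewrite powRN powR_mulrn ?enorm_ge0//; move: xs => /andP[h _].
  rewrite -[leRHS]invrK lef_pV2 ?posrE ?invr_gt0 ?exprn_gt0//; last first.
    by apply: lt_le_trans h; rewrite invr_gt0.
  by rewrite -exprVn lerXn2r ?nnegrE ?invr_ge0 ?enorm_ge0.
apply: (@le_lt_trans _ _ (\int[L]_(x in shell 2^-1%R 1%R) (cst (2 ^+ n)%:E x))).
  apply: ge0_le_integral => //.
  - exact: measurable_shell.
  - by move=> x _; rewrite lee_fin rquot_ge0.
rewrite integral_cst; last exact: measurable_shell.
rewrite lte_mul_pinfty ?lee_fin ?exprn_ge0//.
apply: (le_lt_trans _ (@lebesgue_eball_lty R n 0%R 1%R)); apply: le_measure; rewrite ?inE.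
- exact: measurable_shell.
- exact: measurable_eball.
- by move=> x /andP[_ h]; rewrite /eball/= subr0.
Qed.

Let I1_gt0 : 0 < I 1%R.
Proof.
pose c : 'rV[R]_n := (3 / 4)%R *: delta_mx ord0 ord0.
have cE : enorm c = (3 / 4)%R.
  by rewrite enormZ enorm_delta mulr1 ger0_norm// divr_ge0.
apply: (@lt_le_trans _ _ (\int[L]_(x in shell 2^-1%R 1%R) (cst 1 x))); last first.
  apply: ge0_le_integral => //.
  - exact: measurable_shell.
  - move=> x xs; rewrite lee_fin rquotE ?half_le//.
    rewrite (_ : (p - (n%:R + 1 * p) = - n%:R)%R); last by ring.
    rewrite powRN powR_mulrn ?enorm_ge0// invf_ge1.
      by rewrite exprn_ile1 ?enorm_ge0//; move: xs => /andP[_ /ltW].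
    by rewrite exprn_gt0// enorm_gt0 half_le.
rewrite integral_cst ?mul1e; last exact: measurable_shell.
have r0 : (0 < (8^-1 : R))%R by rewrite invr_gt0.
apply: (lt_le_trans (@lebesgue_eball_gt0 R n c _ r0)); apply: le_measure; rewrite ?inE.
- exact: measurable_eball.
- exact: measurable_shell.
- move=> x; rewrite /eball/shell/= => xc.
  have := enormD (x - c)%R c; rewrite subrK cE.
  have := enormB_le c 0%R x; rewrite !subr0 cE (enormC c x).
  by move=> h1 h2; apply/andP; split; lra.
Qed.

Let a : R := fine (I 1%R).
Let a_gt0 : (0 < a)%R. Proof. by rewrite fine_gt0// I1_gt0 I1_lty. Qed.
Let aE : I 1%R = a%:E.
Proof. by rewrite fineK// ge0_fin_numE ?I1_lty// ltW// I1_gt0. Qed.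

Let e (theta : R) : R := (n%:R + p - (n%:R + theta * p))%R.
Let eE theta : e theta = ((1 - theta) * p)%R.
Proof. by rewrite /e; ring. Qed.

Let z (theta : R) : R := (2^-1 `^ e theta)%R.

Let I_bounds theta : (theta < 1)%R -> (z theta * a)%:E <= I theta <= a%:E.
Proof.
move=> t1; have e0 : (0 < e theta)%R by rewrite eE mulr_gt0// subr_gt0.
have E (x : 'rV[R]_n) : shell 2^-1%R 1%R x ->
    rquot p (n%:R + theta * p) x = (enorm x `^ e theta * rquot p (n%:R + 1 * p) x)%R.
  move=> xs; rewrite !rquotE ?half_le// -powRD.
    by congr (_ `^ _)%R; rewrite /e; ring.
  by apply/implyP => _; rewrite gt_eqF// enorm_gt0 half_le.
have mS := @measurable_shell R n 2^-1%R 1%R.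
have zl (x : 'rV[R]_n) : shell 2^-1%R 1%R x -> (z theta <= enorm x `^ e theta <= 1)%R.
  move=> /andP[h1 h2]; have h0 : (0 <= 2^-1 :> R)%R by rewrite invr_ge0.
  rewrite /z ge0_ler_powR ?nnegrE ?enorm_ge0 ?(ltW e0)//=.
  have := @ge0_ler_powR R (e theta) (ltW e0) (enorm x) 1%R.
  by rewrite !nnegrE enorm_ge0 ler01 powR1 => /(_ isT isT (ltW h2)).
apply/andP; split.
  have f0 (x : 'rV[R]_n) : shell 2^-1%R 1%R x -> 0 <= (rquot p (n%:R + 1 * p) x)%:E.
    by move=> _; rewrite lee_fin rquot_ge0.
  rewrite EFinM -aE -(ge0_integralZl_EFin L mS f0 _ (powR_ge0 _ _)); last exact: mq.
  apply: (ge0_le_integral _ mS).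
  - by move=> x xs; apply: mule_ge0; [rewrite lee_fin powR_ge0|exact: f0].
  - by apply: emeasurable_funM; [exact: measurable_cst|exact: mq].
  - exact: mq.
  - move=> x xs; rewrite E// -EFinM lee_fin ler_wpM2r ?rquot_ge0//.
    by have /andP[] := zl x xs.
rewrite -aE; apply: ge0_le_integral => //.
- by move=> x _; rewrite lee_fin rquot_ge0.
- move=> x xs; rewrite E// lee_fin ler_piMl ?rquot_ge0//.
  by have /andP[] := zl x xs.
Qed.

Lemma integral_rho_E theta delta : (theta < 1)%R -> (0 < delta)%R ->
  \int[L]_x (rho p theta delta x)%:E =
  ((1 - theta) * (delta `^ e theta * (fine (I theta) / (1 - z theta))))%R%:E.
Proof.
move=> t1 d0; have e0 : (0 < e theta)%R by rewrite eE mulr_gt0// subr_gt0.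
rewrite (integral_rho n p delta (ltW t1)) (Q_ball p_neq0 e0 _ d0); first by rewrite [RHS]EFinM.
by have /andP[_ /le_lt_trans] := I_bounds t1; apply; rewrite ltry.
Qed.

Lemma integral_rho_lty theta delta : (theta < 1)%R -> (0 < delta)%R ->
  \int[L]_x (rho p theta delta x)%:E < +oo.
Proof. by move=> t1 d0; rewrite integral_rho_E// ltry. Qed.

Let l2 : R := ln 2.
Let l2_gt0 : (0 < l2)%R. Proof. by rewrite ln_gt0// ltr1n. Qed.

Let powR_e (t : R) theta : (0 < t)%R -> (t `^ e theta)%R = expR ((1 - theta) * (p * ln t)).
Proof. by move=> t0; rewrite /powR gt_eqF// eE mulrA. Qed.

Let zE theta : z theta = expR (- ((1 - theta) * (p * l2))).
Proof. by rewrite /z powR_e ?invr_gt0// lnV ?posrE// mulrN mulrN. Qed.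

(** With [x = (1 - theta) p ln 2], the inequalities [1 - x <= exp (- x)] and
    [exp (- x) <= 1 / (1 + x)] pin down [(1 - theta) / (1 - 2 ^ (- (1 - theta) p))]. *)
Let mass_bounds (theta delta : R) : (theta < 1)%R -> (0 < delta)%R ->
  (expR ((1 - theta) * (p * ln delta)) * expR (- ((1 - theta) * (p * l2))) * (a / (p * l2))
   <= mass n p theta delta :> R)%R /\
  (mass n p theta delta <= expR ((1 - theta) * (p * ln delta)) *
   ((1 + (1 - theta) * (p * l2)) * (a / (p * l2))) :> R)%R.
Proof.
move=> t1 d0; rewrite /mass integral_rho_E//= powR_e//.
have /andP[] := I_bounds t1.
have -> : I theta = (fine (I theta))%:E.
  rewrite fineK// ge0_fin_numE.
    by have /andP[_ /le_lt_trans] := I_bounds t1; apply; rewrite ltry.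
  by apply: integral_ge0 => x _; rewrite lee_fin rquot_ge0.
rewrite !lee_fin/= zE; set x := ((1 - theta) * (p * l2))%R.
set D := expR (_ * (p * ln delta)); move: (fine _) => A zA Aa.
have pl : (0 < p * l2)%R by rewrite mulr_gt0.
have x0 : (0 < x)%R by rewrite mulr_gt0// subr_gt0.
have D0 : (0 < D)%R by exact: expR_gt0.
have w0 : (0 < expR (- x))%R by exact: expR_gt0.
have h1 : (1 - x <= expR (- x))%R by exact: expR_ge1Dx.
have h2 : (expR (- x) * (1 + x) <= 1)%R.
  rewrite expRN mulrC ler_pdivrMr ?expR_gt0// mul1r; exact: expR_ge1Dx.
have w1 : (expR (- x) < 1)%R by rewrite -expR0 ltr_expR oppr_lt0.
have A0 : (0 <= A)%R by rewrite (le_trans _ zA)// mulr_ge0// ltW.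
have tx : (1 - theta = x / (p * l2))%R by rewrite /x mulfK// gt_eqF.
have q1 : (1 <= x / (1 - expR (- x)))%R.
  by rewrite ler_pdivlMr ?subr_gt0// mul1r; lra.
have q2 : (x / (1 - expR (- x)) <= 1 + x)%R.
  by rewrite ler_pdivrMr ?subr_gt0//; nra.
have -> : ((1 - theta) * (D * (A / (1 - expR (- x)))) =
    D * (A * (x / (1 - expR (- x)) / (p * l2))))%R.
  by rewrite tx; field; rewrite !gt_eqF ?subr_gt0.
have il : (0 < (p * l2)^-1)%R by rewrite invr_gt0.
split.
  rewrite -mulrA ler_pM2l// mulrA; apply: ler_pM => //.
  - by rewrite mulr_ge0// ltW.
  - exact: ltW.
  - by rewrite ler_pdivlMr// mulVf// gt_eqF.
rewrite ler_pM2l// mulrA [leRHS]mulrA ler_pM2r// mulrC; apply: ler_pM => //.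
by rewrite (le_trans _ q1).
Qed.

Let cvg_lin (c : R) : ((1 - theta) * c)%R @[theta --> 1%R^'-] --> (0%R : R).
Proof.
apply: cvg_at_left_filter.
have -> : 0%R = ((1 - 1) * c)%R :> R by rewrite subrr mul0r.
by apply: cvgMl; apply: cvgB; [exact: cvg_cst|exact: cvg_id].
Qed.

Let cvg_exp_lin (c : R) : expR ((1 - theta) * c) @[theta --> 1%R^'-] --> (1%R : R).
Proof. by rewrite -[X in _ --> X]expR0; apply: continuous_cvg; [exact: continuous_expR|exact: cvg_lin]. Qed.

(** By scaling, the mass is [(1 - theta) delta^e I / (1 - 2^(-e))] with
    [e = (1 - theta) p], where the integral [I] over the unit shell converges to its
    value at [theta = 1]. Hence the limit [I / (p ln 2)] does not depend on [delta]. *)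
Lemma mass_limit : exists2 C : R, (0 < C)%R &
  forall delta : R, (0 < delta)%R -> mass n p theta delta @[theta --> 1%R^'-] --> C.
Proof.
have pl : (0 < p * l2)%R by rewrite mulr_gt0.
exists (a / (p * l2))%R => [|delta d0]; first by rewrite divr_gt0.
apply: (@squeeze_cvgr _ _ _ _
  (fun theta => expR ((1 - theta) * (p * ln delta)) * expR (- ((1 - theta) * (p * l2))) * (a / (p * l2)))%R
  (fun theta => expR ((1 - theta) * (p * ln delta)) * ((1 + (1 - theta) * (p * l2)) * (a / (p * l2))))%R).
- near=> theta.
  have t1 : (theta < 1)%R by near: theta; exact: nbhs_left_lt.
  by have [-> ->] := mass_bounds t1 d0.
- rewrite -[X in _ --> X]mul1r; apply: cvgMl; rewrite -[X in _ --> X]mul1r.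
  apply: cvgM; first exact: cvg_exp_lin.
  by under eq_fun do rewrite -mulrN; exact: cvg_exp_lin.
- rewrite -[X in _ --> X]mul1r; apply: cvgM; first exact: cvg_exp_lin.
  rewrite -[X in _ --> X]mul1r; apply: cvgMl; rewrite -[X in _ --> X]addr0.
  by apply: cvgD; [exact: cvg_cst|exact: cvg_lin].
Unshelve. all: by end_near. Qed.

End mass_limit.

(** * Continuity of translations *)

Section powR_ineq.
Variables (R : realType) (p : R).
Hypothesis p_ge1 : 1 <= p.

Let p_gt0 : 0 < p. Proof. exact: lt_le_trans p_ge1. Qed.

Lemma powR_homo (a b : R) : 0 <= a -> a <= b -> a `^ p <= b `^ p.
Proof.
by move=> a0 ab; apply: (ge0_ler_powR (ltW p_gt0)); rewrite ?nnegrE// (le_trans a0).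
Qed.

Lemma powR_normD_le (a b : R) : `|a + b| `^ p <= 2 `^ p * (`|a| `^ p + `|b| `^ p).
Proof.
wlog ab : a b / `|a| <= `|b|.
  move=> h; case: (leP `|a| `|b|) => [|/ltW] ab; first exact: h.
  by rewrite addrC [X in _ * X]addrC; exact: h.
apply: (@le_trans _ _ ((2 * `|b|) `^ p)).
  apply: powR_homo => //; rewrite (le_trans (ler_normD _ _))//.
  by rewrite mulr2n mulrDl mul1r lerD2r.
by rewrite powRM// ler_wpM2l ?powR_ge0// lerDr powR_ge0.
Qed.

Lemma powR_le_self (a : R) : 0 <= a <= 1 -> a `^ p <= a.
Proof.
move=> /andP[]; rewrite le_eqVlt => /predU1P[<- _|a0 a1].
  by rewrite powR0// gt_eqF.
by apply: ge1r_powR => //; rewrite a0.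
Qed.

End powR_ineq.

Section translation_continuity.
Local Open Scope ereal_scope.
Variables (R : realType) (n : nat) (p : R).
Hypothesis p_ge1 : (1 <= p)%R.
Notation L := (@lebesgue_rV R n).
Implicit Types (x y : 'rV[R]_n) (f g : 'rV[R]_n -> R) (A U : set 'rV[R]_n).

Let p_gt0 : (0 < p)%R. Proof. exact: lt_le_trans p_ge1. Qed.

(** The [p]-th power of the [L^p] norm. *)
Definition pnorm f : \bar R := \int[L]_x (`|f x| `^ p)%:E.

Definition shift_diff f (y : 'rV[R]_n) : \bar R :=
  \int[L]_x (`|f (x + y) - f x| `^ p)%:E.

Definition shift_continuous f := forall eta : R, (0 < eta)%R ->
  exists2 delta : R, (0 < delta)%R &
  forall y, (enorm y < delta)%R -> shift_diff f y <= eta%:E.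

Lemma measurable_pow f : measurable_fun setT f ->
  measurable_fun setT (fun x => (`|f x| `^ p)%:E : \bar R).
Proof.
move=> mf; apply/measurable_EFinP.
apply: (measurableT_comp (measurable_powR p)).
exact: measurableT_comp.
Qed.

Lemma pnorm_ge0 f : 0 <= pnorm f.
Proof. by apply: integral_ge0 => x _; rewrite lee_fin powR_ge0. Qed.

Lemma shift_diff_ge0 f y : 0 <= shift_diff f y.
Proof. by apply: integral_ge0 => x _; rewrite lee_fin powR_ge0. Qed.

Lemma measurable_translate f y : measurable_fun setT f ->
  measurable_fun setT (fun x : 'rV[R]_n => f (x + y)%R).
Proof. by move=> mf; apply: measurableT_comp mf _; apply: measurable_rowD. Qed.

Lemma measurable_shift_sub f y : measurable_fun setT f ->
  measurable_fun setT (fun x : 'rV[R]_n => f (x + y) - f x)%R.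
Proof. by move=> mf; apply: measurable_funB => //; exact: measurable_translate. Qed.

Lemma pnormD f g : measurable_fun setT f -> measurable_fun setT g ->
  pnorm (fun x => f x + g x)%R <= (2 `^ p)%:E * (pnorm f + pnorm g).
Proof.
move=> mf mg; have mfg := measurable_funD mf mg.
rewrite /pnorm -ge0_integralD//; try exact: measurable_pow.
rewrite -ge0_integralZl_EFin//.
- apply: ge0_le_integral => //.
  + exact: measurable_pow.
  + apply: emeasurable_funM => //; apply: emeasurable_funD; exact: measurable_pow.
  + by move=> x _; rewrite -EFinD -EFinM lee_fin; exact: powR_normD_le.
- by move=> x _; rewrite -EFinD lee_fin addr_ge0// powR_ge0.
- by apply: emeasurable_funD; exact: measurable_pow.
Qed.

Lemma shift_diffE f y : shift_diff f y = pnorm (fun x => f (x + y) - f x)%R.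
Proof. by []. Qed.

Lemma shift_diffD f g y : measurable_fun setT f -> measurable_fun setT g ->
  shift_diff (fun x => f x + g x)%R y <= (2 `^ p)%:E * (shift_diff f y + shift_diff g y).
Proof.
move=> mf mg; rewrite !shift_diffE.
apply: le_trans (pnormD (measurable_shift_sub y mf) (measurable_shift_sub y mg)).
rewrite le_eqVlt; apply/orP; left; apply/eqP; apply: eq_integral => x _.
by congr ((`|_| `^ p)%:E); ring.
Qed.

Lemma pnormZ (c : R) f : measurable_fun setT f ->
  pnorm (fun x => c * f x)%R = (`|c| `^ p)%:E * pnorm f.
Proof.
move=> mf; rewrite /pnorm -ge0_integralZl_EFin ?powR_ge0//.
by apply: eq_integral => x _; rewrite normrM powRM.
exact: measurable_pow.
Qed.

Lemma shift_diffZ (c : R) f y : measurable_fun setT f ->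
  shift_diff (fun x => c * f x)%R y = (`|c| `^ p)%:E * shift_diff f y.
Proof.
move=> mf; rewrite !shift_diffE -pnormZ; last exact: measurable_shift_sub.
by apply: eq_integral => x _; rewrite mulrBr.
Qed.

Lemma pnorm_translate f y : measurable_fun setT f ->
  pnorm (fun x => f (x + y)%R) = pnorm f.
Proof.
move=> mf; rewrite /pnorm -[RHS](integral_translate y)//.
exact: measurable_pow.
Qed.

Lemma shift_diff_le f y : measurable_fun setT f ->
  shift_diff f y <= (2 `^ p * 2)%:E * pnorm f.
Proof.
move=> mf; rewrite shift_diffE.
have mNf : measurable_fun setT (fun x => - f x)%R by exact: measurableT_comp.
apply: le_trans (pnormD (measurable_translate y mf) mNf) _.
have -> : pnorm (fun x => - f x)%R = pnorm f.
  by apply: eq_integral => x _; rewrite normrN.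
by rewrite pnorm_translate// EFinM -muleA lee_wpmul2l ?lee_fin ?powR_ge0// mule_natl.
Qed.

Lemma shift_continuousD f g : measurable_fun setT f -> measurable_fun setT g ->
  shift_continuous f -> shift_continuous g -> shift_continuous (fun x => f x + g x)%R.
Proof.
move=> mf mg cf cg eta eta0.
pose t : R := (eta / (2 `^ p * 2))%R.
have c0 : (0 < (2 `^ p * 2) :> R)%R by rewrite mulr_gt0// powR_gt0.
have t0 : (0 < t)%R by rewrite divr_gt0.
have [d1 d10 h1] := cf t t0; have [d2 d20 h2] := cg t t0.
exists (Order.min d1 d2); first by rewrite lt_min d10.
move=> y; rewrite lt_min => /andP[y1 y2].
apply: le_trans (shift_diffD y mf mg) _.
apply: (@le_trans _ _ ((2 `^ p)%:E * (t%:E + t%:E))).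
  by apply: lee_wpmul2l; [rewrite lee_fin powR_ge0|exact: leeD (h1 y y1) (h2 y y2)].
by rewrite -EFinD -EFinM lee_fin -mulr2n -[(t *+ 2)%R]mulr_natr mulrCA /t divfK// gt_eqF.
Qed.

Lemma shift_continuousZ (c : R) f : measurable_fun setT f ->
  shift_continuous f -> shift_continuous (fun x => c * f x)%R.
Proof.
move=> mf cf eta eta0; pose t : R := (eta / (`|c| `^ p + 1))%R.
have c0 : (0 < `|c| `^ p + 1)%R by rewrite ltr_wpDl// powR_ge0.
have [d d0 h] := cf t ltac:(by rewrite divr_gt0).
exists d => // y yd; rewrite shift_diffZ//.
apply: (@le_trans _ _ ((`|c| `^ p + 1)%:E * t%:E)).
  rewrite lee_pmul ?lee_fin ?powR_ge0 ?shift_diff_ge0 ?lerDl//; exact: h.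
by rewrite -EFinM lee_fin /t mulrC divfK// gt_eqF.
Qed.

(** The functions with continuous translates form a closed subspace of [L^p]. *)
Lemma shift_continuous_approx f : measurable_fun setT f ->
  (forall eta : R, (0 < eta)%R -> exists g, [/\ measurable_fun setT g,
     shift_continuous g & pnorm (fun x => f x - g x)%R <= eta%:E]) ->
  shift_continuous f.
Proof.
move=> mf h eta eta0.
pose K : R := (2 `^ p)%R; have K0 : (0 < K)%R by rewrite powR_gt0.
pose t : R := (eta / (K * (K * 2) + K))%R.
have D0 : (0 < K * (K * 2) + K)%R by rewrite addr_gt0// !mulr_gt0.
have t0 : (0 < t)%R by rewrite divr_gt0.
have [g [mg cg fg]] := h t t0.
have [d d0 gd] := cg t t0; exists d => // y yd.
have mfg : measurable_fun setT (fun x => f x - g x)%R by exact: measurable_funB.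
have -> : shift_diff f y = shift_diff (fun x => (f x - g x) + g x)%R y.
  by congr (shift_diff _ y); apply/funext => x; rewrite subrK.
apply: le_trans (shift_diffD y mfg mg) _.
apply: (@le_trans _ _ (K%:E * ((K * 2)%:E * t%:E + t%:E))).
  apply: lee_wpmul2l; first by rewrite lee_fin powR_ge0.
  apply: leeD; last exact: gd.
  apply: le_trans (shift_diff_le y mfg) _.
  by rewrite lee_wpmul2l// lee_fin mulr_ge0// powR_ge0.
rewrite -[X in K%:E * X]/((K * 2 * t + t)%R%:E) -EFinM lee_fin.
rewrite (_ : K * (K * 2 * t + t) = t * (K * (K * 2) + K))%R; last by ring.
by rewrite /t divfK// gt_eqF.
Qed.

Lemma pnorm_indic A : measurable A -> pnorm \1_A = L A.
Proof.
move=> mA; rewrite measure_integral_indic//; apply: eq_integral => x _.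
by rewrite indicE; case: (_ \in _); rewrite ?normr1 ?powR1// normr0 powR0// gt_eqF.
Qed.

(** The points of [inner U k] stay in [U] under translations of length less than
    [1/(k+1)], and the rest of [U] has small measure. *)
Lemma shift_continuous_eopen U r : eopen U -> U `<=` eball 0%R r ->
  shift_continuous \1_U.
Proof.
move=> oU Ur eta eta0.
have mU := eopen_measurable oU.
have Ufin : L U \is a fin_num.
  rewrite ge0_fin_numE// (le_lt_trans _ (@lebesgue_eball_lty R n 0%R r))//.
  by apply: le_measure; rewrite ?inE//; exact: measurable_eball.
have eta20 : (0 < eta / 2)%R by rewrite divr_gt0.
have mI k : measurable (inner U k) by exact: measurable_inner.
have le_U A : A `<=` U -> measurable A -> L A \is a fin_num.
  move=> AU mA; rewrite ge0_fin_numE// (@le_lt_trans _ _ (L U))//.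
    by apply: le_measure; rewrite ?inE.
  by rewrite -ge0_fin_numE.
have [k hk] : exists k, L U - L (inner U k) <= (eta / 2)%:E.
  have := cvg_measure_inner (m := L) oU.
  rewrite -[X in _ --> X](fineK Ufin) => /fine_cvgP[_ /cvgrPdist_lt /(_ _ eta20)].
  move=> [k _ /(_ k (leqnn k))/= h]; exists k.
  rewrite -(fineK Ufin) -(fineK (le_U _ (@inner_sub _ _ U k) (mI k))) -EFinB lee_fin.
  by rewrite ltW// (le_lt_trans (ler_norm _)).
exists k.+1%:R^-1%R; first by rewrite invr_gt0.
move=> y yk; pose V := (fun x => x + y)%R @^-1` U.
have mV : measurable V by apply: measurable_preimageT => //; exact: measurable_rowD.
have iUV : inner U k `<=` U `&` V.
  move=> x xi; split; first exact: inner_sub xi.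
  by apply: xi; rewrite /eball/= addrAC subrr add0r.
have iUVle : L (inner U k) <= L (U `&` V).
  by apply: le_measure; rewrite ?inE//; exact: measurableI.
have LV : L V = L U by exact: lebesgue_rV_translate.
have Vfin : L V \is a fin_num by rewrite LV.
have dU : L (U `\` V) <= (eta / 2)%:E.
  apply: le_trans hk; rewrite measureD//; last by rewrite -ge0_fin_numE.
  by rewrite leeD2l// leeN2.
have dV : L (V `\` U) <= (eta / 2)%:E.
  apply: le_trans hk; rewrite measureD//; last by rewrite -ge0_fin_numE.
  by rewrite [X in X - _]LV leeD2l// leeN2 setIC.
apply: (@le_trans _ _ (L (U `\` V) + L (V `\` U))); last first.
  by rewrite (le_trans (leeD dU dV))// -EFinD lee_fin -splitr.
have mUV := measurableD mU mV; have mVU := measurableD mV mU.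
rewrite !measure_integral_indic// -ge0_integralD//; last 2 first.
- by apply/measurable_EFinP.
- by apply/measurable_EFinP.
apply: ge0_le_integral => //.
- apply: (@measurable_pow (fun x => \1_U (x + y) - \1_U x)%R).
  apply: measurable_shift_sub; exact: measurable_indic.
- by apply: emeasurable_funD; apply/measurable_EFinP.
move=> x _; rewrite -EFinD lee_fin !indicE !in_setD.
have -> : (x \in V) = ((x + y)%R \in U) by apply/idP/idP; rewrite !inE.
by case: (_ \in U); case: (_ \in U); rewrite /= ?subrr ?subr0 ?sub0r ?normrN1 ?normr1 ?normr0
  ?powR1 ?(powR0 (lt0r_neq0 p_gt0)) ?addr0 ?add0r.
Qed.

(** The sets with this property form a lambda-system containing the open sets. *)
Lemma shift_continuous_indic A r : measurable A ->
  shift_continuous \1_(A `&` eball 0%R r).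
Proof.
have mB := @measurable_eball R n 0%R r; have oB := @eopen_eball R n 0%R r.
pose H := [set A | measurable A /\ shift_continuous \1_(A `&` eball 0%R r)].
suff : @measurable _ 'rV[R]_n `<=` H by move=> /(_ A) h mA; have [] := h mA.
rewrite measurable_eopenE; apply: lambda_system_subset => //.
- by move=> U V; exact: eopenI.
- split; first by move=> ? _.
  + by split; [exact: measurableT|rewrite setTI; apply: (@shift_continuous_eopen _ r)].
  + move=> B C CB [mB' sB] [mC sC]; split; first exact: measurableD.
    have mBr : measurable (B `&` eball 0%R r) by exact: measurableI.
    have mCr : measurable (C `&` eball 0%R r) by exact: measurableI.
    have -> : (\1_((B `\` C) `&` eball 0%R r) : 'rV[R]_n -> R) =
        (fun x => \1_(B `&` eball 0%R r) x + -1 * \1_(C `&` eball 0%R r) x)%R.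
      apply/funext => x; rewrite !indicE in_setI in_setD !in_setI.
      case: (boolP (x \in C)) => /= xC.
        have -> : x \in B by move: xC; rewrite !inE; exact: CB.
        by case: (_ \in _) => /=; ring.
      by case: (x \in B); case: (_ \in _) => /=; ring.
    apply: shift_continuousD; last 2 first.
    + exact: sB.
    + by apply: shift_continuousZ sC; exact: measurable_indic.
    + exact: measurable_indic.
    + by apply: measurable_funM; [exact: measurable_cst|exact: measurable_indic].
  + move=> F ndF HF.
    have mF i : measurable (F i) by have [] := HF i.
    have mUF : measurable (\bigcup_i F i) by exact: bigcupT_measurable.
    split => //; apply: shift_continuous_approx.
      by apply: measurable_indic; exact: measurableI.
    move=> eta eta0; pose G i := F i `&` eball 0%R r.
    have mG i : measurable (G i) by exact: measurableI.
    have UG : \bigcup_i F i `&` eball 0%R r = \bigcup_i G i by rewrite setI_bigcupl.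
    have mUG : measurable (\bigcup_i G i) by rewrite -UG; exact: measurableI.
    have fin B : B `<=` eball 0%R r -> measurable B -> L B \is a fin_num.
      move=> Br mB'; rewrite ge0_fin_numE// (le_lt_trans _ (@lebesgue_eball_lty R n 0%R r))//.
      by apply: le_measure; rewrite ?inE.
    have fUG : L (\bigcup_i G i) \is a fin_num.
      by apply: fin => //; rewrite -UG; exact: subIsetr.
    have ndG : nondecreasing_seq G.
      by move=> i j ij; apply/subsetPset; apply: setSI; exact/subsetPset/ndF.
    have := nondecreasing_cvg_mu (mu := L) mG mUG ndG.
    rewrite -[X in _ --> X](fineK fUG) => /fine_cvgP[_ /cvgrPdist_lt /(_ _ eta0)].
    move=> [k _ /(_ k (leqnn k))/= h]; exists \1_(G k); split.
    + exact: measurable_indic.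
    + by have [] := HF k.
    rewrite (_ : (fun x => _) = \1_(\bigcup_i G i `\` G k)); last first.
      apply/funext => x; rewrite UG !indicE in_setD.
      case: (boolP (x \in G k)) => /= xG.
        have -> : x \in \bigcup_i G i by rewrite inE; exists k => //; move: xG; rewrite inE.
        by rewrite subrr.
      by rewrite andbT subr0.
    rewrite pnorm_indic; last exact: measurableD.
    rewrite measureD//; last by rewrite -ge0_fin_numE.
    rewrite setIidr; last by move=> x Gx; exists k.
    rewrite -[X in X - _](fineK fUG) -[X in _ - X](fineK (fin _ (@subIsetr _ _ _) (mG k))) -EFinB lee_fin.
    by rewrite ltW// (le_lt_trans (ler_norm _)).
- move=> U oU; split; first exact: eopen_measurable.
  apply: (@shift_continuous_eopen _ r); first exact: eopenI.
  exact: subIsetr.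
Qed.

Lemma shift_continuous_sum (I : eqType) (s : seq I) (F : I -> 'rV[R]_n -> R) :
  (forall i, measurable_fun setT (F i)) -> (forall i, shift_continuous (F i)) ->
  shift_continuous (fun x => \sum_(i <- s) F i x)%R.
Proof.
move=> mF cF; elim: s => [|i s IH].
  move=> eta eta0; exists 1%R => // y _; rewrite shift_diffE /pnorm integral0_eq ?lee_fin ?ltW//.
  by move=> x _; rewrite !big_nil subrr normr0 powR0// gt_eqF.
rewrite (_ : (fun x => _) = fun x => (F i x + \sum_(i <- s) F i x)%R).
  by apply: shift_continuousD (mF i) _ (cF i) IH; exact: measurable_sum.
by apply/funext => x; rewrite big_cons.
Qed.

Import HBNNSimple.

(** Simple functions cut off to large balls approximate [f] in [L^p] by dominated
    convergence. *)
Lemma shift_continuous_ge0 f : measurable_fun setT f -> (forall x, 0 <= f x)%R ->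
  pnorm f < +oo -> shift_continuous f.
Proof.
move=> mf f0 foo.
have mfE : measurable_fun setT (EFin \o f) by exact/measurable_EFinP.
pose h := nnsfun_approx measurableT mfE.
have f0E x : setT x -> 0 <= (EFin \o f) x by rewrite lee_fin.
pose B k : set 'rV[R]_n := eball 0%R k%:R.
pose g k x := (h k x * \1_(B k) x)%R.
have mg k : measurable_fun setT (g k).
  apply: measurable_funM => //; apply: measurable_indic; exact: measurable_eball.
have gf k x : (0 <= g k x <= f x)%R.
  rewrite mulr_ge0//= (@le_trans _ _ (h k x))//.
    by rewrite ler_piMr// indicE; case: (_ \in _).
  by rewrite -lee_fin; rewrite /h nnsfun_approxE; exact: le_approx.
have cg k : shift_continuous (g k).
  rewrite (_ : g k = fun x => \sum_(r <- finmap.enum_fset (fset_set (range (h k))))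
      (r * \1_((h k @^-1` [set r]) `&` B k) x))%R.
    apply: shift_continuous_sum => r.
      apply: measurable_funM => //; apply: measurable_indic; apply: measurableI => //.
      exact: measurable_eball.
    apply: shift_continuousZ; last by apply: shift_continuous_indic.
    apply: measurable_indic; apply: measurableI => //; exact: measurable_eball.
  apply/funext => x; rewrite /g fimfunE fsbig_finite//= mulr_suml; apply: eq_bigr => r _.
  by rewrite -mulrA indicI.
apply: shift_continuous_approx => // eta eta0.
pose u k x : \bar R := (`|f x - g k x| `^ p)%:E.
have mu k : measurable_fun setT (u k).
  by apply: measurable_pow; exact: measurable_funB.
have [] := @dominated_convergence _ _ _ L setT measurableT u (cst 0)
  (fun x => (`|f x| `^ p)%:E) mu (measurable_cst _).
- apply: aeW => x _.
  have hx : (h k x : R) @[k --> \oo] --> f x.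
    have := @cvg_nnsfun_approx _ _ _ _ measurableT _ mfE f0E x I.
    by move=> /fine_cvgP[_].
  have gx : (f x - g k x)%R @[k --> \oo] --> (0%R : R).
    rewrite -(subrr (f x)); apply: cvgB; first exact: cvg_cst.
    apply: cvg_trans hx; apply: near_eq_cvg; near=> k.
    rewrite /g indicE mem_set ?mulr1// /B /eball/= subr0.
    near: k; exact: nbhs_infty_gtr.
  apply/fine_cvgP; split; first exact: nearW.
  apply: (@squeeze_cvgr _ _ _ _ (fun=> 0%R) (fun k => f x - g k x)%R) => //; last exact: cvg_cst.
  have /cvgr_lt /(_ _ ltr01) := gx.
  apply: filterS => k k1 /=; rewrite powR_ge0/=.
  have /andP[_ gk] := gf k x.
  by rewrite ger0_norm ?subr_ge0// powR_le_self// subr_ge0 gk ltW.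
- apply/integrableP; split; first exact: measurable_pow.
  under eq_integral do rewrite gee0_abs ?lee_fin ?powR_ge0//.
  exact: foo.
- apply: aeW => x k _; rewrite gee0_abs ?lee_fin ?powR_ge0//.
  have /andP[g0 gk] := gf k x.
  by apply: powR_homo => //; rewrite !ger0_norm ?subr_ge0// gerBl.
move=> _ _; rewrite integral0 => /fine_cvgP[[N1 _ h1] /cvgrPdist_lt /(_ _ eta0) [N2 _ h2]].
pose N := maxn N1 N2; exists (g N); split => //.
have := h1 N (leq_maxl _ _); have := h2 N (leq_maxr _ _); rewrite /= sub0r normrN => a b.
by rewrite -[X in X <= _](fineK b) lee_fin ltW// (le_lt_trans (ler_norm _)).
Unshelve. all: by end_near. Qed.

(** Positive and negative parts reduce to [shift_continuous_ge0]. *)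
Lemma translation_continuous f : measurable_fun setT f -> pnorm f < +oo ->
  shift_continuous f.
Proof.
move=> mf foo.
have part (g : 'rV[R]_n -> R) : measurable_fun setT g -> (forall x, 0 <= g x <= `|f x|)%R ->
    shift_continuous g.
  move=> mg gf; apply: (shift_continuous_ge0 mg); first by move=> x; have /andP[] := gf x.
  apply: le_lt_trans foo; apply: ge0_le_integral => //.
  - exact: measurable_pow.
  - exact: measurable_pow.
  - move=> x _; rewrite lee_fin; apply: powR_homo => //.
    by have /andP[g0 gl] := gf x; rewrite (ger0_norm g0).
rewrite (_ : f = fun x => f^\+ x + -1 * f^\- x)%R; last first.
  by apply/funext => x; rewrite mulN1r -[in LHS](funrposBneg f).
apply: shift_continuousD.
- exact: measurable_funrpos.
- by apply: measurable_funM => //; exact: measurable_funrneg.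
- apply: part; first exact: measurable_funrpos.
  by move=> x; rewrite /funrpos le_max lexx orbT/= ge_max normr_ge0 ler_norm.
- apply: shift_continuousZ; first exact: measurable_funrneg.
  apply: part; first exact: measurable_funrneg.
  by move=> x; rewrite /funrneg le_max lexx orbT/= ge_max normr_ge0 -normrN ler_norm.
Qed.

End translation_continuity.

(** * Integral inequalities *)

Section powR_split.
Variables (R : realType) (p : R).
Hypothesis p_ge1 : 1 <= p.

Let p_gt0 : 0 < p. Proof. exact: lt_le_trans p_ge1. Qed.

(** Either [b <= t a] or [a < b / t], where [(1 + t) ^ p = 1 + e]. *)
Lemma powRD_le_eps (e : R) : 0 < e -> exists2 C : R, 0 <= C &
  forall a b : R, 0 <= a -> 0 <= b -> (a + b) `^ p <= (1 + e) * a `^ p + C * b `^ p.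
Proof.
move=> e0; pose t : R := (1 + e) `^ p^-1 - 1.
have tp : (1 + t) `^ p = 1 + e.
  rewrite /t addrC subrK -powRrM mulVf ?gt_eqF// powRr1//.
  by rewrite addr_ge0// ltW.
have t0 : 0 < t.
  rewrite subr_gt0; have := @gt0_ltr_powR R p^-1 _ 1 (1 + e).
  by rewrite invr_gt0 !nnegrE ler01 powR1 ltrDl addr_ge0// ?(ltW e0)// => /(_ p_gt0 isT isT e0).
exists ((1 + t^-1) `^ p); first exact: powR_ge0.
move=> a b a0 b0; have [bt|bt] := leP b (t * a).
  apply: (@le_trans _ _ (((1 + t) * a) `^ p)).
    by apply: powR_homo => //; rewrite ?addr_ge0// mulrDl mul1r lerD2l.
  rewrite powRM// ?tp ?lerDl ?mulr_ge0 ?powR_ge0//.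
  by rewrite addr_ge0// ltW.
apply: (@le_trans _ _ (((1 + t^-1) * b) `^ p)).
  apply: powR_homo => //; rewrite ?addr_ge0// mulrDl mul1r addrC lerD2l.
  by rewrite mulrC ler_pdivlMr// mulrC ltW.
rewrite powRM// ?lerDr ?mulr_ge0 ?powR_ge0 ?addr_ge0 ?invr_ge0// ltW//.
Qed.

End powR_split.

Section integral_inequalities.
Local Open Scope ereal_scope.
Context d (T : measurableType d) (R : realType).
Variables (mu : {measure set T -> \bar R}) (D : set T) (v : R).
Hypotheses (mD : measurable D) (muD : mu D = v%:E).

Let v_ge0 : (0 <= v)%R. Proof. by rewrite -lee_fin -muD. Qed.

Lemma abs_Rintegral_le (f : T -> R) : measurable_fun D f ->
  (`|\int[mu]_(x in D) f x|%R)%:E <= \int[mu]_(x in D) `|f x|%:E.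
Proof.
move=> mf; have mfE : measurable_fun D (EFin \o f) by exact/measurable_EFinP.
have := le_abse_integral mu mD mfE.
rewrite /Rintegral; case: (\int[mu]_(x in D) (f x)%:E) => [r h|_|_] /=.
- exact: h.
- by rewrite normr0; exact: integral_ge0.
- by rewrite normr0; exact: integral_ge0.
Qed.

(** When [f] is not integrable the right-hand side is infinite. *)
Lemma abs_Rintegral_sub_le (f : T -> R) (c : R) : measurable_fun D f ->
  (`|\int[mu]_(x in D) f x - v * c|%R)%:E <= \int[mu]_(x in D) `|f x - c|%:E.
Proof.
move=> mf; have mfc : measurable_fun D (fun x => f x - c)%R by exact: measurable_funB.
have mE : measurable_fun D (fun x => (f x - c)%:E) by exact/measurable_EFinP.
have [foo|foo] := ltP (\int[mu]_(x in D) `|f x - c|%:E) +oo; last first.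
  by rewrite (le_trans _ foo)// leey.
have icst : mu.-integrable D (EFin \o cst c).
  apply/integrableP; split; first by apply/measurable_EFinP; exact: measurable_cst.
  have := integral_cst mu mD `|c|%:E; rewrite /cst /= => ->.
  by rewrite muD -EFinM ltry.
have ifc : mu.-integrable D (fun x => (f x - c)%:E) by apply/integrableP.
have if_ : mu.-integrable D (EFin \o f).
  have := integrableD mD ifc icst; apply: eq_integrable => // x _.
  by rewrite /= -EFinD subrK.
have E : (\int[mu]_(x in D) f x - v * c = \int[mu]_(x in D) (f x - c))%R.
  rewrite RintegralB//= Rintegral_cst//; congr (_ - _)%R.
  by rewrite muD/= mulrC.
by rewrite E; exact: abs_Rintegral_le.
Qed.

Variable p : R.
Hypothesis p_ge1 : (1 <= p)%R.

Let p_gt0 : (0 < p)%R. Proof. exact: lt_le_trans p_ge1. Qed.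

(** Jensen's inequality for a measure of total mass [v], as Hoelder's inequality
    against the indicator of [D]. *)
Lemma poweR_integral_le (g : T -> R) : measurable_fun setT g -> (forall x, 0 <= g x)%R ->
  (\int[mu]_(x in D) (g x)%:E) `^ p <= (v `^ (p - 1))%:E * \int[mu]_(x in D) (g x `^ p)%:E.
Proof.
move=> mg g0.
have [p1|p1] := eqVneq p 1%R.
  rewrite p1 subrr powRr0 mul1e poweRe1; last by apply: integral_ge0 => x _; rewrite lee_fin.
  rewrite le_eqVlt; apply/orP; left; apply/eqP; apply: eq_integral => x _.
  by rewrite powRr1.
have p1' : (1 < p)%R by rewrite lt_neqAle eq_sym p1.
pose q : R := (p / (p - 1))%R.
have q0 : (0 < q)%R by rewrite divr_gt0// subr_gt0.
have pq : (p^-1 + q^-1 = 1)%R.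
  by rewrite /q; field; rewrite subr_eq0 gt_eqF//= gt_eqF.
have m1 : measurable_fun setT (\1_D : T -> R) by exact: measurable_indic.
have mf : measurable_fun setT (fun x => g x * \1_D x)%R by exact: measurable_funM.
have := hoelder mu mf m1 p_gt0 q0 pq; rewrite Lnorm1.
have -> : \int[mu]_x `|(EFin \o ((fun x => g x * \1_D x) \* \1_D)%R) x| = \int[mu]_(x in D) (g x)%:E.
  rewrite [RHS]integral_mkcond; apply: eq_integral => x _; rewrite patchE /= indicE.
  by case: (_ \in _); rewrite ?mulr1 ?mulr0 ?normr0// ger0_norm.
move=> h.
have dom (y : \bar R) : 0 <= y -> y \in `[0, +oo] by move=> y0; rewrite in_itv/= y0 leey.
apply: (le_trans (gt0_ler_poweR (ltW p_gt0) _ _ h)).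
- by apply: dom; apply: integral_ge0 => x _; rewrite lee_fin.
- by apply: dom; rewrite mule_ge0// Lnorm_ge0.
rewrite poweRM ?Lnorm_ge0// (powR_Lnorm _ _ (lt0r_neq0 p_gt0)) muleC.
have -> : \int[mu]_x `|(EFin \o (fun x => g x * \1_D x)%R) x| `^ p = \int[mu]_(x in D) (g x `^ p)%:E.
  rewrite [RHS]integral_mkcond; apply: eq_integral => x _; rewrite patchE /= indicE ?poweR_EFin.
  case: (_ \in _); rewrite ?mulr1 ?mulr0 ?normr0 ?powR0 ?gt_eqF//.
  by rewrite ger0_norm.
have Nq : 'N[mu]_q%:E[EFin \o \1_D] `^ p = (v `^ (p - 1))%:E.
  have -> : p = (q * (p - 1))%R by rewrite /q divfK// subr_eq0.
  rewrite poweRrM (powR_Lnorm _ _ (lt0r_neq0 q0)).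
  have -> : \int[mu]_x `|(EFin \o \1_D) x| `^ q = v%:E.
    rewrite -muD -[X in _ = mu X](setIT D) -integral_indic//; apply: eq_integral => x _.
    by rewrite /= ?poweR_EFin indicE; case: (_ \in _); rewrite ?normr1 ?normr0 ?powR1 ?powR0 ?gt_eqF.
  rewrite poweR_EFin; congr (_ `^ _)%:E; rewrite /q divfK ?subr_eq0//.
by rewrite Nq.
Qed.

End integral_inequalities.

Section tonelli3.
Local Open Scope ereal_scope.
Context d1 d2 d3 (T1 : measurableType d1) (T2 : measurableType d2)
  (T3 : measurableType d3) (R : realType).
Variables (m1 : {sigma_finite_measure set T1 -> \bar R})
  (m2 : {sigma_finite_measure set T2 -> \bar R})
  (m3 : {sigma_finite_measure set T3 -> \bar R}).
Variable f : T1 * T2 * T3 -> \bar R.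
Hypotheses (mf : measurable_fun setT f) (f0 : forall z, 0 <= f z).

Lemma measurable_tonelli_inner :
  measurable_fun setT (fun z => \int[m3]_s f (z, s)).
Proof. exact: (@measurable_fun_fubini_tonelli_F _ _ _ _ _ m3 f mf f0). Qed.

Lemma tonelli3 : \int[m1]_x \int[m2]_h \int[m3]_s f (x, h, s) =
  \int[m2]_h \int[m3]_s \int[m1]_x f (x, h, s).
Proof.
rewrite (@fubini_tonelli _ _ _ _ _ m1 m2 (fun z => \int[m3]_s f (z, s)))//; last 2 first.
- exact: measurable_tonelli_inner.
- by move=> z; apply: integral_ge0.
apply: eq_integral => h _.
rewrite (@fubini_tonelli _ _ _ _ _ m1 m3 (fun z => f (z.1, h, z.2)))//.
apply: measurableT_comp mf _.
apply: measurable_fun_pair; last exact: measurable_snd.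
by apply: measurable_fun_pair; [exact: measurable_fst|exact: measurable_cst].
Qed.

End tonelli3.

(** * Covectors on frames *)

Section covector.
Variables (R : realType) (n k : nat).
Implicit Types (a b : covector R n k) (h u : k.-tuple 'rV[R]_n).

Definition edge_prod h : R := \prod_(i < k) enorm (tnth h i).

Definition udirs h : k.-tuple 'rV[R]_n := tuple_map (fun=> @udir R n) h.

Lemma edge_prod_ge0 h : 0 <= edge_prod h.
Proof. by apply: prodr_ge0 => i _; exact: enorm_ge0. Qed.

Lemma covector_evalB a b h :
  covector_eval a h - covector_eval b h = covector_eval [ffun I => a I - b I] h.
Proof.
by rewrite /covector_eval -sumrB; apply: eq_bigr => I _; rewrite ffunE mulrBl.
Qed.

(** Multilinearity: the matrix of coordinates has rows scaled by the lengths. *)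
Lemma covector_eval_udirs a h :
  covector_eval a h = edge_prod h * covector_eval a (udirs h).
Proof.
rewrite /covector_eval mulr_sumr; apply: eq_bigr => I _.
rewrite mulrCA; congr (_ * _).
set M := (X in _ = _ * \det X).
have -> : edge_prod h = \det (diag_mx (\row_i enorm (tnth h i))).
  by rewrite det_diag; apply: eq_bigr => i _; rewrite mxE.
rewrite -det_mulmx; congr (\det _); apply/matrixP => i j.
rewrite mul_diag_mx !mxE tnth_mktuple -[in LHS](udirK (tnth h i)) mxE//.
Qed.

Lemma norm_coord_le1 (v : 'rV[R]_n) i : enorm v <= 1 -> `|v ord0 i| <= 1.
Proof. by move=> v1; rewrite (le_trans (coord_le_enorm v i)). Qed.

Lemma covector_eval_le a u : (forall i, enorm (tnth u i) <= 1) ->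
  `|covector_eval a u| <= k`!%:R * \sum_I `|a I|.
Proof.
move=> u1; rewrite mulr_sumr (le_trans (ler_norm_sum _ _ _))//.
apply: ler_sum => I _; rewrite normrM mulrC ler_wpM2r//.
rewrite (le_trans (ler_norm_sum _ _ _))//.
have -> : k`!%:R = \sum_(s : {perm 'I_k}) (1 : R).
  by rewrite sumr_const -card_Sn.
apply: ler_sum => s _.
rewrite normrM normrX normrN1 expr1n mul1r normr_prod.
by apply: prodr_ile1 => i _; rewrite normr_ge0 mxE norm_coord_le1.
Qed.

Lemma enorm_udir_le1 (v : 'rV[R]_n) : enorm (udir v) <= 1.
Proof.
have [->|v0] := eqVneq v 0; first by rewrite /udir scaler0 enorm0.
by rewrite enorm_udir.
Qed.

(** By induction on [s] from the case of two terms, [powR_normD_le]. *)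
Lemma powR_sum_le (p : R) (T : Type) (s : seq T) : 1 <= p ->
  exists2 C : R, 0 <= C & forall f : T -> R, (forall i, 0 <= f i) ->
    (\sum_(i <- s) f i) `^ p <= C * \sum_(i <- s) f i `^ p.
Proof.
move=> p1; elim: s => [|x s [C C0 IH]].
  by exists 0 => // f _; rewrite !big_nil mulr0 powR0// gt_eqF// (lt_le_trans _ p1).
exists (2 `^ p * (1 + C)); first by rewrite mulr_ge0 ?powR_ge0// addr_ge0.
move=> f f0; rewrite !big_cons.
have := powR_normD_le p1 (f x) (\sum_(i <- s) f i).
have s0 : 0 <= \sum_(i <- s) f i by exact: sumr_ge0.
rewrite !ger0_norm ?addr_ge0// => /le_trans; apply.
rewrite -mulrA ler_pM2l ?powR_gt0//.
have t0 : 0 <= \sum_(i <- s) f i `^ p by apply: sumr_ge0 => i _; exact: powR_ge0.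
have := IH f f0; have := powR_ge0 (f x) p => ? ?.
by rewrite mulrDl mul1r mulrDr; nra.
Qed.

Lemma covector_eval_pow_le (p : R) : 1 <= p -> exists2 C : R, 0 <= C & forall a u,
  (forall i, enorm (tnth u i) <= 1) ->
  `|covector_eval a u| `^ p <= C * \sum_I `|a I| `^ p.
Proof.
move=> p1; have [C C0 H] := powR_sum_le (index_enum (multi_index n k)) p1.
exists (k`!%:R `^ p * C); first by rewrite mulr_ge0// powR_ge0.
move=> a u u1; apply: (le_trans (powR_homo p1 (normr_ge0 _) (covector_eval_le a u1))).
rewrite powRM ?sumr_ge0// -mulrA ler_wpM2l ?powR_ge0//.
exact: H.
Qed.

Lemma measurable_covector_eval d (T : measurableType d) (a : T -> covector R n k)
  (h : T -> k.-tuple 'rV[R]_n) :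
  (forall I, measurable_fun setT (fun t => a t I)) -> measurable_fun setT h ->
  measurable_fun setT (fun t => covector_eval (a t) (h t)).
Proof.
move=> ma mh; apply: measurable_sum => I; apply: measurable_funM => //.
rewrite /determinant; apply: measurable_sum => s.
apply: measurable_funM; first exact: measurable_cst.
apply: measurable_prod => i _; under eq_fun do rewrite mxE.
apply: measurable_coord_comp; exact: measurableT_comp (@measurable_tnth _ _ _ i) mh.
Qed.

Lemma measurable_udirs : measurable_fun setT udirs.
Proof. by apply: measurable_tuple_map => i; exact: measurable_udir. Qed.

Lemma measurable_edge_prod : measurable_fun setT edge_prod.
Proof. exact: measurable_prod_tnth (@measurable_enorm R n) k. Qed.

End covector.

(** * Simplices given by a base point and edges *)

(** Turns an integral over a set into one over the whole space, to which Fubini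
    applies. *)
Lemma integral_indicM d (T : measurableType d) (R : realType) (mu : {measure set T -> \bar R})
    (D : set T) (f : T -> R) :
  (\int[mu]_(x in D) (f x)%:E = \int[mu]_x (f x * \1_D x)%:E)%E.
Proof.
rewrite [LHS]integral_mkcond; apply: eq_integral => x _.
by rewrite patchE indicE; case: (_ \in _); rewrite ?mulr1 ?mulr0.
Qed.

(** The real valued integral is the difference of the integrals of the positive and
    negative parts, to which Tonelli applies, also where they are infinite. *)
Lemma measurable_fun_Rintegral d1 d2 (T1 : measurableType d1) (T2 : measurableType d2)
    (R : realType) (m : {sigma_finite_measure set T2 -> \bar R}) (D : set T2)
    (f : T1 * T2 -> R) : measurable D -> measurable_fun setT f ->
  measurable_fun setT (fun x => \int[m]_(y in D) f (x, y)).
Proof.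
move=> mD mf; pose g (z : T1 * T2) := (f z * \1_D z.2).
have mg : measurable_fun setT (fun z => (g z)%:E : \bar R).
  apply/measurable_EFinP; apply: measurable_funM => //.
  apply: (measurableT_comp (f := (\1_D : T2 -> R))); [exact: measurable_indic|exact: measurable_snd].
have -> : (fun x => \int[m]_(y in D) f (x, y)) =
    (fun x => fine (\int[m]_y (fun z => (g z)%:E)^\+ (x, y) - \int[m]_y (fun z => (g z)%:E)^\- (x, y))%E).
  apply/funext => x; rewrite /Rintegral integral_indicM integralE; congr fine.
  by congr (_ - _)%E; apply: eq_integral => y _; rewrite ?funepos.unlock ?funeneg.unlock.
apply: (measurableT_comp (@fine_measurable R setT measurableT)).
apply: emeasurable_funB; apply: (@measurable_fun_fubini_tonelli_F _ _ _ _ _ m) => //.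
- exact: measurable_funepos.
- exact: measurable_funeneg.
Qed.

Section simplices.
Variables (R : realType) (n k : nat).
Notation pt := 'rV[R]_n.
Implicit Types (x : pt) (h : k.-tuple pt) (s : 'rV[R]_k).

Definition combination h s : pt := \sum_(i < k) s ord0 i *: tnth h i.

Definition simplex_at x h : k.+1.-tuple pt := tcons (x, tuple_map (fun _ v => x + v) h).

Lemma base_point_simplex_at x h : base_point (simplex_at x h) = x.
Proof. exact: tnth_tcons0. Qed.

Lemma edges_simplex_at x h : edges (simplex_at x h) = h.
Proof.
apply: eq_from_tnth => i; rewrite tnth_mktuple base_point_simplex_at.
by rewrite tnth_tconsS tnth_mktuple addrC addKr.
Qed.

Lemma simplex_map_simplex_at x h s : simplex_map (simplex_at x h) s = x + combination h s.
Proof. by rewrite /simplex_map base_point_simplex_at edges_simplex_at. Qed.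

Lemma measurable_combination d (T : measurableType d) (h : T -> k.-tuple pt) (s : T -> 'rV[R]_k) :
  measurable_fun setT h -> measurable_fun setT s ->
  measurable_fun setT (fun t => combination (h t) (s t)).
Proof.
move=> mh ms; apply: measurable_rowP => j; under eq_fun do rewrite summxE.
apply: measurable_sum => i; under eq_fun do rewrite mxE.
apply: measurable_funM; first exact: measurable_coord_comp.
by apply: measurable_coord_comp; exact: measurableT_comp (@measurable_tnth _ _ _ i) mh.
Qed.

Lemma measurable_std_simplex : measurable (@std_simplex R k).
Proof.
have -> : @std_simplex R k = (\bigcap_(i in [set: 'I_k]) [set s : 'rV[R]_k | 0 <= s ord0 i])
    `&` [set s : 'rV[R]_k | \sum_i s ord0 i <= 1].
  apply/seteqP; split => s /= [h1 h2]; split => //; first by move=> i _; exact: h1.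
  by move=> i; exact: h1.
apply: measurableI.
  apply: fin_bigcap_measurable => // i _.
  by apply: measurable_ler_set => //; exact: measurable_coord.
apply: measurable_ler_set => //; apply: measurable_sum => i; exact: measurable_coord.
Qed.

Lemma coord_std_simplex s i : std_simplex s -> 0 <= s ord0 i <= 1.
Proof.
move=> [s0 s1]; rewrite s0/= (le_trans _ s1)// (bigD1 i)//= lerDl.
by apply: sumr_ge0.
Qed.

Lemma enorm_combination_le (delta : R) h s : std_simplex s -> 0 <= delta ->
  (forall i, enorm (tnth h i) <= delta) -> enorm (combination h s) <= delta.
Proof.
move=> [s0 s1] d0 hd; apply: (@le_trans _ _ (\sum_i s ord0 i * delta)).
  rewrite /combination; elim/big_ind2: _ => //; first by rewrite enorm0.
    by move=> a b c e ab ce; rewrite (le_trans (enormD _ _))// lerD.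
  by move=> i _; rewrite enormZ ger0_norm// ler_wpM2l.
by rewrite -mulr_suml ler_piMl.
Qed.

Definition simplex_volume : R := fine (lebesgue_rV k (@std_simplex R k)).

Lemma simplex_volumeE : lebesgue_rV k (@std_simplex R k) = simplex_volume%:E.
Proof.
rewrite /simplex_volume fineK// ge0_fin_numE//.
have := @lebesgue_rV_box R k (fun=> 1) (fun=> ler01) => H.
apply: (@le_lt_trans _ _ (lebesgue_rV k [set v : 'rV[R]_k | forall i, `|v ord0 i| <= 1])).
  apply: le_measure; rewrite ?inE; [exact: measurable_std_simplex|exact: measurable_box|].
  move=> s hs i; have /andP[a b] := coord_std_simplex i hs.
  by rewrite ger0_norm.
by rewrite H ltry.
Qed.

(** The simplex contains the ball of radius [1/(2(k+1))] about the point whose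
    coordinates are all [1/(2(k+1))]. *)
Lemma simplex_volume_gt0 : 0 < simplex_volume.
Proof.
rewrite -lte_fin -simplex_volumeE.
pose c : R := (2 * k.+1%:R)^-1.
have c0 : 0 < c by rewrite invr_gt0 mulr_gt0.
apply: (lt_le_trans (@lebesgue_eball_gt0 R k (const_mx c) c c0)).
apply: le_measure; rewrite ?inE; [exact: measurable_eball|exact: measurable_std_simplex|].
move=> s hs; have hi i : `|s ord0 i - c| <= c.
  have := coord_le_enorm (s - const_mx c) i; rewrite !mxE => /le_trans; apply.
  exact: ltW.
split=> [i|]; first by have := hi i; rewrite ler_norml => /andP[]; lra.
apply: (@le_trans _ _ (\sum_(i < k) (2 * c))).
  by apply: ler_sum => i _; have := hi i; rewrite ler_norml => /andP[]; lra.
rewrite sumr_const card_ord -[_ *+ _]mulr_natr /c invfM mulrA divff ?mul1r//.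
by rewrite mulrC ler_pdivrMr// mul1r ler_nat.
Qed.

Lemma measurable_simplex_at : measurable_fun setT (fun z => simplex_at z.1 z.2).
Proof.
apply/measurable_fun_tnthP => i; case: (unliftP ord0 i) => [j ->|->].
  rewrite (_ : _ \o _ = fun z => z.1 + tnth z.2 j); last first.
    by apply/funext => z; rewrite /= tnth_tconsS tnth_mktuple.
  apply: measurable_rowD; first exact: measurable_fst.
  exact: measurableT_comp (@measurable_tnth _ _ _ j) measurable_snd.
rewrite (_ : _ \o _ = fst); first exact: measurable_fst.
by apply/funext => z; rewrite /= tnth_tcons0.
Qed.

Local Open Scope ereal_scope.
Notation L := (@lebesgue_rV R n).
Notation Lk := (@tuple_product _ _ R (@lebesgue_rV R n) k).

(** Fubini and the translation invariance of the measure in each of the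
    vertices other than [x_0]. *)
Lemma integral_simplex (f : k.+1.-tuple pt -> \bar R) :
  measurable_fun setT f -> (forall t, 0 <= f t) ->
  \int[tuple_product L k.+1]_t f t = \int[L]_x \int[Lk]_h f (simplex_at x h).
Proof.
move=> mf f0; rewrite (tuple_product_integral L mf f0); apply: eq_integral => x _.
pose g t := f (tcons (x, t)).
have mg : measurable_fun setT g.
  by apply: (measurableT_comp mf); apply: measurableT_comp; [exact: measurable_tcons|exact: measurable_fun_pair].
have := @tuple_product_transfer _ _ _ _ R L L (fun=> 1%R) 1%R _ _ _ k (fun _ v => x + v)%R _ _ g mg.
rewrite expr1n mul1e => <- //.
- by apply: eq_integral => h _; rewrite big1// mul1e.
- by move=> i; exact: measurable_rowD.
- move=> i u mu u0; rewrite mul1e -(integral_translate x mu u0).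
  by apply: eq_integral => y _; rewrite mul1e addrC.
- by move=> t; exact: f0.
Qed.

End simplices.

(** * The seminorm over short simplices *)

Section rho_transfer.
Local Open Scope ereal_scope.
Variables (R : realType) (p : R).
Hypothesis p_ge1 : (1 <= p)%R.

Definition angular_factor n (theta delta : R) : R :=
  (mass n p theta delta / fine (sphere_measure n [set: 'rV[R]_n]))%R.

Lemma rho_transfer n (theta delta : R) (u : 'rV[R]_n -> \bar R) : (0 < n)%N ->
  (theta < 1)%R -> (0 < delta)%R -> measurable_fun setT u -> (forall y, 0 <= u y) ->
  \int[lebesgue_rV n]_x ((rho p theta delta x)%:E * u (udir x)) =
  (angular_factor n theta delta)%:E * \int[sphere_measure n]_y u y.
Proof.
case: n u => [u|m u _ t1 d0 mu u0]; first by [].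
apply: radial_transfer mu u0.
- exact: measurable_rho.
- by move=> x; apply: rho_ge0; exact: ltW.
- by move=> ? ?; exact: rho_refl.
- exact: rho0.
- exact: integral_rho_lty.
Qed.

Lemma integral_rho_mass n (theta delta : R) : (0 < n)%N ->
  (theta < 1)%R -> (0 < delta)%R ->
  \int[lebesgue_rV n]_x (rho p theta delta x)%:E = (mass n p theta delta)%:E.
Proof.
case: n => // m _ t1 d0; rewrite /mass fineK// ge0_fin_numE; first exact: integral_rho_lty.
by apply: integral_ge0 => x _; rewrite lee_fin rho_ge0// ltW.
Qed.

End rho_transfer.

Section estimates.
Local Open Scope ereal_scope.
Variables (R : realType) (n k : nat) (p : R).
Hypotheses (p_ge1 : (1 <= p)%R) (kn : (k <= n)%N).
Notation pt := 'rV[R]_n.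
Notation L := (@lebesgue_rV R n).
Notation Lk := (@tuple_product _ _ R (@lebesgue_rV R n) k).
Notation Delta := (@std_simplex R k).
Notation v := (simplex_volume R k).
Implicit Types (x : pt) (h : k.-tuple pt) (s : 'rV[R]_k) (theta delta : R) (G : set pt).

Let p_gt0 : (0 < p)%R. Proof. exact: lt_le_trans p_ge1. Qed.
Let v_gt0 : (0 < v)%R := simplex_volume_gt0 R k.
Let mDelta : measurable Delta := @measurable_std_simplex R k.

Definition weight theta delta h : R := (\prod_(i < k) rho p theta delta (tnth h i))%R.

Lemma weight_ge0 theta delta h : (theta <= 1)%R -> (0 <= weight theta delta h)%R.
Proof. by move=> t1; apply: prodr_ge0 => i _; exact: rho_ge0. Qed.

Lemma measurable_weight theta delta : measurable_fun setT (weight theta delta).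
Proof. exact: measurable_prod_tnth (measurable_rho _ _ _) k. Qed.

Lemma weight_neq0 theta delta h : weight theta delta h != 0%R ->
  forall i, (tnth h i != 0)%R /\ (enorm (tnth h i) < delta)%R.
Proof.
move=> /prodf_neq0 H i; have := H i isT; rewrite /rho => H1; split.
  apply: contra_neq H1 => ->; case: ifP => // _.
  by rewrite rquot0 ?mulr0// gt_eqF.
by move: H1; case: ifP => //; rewrite eqxx.
Qed.

Definition frames : set (k.-tuple pt) := [set u | forall i, unit_sphere n (tnth u i)].

Lemma measurable_frames : measurable frames.
Proof.
have -> : frames = \bigcap_(i in [set: 'I_k]) ((fun u => tnth u i) @^-1` unit_sphere n).
  by apply/seteqP; split => t /= h i; [move=> _|]; exact: h.
apply: fin_bigcap_measurable => // i _.
apply: measurable_preimageT; [exact: measurable_tnth|exact: measurable_unit_sphere].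
Qed.

(** The weights vanish when an edge does, so that only frames of unit vectors
    contribute; each of the factors is then handled by [radial_transfer]. *)
Lemma weight_udirs_integral theta delta (g : k.-tuple pt -> \bar R) :
  (theta < 1)%R -> (0 < delta)%R -> measurable_fun setT g -> (forall u, 0 <= g u) ->
  \int[Lk]_h ((weight theta delta h)%:E * g (udirs h)) =
  (angular_factor p n theta delta ^+ k)%:E *
    \int[tuple_product (sphere_measure n) k]_(u in frames) g u.
Proof.
move=> t1 d0 mg g0; have t1' := ltW t1.
pose g' := g \_ frames.
have mg' : measurable_fun setT g'.
  apply/(measurable_restrictT _ _).1; first exact: measurable_frames.
  exact: measurable_funTS.
have g'0 u : 0 <= g' u by rewrite /g' patchE; case: ifP.
have [M ME] := sphere_measure_ex R n; rewrite ME (integral_mkcond frames) -/g'.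
have am0 : (0 <= angular_factor p n theta delta)%R.
  by rewrite divr_ge0// fine_ge0// ?ME//; apply: integral_ge0 => x _; rewrite lee_fin rho_ge0.
have H (i : 'I_k) (u : pt -> \bar R) : measurable_fun setT u -> (forall y, 0 <= u y) ->
    \int[L]_x ((rho p theta delta x)%:E * u (udir x)) =
    (angular_factor p n theta delta)%:E * \int[M]_y u y.
  by rewrite -ME; apply: rho_transfer => //; exact: leq_ltn_trans (leq_trans (ltn_ord i) kn).
have := tuple_product_transfer (@measurable_rho R n p theta delta) (fun x => @rho_ge0 R n p theta delta x t1') am0
   (fun=> @measurable_udir R n) H mg' g'0.
move=> <-; apply: eq_integral => h _; rewrite -/(weight theta delta h).
have [->|w0] := eqVneq (weight theta delta h) 0%R; first by rewrite !mul0e.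
congr (_ * _); rewrite /g' patchE ifT// inE => i.
by rewrite tnth_mktuple; apply: enorm_udir; have [] := weight_neq0 w0 i.
Qed.

(** [tuple_product_transfer] for the map to a point. *)
Lemma integral_weight theta delta : (theta < 1)%R -> (0 < delta)%R ->
  \int[Lk]_h (weight theta delta h)%:E = (mass n p theta delta ^+ k)%:E.
Proof.
move=> t1 d0; have t1' := ltW t1.
have m0 : (0 <= mass n p theta delta)%R.
  by rewrite fine_ge0//; apply: integral_ge0 => x _; rewrite lee_fin rho_ge0.
have H (i : 'I_k) (u : pt -> \bar R) : measurable_fun setT u -> (forall y, 0 <= u y) ->
    \int[L]_x ((rho p theta delta x)%:E * u 0%R) =
    (mass n p theta delta)%:E * \int[\d_(0%R : pt)]_y u y.
  move=> mu u0; rewrite integral_dirac// diracT mul1e ge0_integralZr//; last 2 first.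
  - by apply/measurable_EFinP; exact: measurable_rho.
  - by move=> x _; rewrite lee_fin rho_ge0.
  by rewrite integral_rho_mass//; exact: leq_ltn_trans (leq_trans (ltn_ord i) kn).
have := tuple_product_transfer (@measurable_rho R n p theta delta) (fun x => @rho_ge0 R n p theta delta x t1') m0
   (fun=> @measurable_cst _ _ _ _ setT (0%R : pt)) H (measurable_cst (1 : \bar R)) (fun=> lee01).
have -> : \int[tuple_product \d_(0%R : pt) k]_u (cst 1 u : \bar R) = 1.
  rewrite integral_cst// mul1e.
  have := @tuple_product_box R _ _ \d_(0%R : pt) k (fun=> setT) (fun=> measurableT).
  rewrite big1 => [<-|i _]; last exact: diracT.
  by congr (tuple_product _ _ _); apply/seteqP; split.
by rewrite mule1 => <-; apply: eq_integral => h _; rewrite mule1.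
Qed.

Variable w : dform R n k.
Hypothesis mw : measurable_form setT w.

Let measurable_comp_form d (T : measurableType d) (f : T -> pt) : measurable_fun setT f ->
  forall I, measurable_fun setT (fun t => w (f t) I).
Proof. by move=> mf I; exact: measurableT_comp (mw I) mf. Qed.

(** Jensen's inequality for the mean over the simplex: here [a] is the form along
    the simplex and [b] a constant form to compare it with. *)
Lemma simplex_mean_le (a : 'rV[R]_k -> covector R n k) (b : covector R n k) h :
  (forall I, measurable_fun setT (fun s => a s I)) ->
  (`|\int[lebesgue_rV k]_(s in Delta) covector_eval (a s) h - v * covector_eval b h| `^ p)%:E
  <= (edge_prod h `^ p * v `^ (p - 1))%:E *
     \int[lebesgue_rV k]_(s in Delta)
       (`|covector_eval (a s) (udirs h) - covector_eval b (udirs h)| `^ p)%:E.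
Proof.
move=> ma.
have meval u : measurable_fun setT (fun s => covector_eval (a s) u).
  by apply: measurable_covector_eval => //; exact: measurable_cst.
have mf : measurable_fun setT
    (fun s => `|covector_eval (a s) (udirs h) - covector_eval b (udirs h)|%R).
  by apply: measurableT_comp => //; apply: measurable_funB => //; exact: measurable_cst.
have f0 : 0 <= \int[lebesgue_rV k]_(s in Delta)
    `|covector_eval (a s) (udirs h) - covector_eval b (udirs h)|%:E.
  by apply: integral_ge0 => s _; rewrite lee_fin.
have := abs_Rintegral_sub_le mDelta (simplex_volumeE R k) (covector_eval b h)
  (measurable_funTS (meval h)).
have -> : \int[lebesgue_rV k]_(s in Delta) `|covector_eval (a s) h - covector_eval b h|%:E =
    (edge_prod h)%:E * \int[lebesgue_rV k]_(s in Delta)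
    `|covector_eval (a s) (udirs h) - covector_eval b (udirs h)|%:E.
  rewrite -ge0_integralZl_EFin//; last 2 first.
  - by apply/measurable_EFinP; exact: measurable_funTS.
  - exact: edge_prod_ge0.
  apply: eq_integral => s _; rewrite (covector_eval_udirs (a s)) (covector_eval_udirs b).
  by rewrite -mulrBr normrM ger0_norm// edge_prod_ge0.
move=> H; rewrite -poweR_EFin.
have dom (y : \bar R) : 0 <= y -> y \in `[0, +oo] by move=> y0; rewrite in_itv/= y0 leey.
apply: (le_trans (gt0_ler_poweR (ltW p_gt0) _ _ H)).
- by apply: dom; rewrite lee_fin.
- by apply: dom; rewrite mule_ge0// lee_fin edge_prod_ge0.
rewrite poweRM//; last by rewrite lee_fin edge_prod_ge0.
rewrite poweR_EFin EFinM -muleA lee_wpmul2l ?lee_fin ?powR_ge0//.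
exact: (poweR_integral_le mDelta (simplex_volumeE R k) p_ge1 mf).
Qed.

Definition short_edges delta h : bool := [forall i, (enorm (tnth h i) < delta)%R].

(** The factor of [|F|^p] in the truncated seminorm; the [p]-th power of the product of
    the edge lengths turns it into the product of the kernels, see [edge_coefM]. *)
Definition edge_coef theta delta h : R :=
  (if short_edges delta h then (1 - theta) ^+ k / edge_prod h `^ (n%:R + theta * p) else 0)%R.

Lemma edge_coef_ge0 theta delta h : (theta <= 1)%R -> (0 <= edge_coef theta delta h)%R.
Proof.
move=> t1; rewrite /edge_coef; case: ifP => // _.
by rewrite divr_ge0 ?powR_ge0// exprn_ge0// subr_ge0.
Qed.

Lemma powR_edge_prod h (r : R) : (edge_prod h `^ r = \prod_(i < k) enorm (tnth h i) `^ r)%R.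
Proof.
rewrite /edge_prod.
have [_ ->] : (0 <= \prod_(i < k) enorm (tnth h i))%R /\
   ((\prod_(i < k) enorm (tnth h i)) `^ r = \prod_(i < k) enorm (tnth h i) `^ r)%R; last by [].
elim/big_rec2: _ => [|i a b _ [b0 <-]]; first by rewrite powR1.
by rewrite mulr_ge0 ?enorm_ge0// powRM// enorm_ge0.
Qed.

Lemma edge_coefM theta delta h :
  (edge_coef theta delta h * edge_prod h `^ p = weight theta delta h)%R.
Proof.
rewrite /edge_coef /weight; case: ifPn => [/forallP sh|].
  rewrite mulrAC -mulrA !powR_edge_prod -prodfV -big_split/=.
  rewrite -[X in (_ ^+ X)%R]card_ord -prodr_const -big_split/=.
  by apply: eq_bigr => i _; rewrite /rho sh /rquot.
rewrite negb_forall => /existsP[i hi]; rewrite mul0r (bigD1 i)//=.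
by rewrite /rho (negbTE hi) mul0r.
Qed.

Lemma measurable_short_edges delta : measurable [set h | short_edges delta h].
Proof.
have -> : [set h | short_edges delta h] =
    \bigcap_(i in [set: 'I_k]) [set h : k.-tuple pt | (enorm (tnth h i) < delta)%R].
  by apply/seteqP; split => t /= h; [move=> i _; exact/(forallP h)|apply/forallP => i; exact: h].
apply: fin_bigcap_measurable => // i _; apply: measurable_ltr_set => //.
by apply: measurable_enorm_comp; exact: measurable_tnth.
Qed.

Definition near_simplices G delta : set (k.+1.-tuple pt) :=
  [set t | G (base_point t) /\ short_edges delta (edges t)].

Lemma measurable_base_point : measurable_fun setT (@base_point R n k).
Proof. exact: measurable_tnth. Qed.

Lemma measurable_edges : measurable_fun setT (@edges R n k).
Proof.
apply/measurable_fun_tnthP => i.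
rewrite (_ : _ \o _ = fun t : k.+1.-tuple pt => tnth t (lift ord0 i) - base_point t)%R; last first.
  by apply/funext => t; rewrite /= tnth_mktuple.
by apply: measurable_rowB; exact: measurable_tnth.
Qed.

Lemma measurable_near_simplices G delta : measurable G -> measurable (near_simplices G delta).
Proof.
move=> mG; apply: (measurableI (@base_point R n k @^-1` G) (@edges R n k @^-1` [set h | short_edges delta h])).
  exact: measurable_preimageT measurable_base_point mG.
exact: measurable_preimageT measurable_edges (measurable_short_edges delta).
Qed.

Lemma measurable_integration : measurable_fun setT (integration w).
Proof.
rewrite /integration.
apply: (@measurable_fun_Rintegral _ _ _ _ _ _ _
  (fun z => covector_eval (w (simplex_map z.1 z.2)) (edges z.1)) mDelta).
have me : measurable_fun setT (fun z : k.+1.-tuple pt * 'rV[R]_k => edges z.1).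
  exact: measurableT_comp measurable_edges measurable_fst.
apply: measurable_covector_eval => //; apply: measurable_comp_form.
apply: measurable_rowD.
  exact: measurableT_comp measurable_base_point measurable_fst.
by apply: (measurable_combination me); exact: measurable_snd.
Qed.

Lemma integration_simplex_at x h : integration w (simplex_at x h) =
  (\int[lebesgue_rV k]_(s in Delta) covector_eval (w (x + combination h s)) h)%R.
Proof.
rewrite /integration; apply: eq_Rintegral => s _.
by rewrite simplex_map_simplex_at edges_simplex_at.
Qed.

Lemma Ntheta_near_simplices theta delta G : (theta <= 1)%R -> measurable G ->
  Ntheta p theta (integration w) (near_simplices G delta) =
  \int[L]_x \int[Lk]_h
    (\1_G x * (edge_coef theta delta h * `|integration w (simplex_at x h)| `^ p))%:E.
Proof.
move=> t1 mG; rewrite /Ntheta integral_indicM integral_simplex.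
- apply: eq_integral => x _; apply: eq_integral => h _; congr EFin.
  rewrite edges_simplex_at -/(edge_prod h) /edge_coef !indicE.
  have -> : (simplex_at x h \in near_simplices G delta) = (x \in G) && short_edges delta h.
    apply/idP/idP.
      by rewrite inE /near_simplices/= base_point_simplex_at edges_simplex_at => -[/mem_set -> ->].
    by case/andP => /set_mem xG sh; rewrite inE /near_simplices/= base_point_simplex_at edges_simplex_at.
  case: (x \in G) => /=; last by rewrite mulr0 mul0r.
  by case: ifP => _; rewrite ?mulr1 ?mulr0 ?mul1r ?mul0r// mulrAC.
- apply/measurable_EFinP; apply: measurable_funM.
    apply: measurable_funM.
      apply: measurable_funM; first exact: measurable_cst.
      apply: (measurableT_comp (measurable_powR p)).
      by apply: measurableT_comp => //; exact: measurable_integration.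
    have mq := measurableT_comp (@measurable_edge_prod R n k) measurable_edges.
    have := measurableT_comp (measurable_powR (- (n%:R + theta * p)%R)) mq.
    by apply: eq_measurable_fun => x _ /=; rewrite powRN.
  by apply: measurable_indic; exact: measurable_near_simplices.
- move=> x; rewrite lee_fin mulr_ge0 ?divr_ge0 ?powR_ge0// mulr_ge0 ?powR_ge0//.
  by rewrite exprn_ge0// subr_ge0.
Qed.

End estimates.

(** * Deviation of the form along a simplex from its value at the base point *)

(** The integral of a nonnegative function is a supremum over the simple functions
    below it, a family that grows with the function and with the domain. *)
Lemma nonneg_integral_le d (T : measurableType d) (R : realType) (mu : {measure set T -> \bar R})
    (D E : set T) (f g : T -> \bar R) :
  (forall x, 0 <= f x)%E -> (forall x, f x <= g x)%E -> D `<=` E ->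
  (\int[mu]_(x in D) f x <= \int[mu]_(x in E) g x)%E.
Proof.
move=> f0 fg DE; have g0 x : (0 <= g x)%E by exact: le_trans (fg x).
rewrite !ge0_integralE//; apply: ge_ereal_sup => _ [h /= hf <-].
apply: ereal_sup_ubound; exists h => //= x; apply: (le_trans (hf x)); rewrite !patchE.
case: (boolP (x \in D)) => [/set_mem /DE /mem_set ->|_]; first exact: fg.
by case: ifP.
Qed.

Section bounds.
Local Open Scope ereal_scope.
Variables (R : realType) (n k : nat) (p : R).
Hypotheses (p_ge1 : (1 <= p)%R) (kn : (k <= n)%N).
Notation pt := 'rV[R]_n.
Notation L := (@lebesgue_rV R n).
Notation Lk := (@tuple_product _ _ R (@lebesgue_rV R n) k).
Notation Delta := (@std_simplex R k).
Notation v := (simplex_volume R k).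
Implicit Types (x : pt) (h : k.-tuple pt) (s : 'rV[R]_k) (theta delta : R) (G : set pt).

Let p_gt0 : (0 < p)%R. Proof. exact: lt_le_trans p_ge1. Qed.
Let v_gt0 : (0 < v)%R := simplex_volume_gt0 R k.
Let mDelta : measurable Delta := @measurable_std_simplex R k.

Variable w : dform R n k.
Hypothesis mw : measurable_form setT w.

Notation F x h := (integration w (simplex_at x h)).

Let measurable_comp_form d (T : measurableType d) (b : dform R n k) (f : T -> pt) :
  measurable_form setT b -> measurable_fun setT f ->
  forall I, measurable_fun setT (fun t => b (f t) I).
Proof. by move=> mb mf I; exact: measurableT_comp (mb I) mf. Qed.

Section mean_error.
Variables (theta delta : R) (b : dform R n k) (Q : k.-tuple pt -> \bar R).
Hypotheses (t1 : (theta <= 1)%R) (mb : measurable_form setT b).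
Hypotheses (mQ : measurable_fun setT Q) (Q0 : forall h, 0 <= Q h).

Let dev (z : pt * k.-tuple pt * 'rV[R]_k) : R :=
  (`|covector_eval (w (z.1.1 + combination z.1.2 z.2)) (udirs z.1.2)
     - covector_eval (b z.1.1) (udirs z.1.2)| `^ p)%R.

Let mdev : measurable_fun setT dev.
Proof.
have m11 : measurable_fun setT (fun z : pt * k.-tuple pt * 'rV[R]_k => z.1.1).
  exact: measurableT_comp measurable_fst measurable_fst.
have m12 : measurable_fun setT (fun z : pt * k.-tuple pt * 'rV[R]_k => z.1.2).
  exact: measurableT_comp measurable_snd measurable_fst.
have mu : measurable_fun setT (fun z : pt * k.-tuple pt * 'rV[R]_k => udirs z.1.2).
  exact: measurableT_comp (@measurable_udirs R n k) m12.
apply: (measurableT_comp (measurable_powR p)); apply: measurableT_comp => //.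
apply: measurable_funB; apply: measurable_covector_eval => //; apply: measurable_comp_form => //.
by apply: measurable_rowD => //; apply: measurable_combination => //; exact: measurable_snd.
Qed.

Hypothesis HQ : forall h s, weight p theta delta h != 0%R -> Delta s ->
  \int[L]_x (dev (x, h, s))%:E <= Q h.

(** Jensen, then Tonelli, so that the integral over the base point comes
    first. *)
Lemma mean_error_le :
  \int[L]_x \int[Lk]_h
    (edge_coef p theta delta h * `|F x h - v * covector_eval (b x) h| `^ p)%:E
  <= (v `^ p)%:E * \int[Lk]_h ((weight p theta delta h)%:E * Q h).
Proof.
pose f z := (weight p theta delta z.1.2 * (dev z * \1_Delta z.2))%:E : \bar R.
have mweight := @measurable_weight R n k p theta delta.
have w0 h : (0 <= weight p theta delta h)%R by exact: weight_ge0.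
have dev0 z : (0 <= dev z * \1_Delta z.2)%R by rewrite mulr_ge0// powR_ge0.
have f0 z : 0 <= f z by rewrite lee_fin mulr_ge0.
have mf : measurable_fun setT f.
  apply/measurable_EFinP; apply: measurable_funM.
    apply: (measurableT_comp mweight).
    exact: measurableT_comp measurable_snd measurable_fst.
  apply: measurable_funM => //.
  by apply: (measurableT_comp (f := (\1_Delta : _ -> R))); [exact: measurable_indic|exact: measurable_snd].
have mfs z : measurable_fun setT (fun s => f (z, s)).
  by apply: (measurableT_comp mf); exact: measurable_fun_pair.
have vp : (v `^ p = v `^ (p - 1) * v)%R.
  by rewrite -[X in (_ * X)%R]powRr1 ?(ltW v_gt0)// -powRD ?subrK// gt_eqF// implybT.
apply: (@le_trans _ _ (\int[L]_x \int[Lk]_h ((v `^ (p - 1))%:E * \int[lebesgue_rV k]_s f (x, h, s)))).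
  apply: nonneg_integral_le => // x.
    by apply: integral_ge0 => h _; rewrite lee_fin mulr_ge0 ?powR_ge0 ?edge_coef_ge0.
  apply: nonneg_integral_le => // h.
    by rewrite lee_fin mulr_ge0 ?powR_ge0 ?edge_coef_ge0.
  have ma : forall I, measurable_fun setT (fun s => w (x + combination h s)%R I).
    apply: measurable_comp_form => //; apply: measurable_rowD => //.
    by apply: measurable_combination => //; exact: measurable_id.
  rewrite integration_simplex_at EFinM.
  apply: (le_trans (lee_wpmul2l _ (simplex_mean_le p_ge1 (b x) h ma))).
    by rewrite lee_fin edge_coef_ge0.
  rewrite muleA -EFinM mulrA edge_coefM integral_indicM.
  rewrite [in leLHS]mulrC [in leLHS]EFinM -muleA lee_wpmul2l ?lee_fin ?powR_ge0//.
  rewrite -ge0_integralZl_EFin//.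
  apply/measurable_EFinP; apply: measurable_funM; last exact: measurable_indic.
  exact: measurableT_comp mdev (pair1_measurable (x, h)).
have minner := measurable_tonelli_inner (lebesgue_rV k) mf f0.
have inner0 z : 0 <= \int[lebesgue_rV k]_s f (z, s) by exact: integral_ge0.
under eq_integral => x _.
  rewrite ge0_integralZl_EFin//; last first.
  - exact: powR_ge0.
  - by apply: (measurableT_comp minner); exact: measurable_fun_pair.
  over.
rewrite ge0_integralZl_EFin//; last 3 first.
- by move=> x _; exact: integral_ge0.
- exact: (@measurable_fun_fubini_tonelli_F _ _ _ _ _ Lk _ minner).
- exact: powR_ge0.
rewrite tonelli3// vp EFinM -muleA lee_wpmul2l ?lee_fin ?powR_ge0//.
rewrite -ge0_integralZl_EFin//; last 3 first.
- by move=> h _; rewrite mule_ge0// lee_fin.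
- by apply: emeasurable_funM => //; exact/measurable_EFinP.
- exact: ltW.
apply: nonneg_integral_le => // h.
  by apply: integral_ge0 => s _; exact: integral_ge0.
have -> : v%:E * ((weight p theta delta h)%:E * Q h) =
    \int[lebesgue_rV k]_s ((\1_Delta s)%:E * ((weight p theta delta h)%:E * Q h)).
  rewrite ge0_integralZr//; last 2 first.
  - by apply/measurable_EFinP; exact: measurable_indic.
  - by rewrite mule_ge0// lee_fin.
  congr (_ * _); rewrite integral_indic// setIT; exact: esym (simplex_volumeE R k).
apply: nonneg_integral_le => // s; first exact: integral_ge0.
have [sD|sD] := boolP (s \in Delta); last first.
  rewrite indicE (negbTE sD) mul0e integral0_eq// => x _.
  by rewrite /f/= indicE (negbTE sD) !mulr0.
rewrite indicE sD mul1e.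
have [h0|h0] := eqVneq (weight p theta delta h) 0%R.
  by rewrite h0 mul0e integral0_eq// => x _; rewrite /f/= h0 mul0r.
rewrite /f/=; under eq_integral do rewrite indicE sD mulr1 EFinM.
rewrite ge0_integralZl_EFin//; last 2 first.
- by move=> x _; rewrite lee_fin powR_ge0.
- by apply/measurable_EFinP; apply: (measurableT_comp mdev); apply: measurable_fun_pair.
by rewrite lee_wpmul2l ?lee_fin//; apply: HQ => //; exact/set_mem.
Qed.

End mean_error.
End bounds.

(** * Bounds for fixed [theta] *)

Section two_bounds.
Local Open Scope ereal_scope.
Variables (R : realType) (n k : nat) (p : R).
Hypotheses (p_ge1 : (1 <= p)%R) (kn : (k <= n)%N).
Notation pt := 'rV[R]_n.
Notation L := (@lebesgue_rV R n).
Notation Lk := (@tuple_product _ _ R (@lebesgue_rV R n) k).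
Notation Delta := (@std_simplex R k).
Notation v := (simplex_volume R k).
Implicit Types (x : pt) (h : k.-tuple pt) (s : 'rV[R]_k) (theta delta : R) (G : set pt).

Let p_gt0 : (0 < p)%R. Proof. exact: lt_le_trans p_ge1. Qed.
Let v_gt0 : (0 < v)%R := simplex_volume_gt0 R k.

Variable w : dform R n k.
Hypothesis mw : measurable_form setT w.

Notation F x h := (integration w (simplex_at x h)).

(** The [p]-th power of the spherical norm of the form at [x]. *)
Definition snorm_pow (w' : dform R n k) x : \bar R :=
  \int[tuple_product (sphere_measure n) k]_(u in @frames R n k)
    (`|covector_eval (w' x) u| `^ p)%:E.

Let Phi := snorm_pow w.

Lemma measurable_eval_pow d (T : measurableType d) (f : T -> pt) (u : T -> k.-tuple pt) :
  measurable_fun setT f -> measurable_fun setT u ->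
  measurable_fun setT (fun t => (`|covector_eval (w (f t)) (u t)| `^ p)%R).
Proof.
move=> mf mu; apply: (measurableT_comp (measurable_powR p)); apply: measurableT_comp => //.
by apply: measurable_covector_eval => // I; exact: measurableT_comp (mw I) mf.
Qed.

Lemma snorm_pow_ge0 x : 0 <= Phi x.
Proof.
have [M ME] := sphere_measure_ex R n; rewrite /Phi /snorm_pow ME.
by apply: integral_ge0 => u _; rewrite lee_fin powR_ge0.
Qed.

Lemma measurable_snorm_pow : measurable_fun setT Phi.
Proof.
have [M ME] := sphere_measure_ex R n.
pose f (z : pt * k.-tuple pt) := (`|covector_eval (w z.1) z.2| `^ p * \1_(@frames R n k) z.2)%:E.
have -> : Phi = fun x => \int[tuple_product M k]_u f (x, u).
  by apply/funext => x; rewrite /Phi /snorm_pow ME integral_indicM.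
apply: (@measurable_fun_fubini_tonelli_F _ _ _ _ _ (tuple_product M k) f).
  apply/measurable_EFinP; apply: measurable_funM.
    by apply: measurable_eval_pow; [exact: measurable_fst|exact: measurable_snd].
  apply: (measurableT_comp (f := (\1_(@frames R n k) : _ -> R))); last exact: measurable_snd.
  by apply: measurable_indic; exact: measurable_frames.
by move=> z; rewrite lee_fin mulr_ge0// powR_ge0.
Qed.

(** The constant of the theorem before the limit: [v^p] from the mean over the simplex,
    and the mass of the kernel per unit of area of the sphere for each edge. *)
Definition const_factor theta delta : R := (v `^ p * angular_factor p n theta delta ^+ k)%R.

Lemma angular_factor_ge0 theta delta : (theta <= 1)%R -> (0 <= angular_factor p n theta delta)%R.
Proof.
move=> t1; have [M ME] := sphere_measure_ex R n.
by rewrite divr_ge0// fine_ge0// ?ME//; apply: integral_ge0 => x _; rewrite lee_fin rho_ge0.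
Qed.

Lemma const_factor_ge0 theta delta : (theta <= 1)%R -> (0 <= const_factor theta delta)%R.
Proof. by move=> t1; rewrite mulr_ge0 ?powR_ge0// exprn_ge0// angular_factor_ge0. Qed.

Lemma weight_snorm_pow theta delta x : (theta < 1)%R -> (0 < delta)%R ->
  \int[Lk]_h (weight p theta delta h * `|covector_eval (w x) (udirs h)| `^ p)%:E =
  (angular_factor p n theta delta ^+ k)%:E * Phi x.
Proof.
move=> t1 d0.
rewrite -(weight_udirs_integral p_ge1 kn t1 d0 (g := fun u => (`|covector_eval (w x) u| `^ p)%:E))//.
by apply/measurable_EFinP; apply: measurable_eval_pow; [exact: measurable_cst|exact: measurable_id].
Qed.

(** [mean_error_le] against the form 0. By translation invariance the integral of
    [|w (x + y) (u)|^p] over [x] does not depend on [y], so that no error occurs. *)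
Lemma Ntheta_le theta delta : (theta < 1)%R -> (0 < delta)%R ->
  Ntheta p theta (integration w) (near_simplices setT delta) <=
  (const_factor theta delta)%:E * \int[L]_x Phi x.
Proof.
move=> t1 d0; have t1' := ltW t1.
rewrite Ntheta_near_simplices//.
pose b : dform R n k := fun=> [ffun=> 0%R].
have b0 x h : covector_eval (b x) h = 0%R.
  by rewrite /covector_eval big1// => I _; rewrite ffunE mul0r.
pose q (z : pt * k.-tuple pt) := (`|covector_eval (w z.1) (udirs z.2)| `^ p)%:E : \bar R.
pose Q h := \int[L]_x q (x, h).
have mq : measurable_fun setT q.
  apply/measurable_EFinP; apply: measurable_eval_pow; first exact: measurable_fst.
  exact: measurableT_comp (@measurable_udirs R n k) measurable_snd.
have q0 z : 0 <= q z by rewrite lee_fin powR_ge0.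
have mQ : measurable_fun setT Q.
  exact: (@measurable_fun_fubini_tonelli_G _ _ _ _ _ L q).
have Q0 h : 0 <= Q h by exact: integral_ge0.
have mb : measurable_form setT b by move=> I; under eq_fun do rewrite ffunE; exact: measurable_cst.
have HQ h s : weight p theta delta h != 0%R -> Delta s ->
  \int[L]_x (`|covector_eval (w (x + combination h s)%R) (udirs h) - covector_eval (b x) (udirs h)| `^ p)%:E <= Q h.
  move=> _ _; rewrite /Q -(integral_translate (combination h s) (f := fun x => q (x, h))).
  - by under eq_integral do rewrite b0 subr0.
  - by apply: (measurableT_comp mq); exact: measurable_fun_pair.
  - by move=> x; exact: q0.
have := mean_error_le p_ge1 mw t1' mb mQ Q0 HQ.
under eq_integral do under eq_integral do rewrite b0 mulr0 subr0.
move=> H.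
under eq_integral do under eq_integral do rewrite indicE in_setT mul1r.
apply: (le_trans H).
rewrite /const_factor EFinM -muleA lee_wpmul2l ?lee_fin ?powR_ge0//.
rewrite -ge0_integralZl_EFin//; last 3 first.
- by move=> x _; exact: snorm_pow_ge0.
- exact: measurable_snorm_pow.
- by rewrite exprn_ge0// angular_factor_ge0.
under [leRHS]eq_integral do rewrite -weight_snorm_pow//.
have mwq : measurable_fun setT (fun z : pt * k.-tuple pt => (weight p theta delta z.2)%:E * q z).
  apply: emeasurable_funM => //; apply/measurable_EFinP.
  exact: measurableT_comp (@measurable_weight R n k p theta delta) measurable_snd.
have w0 h : 0 <= (weight p theta delta h)%:E by rewrite lee_fin weight_ge0.
rewrite (@fubini_tonelli _ _ _ _ _ L Lk (fun z => (weight p theta delta z.2)%:E * q z))//; last first.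
  by move=> z; exact: mule_ge0.
apply: nonneg_integral_le => // h; first exact: mule_ge0.
rewrite /= ge0_integralZl_EFin.
- exact: lexx.
- exact: measurableT.
- by move=> x _; exact: q0.
- by apply: (measurableT_comp mq); exact: measurable_fun_pair.
- exact: weight_ge0.
Qed.

Hypothesis w_fin : forall I, pnorm p (fun x => w x I) < +oo.

(** Continuity of the translations of each coefficient, uniformly in the frame [u]. *)
Lemma shift_form_le (eta : R) : (0 < eta)%R -> exists2 delta0 : R, (0 < delta0)%R &
  forall (y : pt) (u : k.-tuple pt), (enorm y < delta0)%R -> (forall i, (enorm (tnth u i) <= 1)%R) ->
  \int[L]_x (`|covector_eval (w (x + y)%R) u - covector_eval (w x) u| `^ p)%:E <= eta%:E.
Proof.
move=> eta0; have [C C0 HC] := @covector_eval_pow_le R n k p p_ge1.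
pose N : R := (\sum_(I : multi_index n k) 1)%R.
have N0 : (0 <= N)%R by exact: sumr_ge0.
pose eta' : R := (eta / (C * N + 1))%R.
have D0 : (0 < C * N + 1)%R by rewrite ltr_pwDr// mulr_ge0.
have eta'0 : (0 < eta')%R by rewrite divr_gt0.
have H I : exists d : R, (0 < d)%R /\ forall y : pt, (enorm y < d)%R ->
    shift_diff p (fun x => w x I) y <= eta'%:E.
  by have [d d0 Hd] := translation_continuous p_ge1 (mw I) (w_fin I) eta'0; exists d.
have [d Hd] := choice H.
exists (\big[Num.min/1%R]_I d I).
  by apply/bigmin_gtP; split => // I _; have [] := Hd I.
move=> y u yd u1.
have mz I : measurable_fun setT (fun x => (`|w (x + y)%R I - w x I| `^ p)%R).
  apply: (measurableT_comp (measurable_powR p)); apply: measurableT_comp => //.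
  exact: (measurable_shift_sub y (mw I)).
apply: (@le_trans _ _ (\int[L]_x (C%:E * \sum_I (`|w (x + y)%R I - w x I| `^ p)%:E))).
  apply: nonneg_integral_le => // x.
  rewrite covector_evalB sumEFin -EFinM lee_fin (le_trans (HC _ u u1))//.
  by rewrite ler_wpM2l//; apply: ler_sum => I _; rewrite ffunE.
rewrite ge0_integralZl_EFin//; last 2 first.
- by move=> x _; apply: sume_ge0 => I _; rewrite lee_fin powR_ge0.
- by apply: emeasurable_sum => I; apply/measurable_EFinP.
rewrite ge0_integral_sum//; last by move=> I; apply/measurable_EFinP.
apply: (@le_trans _ _ (C%:E * \sum_(I : multi_index n k) eta'%:E)).
  rewrite lee_wpmul2l ?lee_fin//; apply: lee_sum => I _; apply: (Hd I).2.
  by apply: (lt_le_trans yd); exact: bigmin_le.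
rewrite sumEFin -EFinM lee_fin (_ : (\sum_(I : multi_index n k) eta')%R = (N * eta')%R); last first.
  by rewrite /N mulr_suml; apply: eq_bigr => I _; rewrite mul1r.
rewrite mulrA /eta' mulrCA ler_piMr ?(ltW eta0)// ler_pdivrMr// mul1r lerDl//.
Qed.

(** Split the value [v w (x_0)] into the integral over the simplex and its deviation by
    [powRD_le_eps]. For edges shorter than [delta] the deviation is controlled by
    translations of length at most [delta]. *)
Lemma Ntheta_ge G (e eta : R) : measurable G -> (0 < e)%R -> (0 < eta)%R ->
  exists2 delta0 : R, (0 < delta0)%R & forall theta delta,
  (theta < 1)%R -> (0 < delta)%R -> (delta < delta0)%R ->
  (const_factor theta delta)%:E * \int[L]_(x in G) Phi x <=
  (1 + e)%:E * Ntheta p theta (integration w) (near_simplices G delta) +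
  (eta * mass n p theta delta ^+ k)%:E.
Proof.
move=> mG e0 eta0.
have [C C0 HC] := powRD_le_eps p_ge1 e0.
pose B : R := (C * v `^ p + 1)%R.
have Cv0 : (0 <= C * v `^ p)%R by rewrite mulr_ge0// powR_ge0.
have B0 : (0 < B)%R by rewrite ltr_pwDr.
have [d0 d00 Hd] := shift_form_le (divr_gt0 eta0 B0).
exists d0 => // theta delta t1 dp dd; have t1' := ltW t1.
have w0 h : (0 <= weight p theta delta h)%R by rewrite weight_ge0.
have c0 h : (0 <= edge_coef p theta delta h)%R by rewrite edge_coef_ge0.
have mh : measurable_fun setT (fun z : pt * k.-tuple pt => weight p theta delta z.2).
  exact: measurableT_comp (@measurable_weight R n k p theta delta) measurable_snd.
have mind : measurable_fun setT (fun x : pt => \1_G x : R) by exact: measurable_indic.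
have mc : measurable_fun setT (fun h => edge_coef p theta delta h).
  apply: measurable_fun_ifT => //.
  - apply: (measurable_fun_bool true); rewrite setTI.
    by have := @measurable_short_edges R n k delta; congr (measurable _); apply/seteqP; split.
  - apply: measurable_funM; first exact: measurable_cst.
    have := measurableT_comp (measurable_powR (- (n%:R + theta * p)%R)) (@measurable_edge_prod R n k).
    by apply: eq_measurable_fun => x _ /=; rewrite powRN.
pose q (z : pt * k.-tuple pt) : R := (`|v * covector_eval (w z.1) z.2| `^ p)%R.
pose g1 (z : pt * k.-tuple pt) : R := (\1_G z.1 * (edge_coef p theta delta z.2 * `|F z.1 z.2| `^ p))%R.
pose g2 (z : pt * k.-tuple pt) : R := (edge_coef p theta delta z.2 *
  `|F z.1 z.2 - v * covector_eval (w z.1) z.2| `^ p)%R.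
have mF : measurable_fun setT (fun z : pt * k.-tuple pt => F z.1 z.2).
  exact: measurableT_comp (measurable_integration mw) (@measurable_simplex_at R n k).
have mind1 : measurable_fun setT (fun z : pt * k.-tuple pt => \1_G z.1 : R).
  exact: measurableT_comp mind measurable_fst.
have mc2 : measurable_fun setT (fun z : pt * k.-tuple pt => edge_coef p theta delta z.2).
  exact: measurableT_comp mc measurable_snd.
have mew : measurable_fun setT (fun z : pt * k.-tuple pt => covector_eval (w z.1) z.2).
  apply: measurable_covector_eval; last exact: measurable_snd.
  by move=> I; exact: measurableT_comp (mw I) measurable_fst.
have mg1 : measurable_fun setT (fun z => (g1 z)%:E : \bar R).
  apply/measurable_EFinP; apply: measurable_funM => //; apply: measurable_funM => //.
  by apply: (measurableT_comp (measurable_powR p)); exact: measurableT_comp.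
have mg2 : measurable_fun setT (fun z => (g2 z)%:E : \bar R).
  apply/measurable_EFinP; apply: measurable_funM => //.
  apply: (measurableT_comp (measurable_powR p)); apply: measurableT_comp => //.
  by apply: measurable_funB => //; apply: measurable_funM => //; exact: measurable_cst.
have g10 z : 0 <= (g1 z)%:E by rewrite lee_fin !mulr_ge0 ?powR_ge0// indicE.
have g20 z : 0 <= (g2 z)%:E by rewrite lee_fin !mulr_ge0 ?powR_ge0.
have mx (g : pt * k.-tuple pt -> \bar R) x : measurable_fun setT g ->
    measurable_fun setT (fun h => g (x, h)).
  by move=> mg; exact: measurableT_comp mg (pair1_measurable x).
have mF2 (g : pt * k.-tuple pt -> \bar R) : measurable_fun setT g -> (forall z, 0 <= g z) ->
    measurable_fun setT (fun x => \int[Lk]_h g (x, h)).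
  by move=> mg g0; exact: (@measurable_fun_fubini_tonelli_F _ _ _ _ _ Lk g).
have E1 : \int[L]_x \int[Lk]_h (g2 (x, h))%:E <= (v `^ p * (eta / B) * mass n p theta delta ^+ k)%:E.
  have HQ h s : weight p theta delta h != 0%R -> Delta s ->
      \int[L]_x (`|covector_eval (w (x + combination h s)%R) (udirs h)
         - covector_eval (w x) (udirs h)| `^ p)%:E <= cst (eta / B)%:E h.
    move=> wh sD; apply: Hd => [|i]; last by rewrite tnth_mktuple enorm_udir_le1.
    apply: le_lt_trans dd; apply: enorm_combination_le => // [|i]; first exact: ltW.
    by apply: ltW; have [] := weight_neq0 p_ge1 wh i.
  have Q0 h : 0 <= cst (eta / B)%:E h :> \bar R by rewrite lee_fin divr_ge0// ltW.
  apply: (le_trans (mean_error_le p_ge1 mw t1' mw (measurable_cst _) Q0 HQ)).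
  rewrite /= ge0_integralZr//; last 3 first.
  - by apply/measurable_EFinP; exact: measurable_weight.
  - by move=> h _; rewrite lee_fin.
  - by rewrite lee_fin divr_ge0// ltW.
  rewrite [X in _ * (X * _)](integral_weight p_ge1 kn t1 dp) -!EFinM lee_fin.
  by rewrite -mulrA [X in (_ * X <= _)%R]mulrC.
have E2 : (const_factor theta delta)%:E * \int[L]_(x in G) Phi x <=
    \int[L]_x \int[Lk]_h (\1_G x * (edge_coef p theta delta h * q (x, h)))%:E.
  rewrite le_eqVlt; apply/orP; left; apply/eqP.
  rewrite integral_mkcond -ge0_integralZl_EFin//; last 3 first.
  - by move=> x _; rewrite patchE; case: ifP => // _; exact: snorm_pow_ge0.
  - apply/(measurable_restrictT _ _).1 => //.
    by apply: measurable_funTS; exact: measurable_snorm_pow.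
  - exact: const_factor_ge0.
  apply: eq_integral => x _; rewrite patchE indicE; case: ifP => _; last first.
    by rewrite mule0 integral0_eq// => h _; rewrite mul0r.
  rewrite /const_factor EFinM -muleA -(weight_snorm_pow x t1 dp) -ge0_integralZl_EFin; last 4 first.
  - exact: measurableT.
  - by move=> h _; rewrite lee_fin mulr_ge0// powR_ge0.
  - apply/measurable_EFinP; apply: measurable_funM; first exact: measurable_weight.
    by apply: (measurable_eval_pow (f := cst x)); [exact: measurable_cst|exact: measurable_udirs].
  - exact: powR_ge0.
  apply: eq_integral => h _; rewrite -EFinM mul1r; congr EFin.
  rewrite /q/= (covector_eval_udirs (w x) h) !normrM.
  rewrite (ger0_norm (ltW v_gt0)) (ger0_norm (edge_prod_ge0 h)).
  rewrite !powRM ?mulr_ge0 ?edge_prod_ge0 ?(ltW v_gt0)//.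
  by rewrite -(edge_coefM p theta delta h); ring.
apply: (le_trans E2); rewrite Ntheta_near_simplices//.
apply: (@le_trans _ _ ((1 + e)%:E * (\int[L]_x \int[Lk]_h (g1 (x, h))%:E) +
    C%:E * \int[L]_x \int[Lk]_h (g2 (x, h))%:E)); last first.
  rewrite leeD2l//; apply: (@le_trans _ _ (C%:E * (v `^ p * (eta / B) * mass n p theta delta ^+ k)%:E)).
    by rewrite lee_wpmul2l.
  rewrite -EFinM lee_fin !mulrA ler_wpM2r//.
    by rewrite exprn_ge0// fine_ge0//; apply: integral_ge0 => x _; rewrite lee_fin rho_ge0.
  rewrite -[X in (X <= _)%R]mulrA [X in (X <= _)%R]mulrC -mulrA ler_piMr ?(ltW eta0)//.
  by rewrite mulrC ler_pdivrMr// mul1r lerDl.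
have i10 x : 0 <= \int[Lk]_h (g1 (x, h))%:E by apply: integral_ge0.
have i20 x : 0 <= \int[Lk]_h (g2 (x, h))%:E by apply: integral_ge0.
have e10 : (0 <= 1 + e)%R by rewrite addr_ge0// ltW.
have mI1 := mF2 (fun z => (g1 z)%:E) mg1 g10.
have mI2 := mF2 (fun z => (g2 z)%:E) mg2 g20.
rewrite -ge0_integralZl_EFin//.
rewrite -ge0_integralZl_EFin//.
rewrite -ge0_integralD//; last 4 first.
- by move=> x _; rewrite mule_ge0.
- by apply: emeasurable_funM => //; exact: mI1.
- by move=> x _; rewrite mule_ge0.
- by apply: emeasurable_funM => //; exact: mI2.
apply: nonneg_integral_le; last by [].
  by move=> x; apply: integral_ge0 => h _; rewrite lee_fin !mulr_ge0 ?powR_ge0// indicE.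
move=> x; rewrite -ge0_integralZl_EFin//; last by exact: (mx _ x mg1).
rewrite -ge0_integralZl_EFin//; last by exact: (mx _ x mg2).
rewrite -ge0_integralD//; last 4 first.
- by move=> h _; rewrite mule_ge0.
- by apply: emeasurable_funM => //; exact: (mx _ x mg1).
- by move=> h _; rewrite mule_ge0.
- by apply: emeasurable_funM => //; exact: (mx _ x mg2).
apply: nonneg_integral_le => // h.
  by rewrite lee_fin !mulr_ge0 ?powR_ge0// indicE.
rewrite -!EFinM -EFinD lee_fin /g1 /g2 /q/= indicE; case: (x \in G); last first.
  by rewrite !mul0r mulr0 add0r !mulr_ge0 ?powR_ge0.
rewrite !mul1r mulrCA (mulrCA C) -mulrDr ler_wpM2l//.
apply: (le_trans _ (HC `|F x h| `|F x h - v * covector_eval (w x) h| (normr_ge0 _) (normr_ge0 _))%R).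
apply: powR_homo => //.
rewrite -[X in (`|X| <= _)%R](subKr (F x h)).
exact: ler_normB.
Qed.

End two_bounds.

(** * The limit *)

Section limf.
Local Open Scope ereal_scope.
Variables (R : realType) (F : set_system R) (FF : ProperFilter F).

Let limf_esup_squeeze (f : R -> \bar R) (l : R) :
  (forall e : R, (0 < e)%R -> \forall t \near F, (l - e)%:E <= f t <= (l + e)%:E) ->
  limf_esup f F = l%:E.
Proof.
move=> H; apply/eqP; rewrite eq_le limf_esupE; apply/andP; split.
  apply/lee_addgt0Pr => e e0.
  apply: (@le_trans _ _ (ereal_sup (f @` [set t | (l - e)%:E <= f t <= (l + e)%:E]))).
    by apply: ereal_inf_lbound; exists [set t | (l - e)%:E <= f t <= (l + e)%:E] => //; exact: H.
  by apply: ge_ereal_sup => _ [t /= /andP[_ h] <-].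
apply: le_ereal_inf_tmp => _ [V FV <-]; apply/lee_subgt0Pr => e e0.
have [t [/andP[h _] Vt]] := filter_ex (filterI (H e e0) FV).
by apply: (le_trans h); apply: ereal_sup_ubound; exists t.
Qed.

Lemma limf_squeeze (f : R -> \bar R) (l : R) :
  (forall e : R, (0 < e)%R -> \forall t \near F, (l - e)%:E <= f t <= (l + e)%:E) ->
  limf_esup f F = l%:E /\ limf_einf f F = l%:E.
Proof.
move=> H; split; first exact: limf_esup_squeeze.
rewrite /limf_einf (limf_esup_squeeze (l := (- l)%R)) ?EFinN ?oppeK//.
move=> e e0; apply: filterS (H e e0) => t /andP[h1 h2].
rewrite leeNr leeNl -!EFinN.
have -> : (- (- l + e) = l - e)%R by ring.
have -> : (- (- l - e) = l + e)%R by ring.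
by rewrite h1 h2.
Qed.

End limf.

Section constant.
Variables (R : realType) (n k : nat) (p : R).
Hypotheses (p_ge1 : 1 <= p) (kn : (k <= n)%N).

(** For [k = 0] the constant is [v^p] for every [theta]; otherwise [0 < n], and
    [mass_limit] applies. *)
Lemma const_factor_limit : exists K C : R, [/\ 0 < K, 0 <= C &
  forall delta : R, 0 < delta ->
    const_factor n k p theta delta @[theta --> 1%R^'-] --> K /\
    mass n p theta delta ^+ k @[theta --> 1%R^'-] --> C].
Proof.
have v0 := simplex_volume_gt0 R k.
case: k kn v0 => [|k'] kn' v0.
  exists (simplex_volume R 0 `^ p), 1; split => //; first exact: powR_gt0.
  by move=> d d0; split; rewrite /const_factor; under eq_fun do rewrite expr0 ?mulr1; exact: cvg_cst.
case: n kn' => // m _.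
have [C C0 HC] := @mass_limit R m p p_ge1.
have H0 : 0 < fine (sphere_measure m.+1 [set: 'rV[R]_m.+1]).
  by rewrite fine_gt0// sphere_measure_gt0 sphere_measure_setT_lty.
exists (simplex_volume R k'.+1 `^ p * (C / fine (sphere_measure m.+1 [set: 'rV[R]_m.+1])) ^+ k'.+1).
exists (C ^+ k'.+1); split; first by rewrite mulr_gt0 ?powR_gt0// exprn_gt0// divr_gt0.
  by rewrite exprn_ge0// ltW.
have cvX (f : R -> R) (l : R) j : f t @[t --> 1%R^'-] --> l -> f t ^+ j @[t --> 1%R^'-] --> l ^+ j.
  move=> fl; elim: j => [|j IH]; first by under eq_fun do rewrite expr0; exact: cvg_cst.
  by under eq_fun do rewrite exprS; rewrite exprS; exact: cvgM.
move=> d d0; split; last by apply: cvX; exact: HC.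
apply: cvgM; first exact: cvg_cst.
by apply: cvX; apply: cvgM; [exact: HC|exact: cvg_cst].
Qed.

End constant.

Section squeeze.
Local Open Scope ereal_scope.
Variables (R : realType) (n k : nat) (p : R).
Hypotheses (p_ge1 : (1 <= p)%R) (kn : (k <= n)%N).
Notation pt := 'rV[R]_n.
Notation L := (@lebesgue_rV R n).

Let p_gt0 : (0 < p)%R. Proof. exact: lt_le_trans p_ge1. Qed.

Lemma snorm_pow_le : exists2 C : R, (0 <= C)%R & forall (w : dform R n k) (x : pt),
  snorm_pow p w x <= (C * \sum_I `|w x I| `^ p)%:E.
Proof.
have [C C0 HC] := @covector_eval_pow_le R n k p p_ge1.
have [M ME] := sphere_measure_ex R n.
have Moo : M setT < +oo by rewrite -ME; exact: sphere_measure_setT_lty.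
have Foo : tuple_product M k (@frames R n k) \is a fin_num.
  have -> := tuple_product_box M (fun=> @measurable_unit_sphere R n).
  elim/big_ind: _ => // [a b|i _]; first exact: fin_numM.
  rewrite ge0_fin_numE//; apply: le_lt_trans Moo; apply: le_measure; rewrite ?inE//.
  exact: measurable_unit_sphere.
exists (C * fine (tuple_product M k (@frames R n k)))%R.
  by rewrite mulr_ge0// fine_ge0.
move=> w x; rewrite /snorm_pow ME.
apply: (@le_trans _ _ (\int[tuple_product M k]_(u in @frames R n k) (C * \sum_I `|w x I| `^ p)%:E)).
  apply: ge0_le_integral => //.
  - exact: measurable_frames.
  - apply/measurable_EFinP; apply: measurable_funTS.
    apply: (measurableT_comp (measurable_powR p)); apply: measurableT_comp => //.
    by apply: measurable_covector_eval => //; exact: measurable_id.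
  - by move=> u uF; rewrite lee_fin HC// => i; rewrite (uF i).
rewrite integral_cst//; last exact: measurable_frames.
by rewrite -[X in _ * X]fineK// -EFinM lee_fin mulrAC.
Qed.

Variables (w : dform R n k) (K C : R) (Omega : set pt).
Hypotheses (mw : measurable_form setT w).
Hypothesis w_fin : forall I, pnorm p (fun x => w x I) < +oo.
Hypotheses (K0 : (0 < K)%R) (C0 : (0 <= C)%R).
Hypothesis KC : forall delta : R, (0 < delta)%R ->
    const_factor n k p theta delta @[theta --> 1%R^'-] --> K /\
    (mass n p theta delta ^+ k)%R @[theta --> 1%R^'-] --> C.
Hypothesis oO : open Omega.
Let Phi := snorm_pow p w.
Hypothesis Phi_Omega : \int[L]_x Phi x = \int[L]_(x in Omega) Phi x.

Lemma snorm_pow_integral_lty : \int[L]_x Phi x < +oo.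
Proof.
have [D D0 HD] := snorm_pow_le.
have mpI I : measurable_fun setT (fun x => (`|w x I| `^ p)%:E : \bar R).
  exact: measurable_pow (mw I).
apply: (@le_lt_trans _ _ (\int[L]_x (D%:E * \sum_I (`|w x I| `^ p)%:E))).
  apply: nonneg_integral_le => // x; first exact: snorm_pow_ge0.
  by rewrite sumEFin -EFinM; exact: HD.
rewrite ge0_integralZl_EFin//; last 2 first.
- by move=> x _; apply: sume_ge0 => I _; rewrite lee_fin powR_ge0.
- by apply: emeasurable_sum => I.
rewrite ge0_integral_sum//.
have -> : \sum_I \int[L]_x (`|w x I| `^ p)%:E = (\sum_I fine (pnorm p (fun x => w x I)))%R%:E.
  rewrite -sumEFin; apply: eq_bigr => I _; rewrite fineK// ge0_fin_numE//.
  exact: pnorm_ge0.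
by rewrite -EFinM ltry.
Qed.

Let J : R := fine (\int[L]_x Phi x).
Let JE : \int[L]_x Phi x = J%:E.
Proof.
rewrite /J fineK// ge0_fin_numE ?snorm_pow_integral_lty//.
by apply: integral_ge0 => x _; exact: snorm_pow_ge0.
Qed.

Lemma inner_exhausts (e : R) : (0 < e)%R -> exists m, exists2 g : R,
  \int[L]_(x in inner Omega m) Phi x = g%:E & (J - e <= g <= J)%R.
Proof.
move=> e0.
have mI m : measurable (inner Omega m) by exact: measurable_inner.
have Phi0 x : 0 <= Phi x by exact: snorm_pow_ge0.
have H := @ge0_nondecreasing_set_cvg_integral _ _ R _ Phi L (@inner_nd R n Omega) mI.
have := H (fun m => measurable_funTS (measurable_snorm_pow p mw)) (fun m x _ => Phi0 x).
rewrite (bigcup_inner (open_eopen oO)) -Phi_Omega JE => cv.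
have fin m : \int[L]_(x in inner Omega m) Phi x = (fine (\int[L]_(x in inner Omega m) Phi x))%:E
    /\ \int[L]_(x in inner Omega m) Phi x <= J%:E.
  have le : \int[L]_(x in inner Omega m) Phi x <= J%:E.
    by rewrite -JE; apply: nonneg_integral_le.
  split => //; rewrite fineK// ge0_fin_numE; first by rewrite (le_lt_trans le)// ltry.
  exact: integral_ge0.
move/fine_cvgP : cv => [_ /cvgrPdist_lt /(_ _ e0)] [m _ /(_ m (leqnn m))] Hm.
exists m; exists (fine (\int[L]_(x in inner Omega m) Phi x)); first by have [] := fin m.
have [E le] := fin m; move: le; rewrite E lee_fin => ->; rewrite andbT.
by move: Hm => /=; rewrite ltr_distl => /andP[]; lra.
Qed.

(** The upper bound applies to the simplices with edges shorter than [r], the lower one to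
    the short simplices based well inside [Omega]. The integral of [Phi] over the
    inner approximations tends to the integral over [Omega], which is that over the
    whole space as the form vanishes outside. *)
Lemma Ntheta_squeeze (A : set (k.+1.-tuple pt)) (r : R) : (0 < r)%R ->
  A `<=` near_simplices setT r ->
  (forall m, exists2 d : R, (0 < d)%R & near_simplices (inner Omega m) d `<=` A) ->
  forall e : R, (0 < e)%R -> \forall theta \near (1%R : R)^'-,
    (K * J - e)%:E <= Ntheta p theta (integration w) A <= (K * J + e)%:E.
Proof.
move=> r0 Ar Ainner e e0.
have J0 : (0 <= J)%R by rewrite fine_ge0//; apply: integral_ge0 => x _; exact: snorm_pow_ge0.
have le4 (a : R) : (0 <= a)%R -> (a * (e / (4 * (a + 1))) <= e / 4)%R.
  by move=> a0; rewrite mulrA ler_pdivrMr ?mulr_gt0//; nra.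
have pos4 (a : R) : (0 <= a)%R -> (0 < e / (4 * (a + 1)))%R.
  by move=> a0; rewrite divr_gt0// mulr_gt0// ltr_pwDr.
(* the lower bound loses to the inner approximation, to [const_factor], to the
   factor [1 + e] of [Ntheta_ge] and to its last term: a quarter of [e] each *)
pose B : R := (K * J + 1)%R.
have B0 : (0 <= B)%R by rewrite addr_ge0// mulr_ge0// ltW.
have [m [g gE /andP[g1 g2]]] := inner_exhausts (pos4 K (ltW K0)).
have mG : measurable (inner Omega m) by exact: measurable_inner.
have [d0 d00 Hd0] := Ntheta_ge p_ge1 kn mw w_fin mG (pos4 B B0) (pos4 (C + 1)%R (addr_ge0 C0 ler01)).
have [d1 d10 Hd1] := Ainner m.
pose d : R := (Num.min (d0 / 2) d1)%R.
have dp : (0 < d)%R by rewrite lt_min d10 divr_gt0.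
have dd0 : (d < d0)%R.
  by apply: (@le_lt_trans _ _ (d0 / 2)%R); [rewrite ge_min lexx|lra].
have dA : near_simplices (inner Omega m) d `<=` A.
  move=> t [h1 /forallP h2]; apply: Hd1; split => //; apply/forallP => i.
  by apply: (lt_le_trans (h2 i)); rewrite ge_min lexx orbT.
have [cK cC] := KC dp; have [cKr _] := KC r0.
have min0 : (0 < Num.min e 1 / (J + 1))%R.
  by rewrite divr_gt0 ?lt_min ?e0 ?ltr01// ltr_pwDr.
near=> theta.
have t1 : (theta < 1)%R by near: theta; exact: nbhs_left_lt.
have t1' := ltW t1.
have h1 : (`|K - const_factor n k p theta d| < e / (4 * (J + 1)))%R.
  by near: theta; move/cvgrPdist_lt: cK; apply; exact: pos4.
have h2 : (`|C - mass n p theta d ^+ k| < 1)%R.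
  by near: theta; move/cvgrPdist_lt: cC; apply; exact: ltr01.
have h3 : (`|K - const_factor n k p theta r| < Num.min e 1 / (J + 1))%R.
  by near: theta; move/cvgrPdist_lt: cKr; apply.
have integrand0 t : 0 <= ((1 - theta) ^+ k * `|integration w t| `^ p /
    (\prod_(i < k) enorm (tnth (edges t) i)) `^ (n%:R + theta * p))%:E.
  rewrite lee_fin mulr_ge0 ?invr_ge0 ?powR_ge0// mulr_ge0 ?powR_ge0//.
  by rewrite exprn_ge0// subr_ge0.
have up : Ntheta p theta (integration w) A <= (const_factor n k p theta r * J)%:E.
  rewrite EFinM -JE; apply: le_trans (Ntheta_le p_ge1 kn mw t1 r0).
  exact: nonneg_integral_le.
have N0 : 0 <= Ntheta p theta (integration w) A by exact: integral_ge0.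
have low := Hd0 theta d t1 dp dd0.
have lowA : Ntheta p theta (integration w) (near_simplices (inner Omega m) d) <=
  Ntheta p theta (integration w) A by exact: nonneg_integral_le.
have : Ntheta p theta (integration w) A \is a fin_num.
  by rewrite ge0_fin_numE// (le_lt_trans up)// ltry.
move: up N0 lowA; case: (Ntheta p theta (integration w) A) => [y| |]//.
rewrite !lee_fin => up y0 lowA _.
have e'0 := pos4 B B0.
have {}low : (const_factor n k p theta d * g)%:E <=
    (1 + e / (4 * (B + 1)))%:E * y%:E + (e / (4 * (C + 1 + 1)) * mass n p theta d ^+ k)%:E.
  rewrite EFinM -gE; apply: (le_trans low); rewrite leeD2r// lee_wpmul2l// lee_fin.
  by rewrite addr_ge0// ltW.
move: low; rewrite -EFinM -EFinD lee_fin => low.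
move: h1 h2 h3; rewrite !ltr_distlC => /andP[h1 _] /andP[_ h2] /andP[_ h3].
have up' : (y <= K * J + Num.min e 1)%R.
  apply: (le_trans up); apply: (@le_trans _ _ ((K + Num.min e 1 / (J + 1)) * J)%R).
    by rewrite ler_wpM2r// ltW.
  rewrite mulrDl lerD2l mulrAC ler_pdivrMr ?ltr_pwDr// ler_wpM2l ?lerDl//.
  by rewrite le_min ler01 ltW.
have m1 : (Num.min e 1 <= e)%R by rewrite ge_min lexx.
have m2 : (Num.min e 1 <= 1 :> R)%R by rewrite ge_min lexx orbT.
apply/andP; split; last by rewrite (le_trans up')// lerD2l.
have H1 := le4 K (ltW K0). have H2 := le4 J J0. have H3 := le4 B B0.
have H4 := le4 (C + 1)%R (addr_ge0 C0 ler01).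
have yB : (y <= B)%R by rewrite (le_trans up')// lerD2l.
have g0 : (0 <= g)%R.
  by rewrite -lee_fin -gE; apply: integral_ge0 => x _; exact: snorm_pow_ge0.
have q1 := pos4 K (ltW K0). have q2 := pos4 J J0. have q4 := pos4 (C + 1)%R (addr_ge0 C0 ler01).
move: (e / (4 * (K + 1)))%R (e / (4 * (J + 1)))%R (e / (4 * (B + 1)))%R
  (e / (4 * (C + 1 + 1)))%R q1 q2 e'0 q4 g1 h1 low H1 H2 H3 H4 => eK eJ eB eC q1 q2 q3 q4 g1 h1 low H1 H2 H3 H4.
have r1 : (K * J - e / 4 <= K * g)%R.
  by apply: (@le_trans _ _ (K * (J - eK))%R); [rewrite mulrBr; lra|rewrite ler_wpM2l// ltW].
have r2 : (K * g - e / 4 <= const_factor n k p theta d * g)%R.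
  apply: (@le_trans _ _ ((K - eJ) * g)%R); last by rewrite ler_wpM2r// ltW.
  rewrite mulrBl lerD2l lerN2; apply: le_trans H2.
  by rewrite mulrC ler_wpM2r// ltW.
have r3 : (eB * y <= e / 4)%R.
  by apply: le_trans H3; rewrite mulrC ler_wpM2r// ltW.
have r4 : (eC * mass n p theta d ^+ k <= e / 4)%R.
  by apply: le_trans H4; rewrite mulrC ler_wpM2r ?(ltW q4)//; exact: ltW.
by move: low; rewrite mulrDl mul1r; lra.
Unshelve. all: by end_near.
Qed.

End squeeze.

(** * The four domains and the choice of a representative *)

Section domains.
Variables (R : realType) (n k : nat).
Notation pt := 'rV[R]_n.
Implicit Types (Omega : set pt) (t : k.+1.-tuple pt).

Lemma tnth_edges t i : tnth (edges t) i = tnth t (lift ord0 i) - base_point t.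
Proof. by rewrite tnth_mktuple. Qed.

(** The bound on the set is in the sup norm, hence the sums. *)
Lemma bounded_short_edges Omega : bounded_set Omega -> exists2 M : R, 0 < M &
  forall t, pow_set Omega t -> forall i, enorm (tnth (edges t) i) < M.
Proof.
move=> /pinfty_ex_gt0[M M0 HM].
have H (x : pt) : Omega x -> enorm x <= \sum_(i < n) M.
  move=> Ox; apply: (le_trans (enorm_le_sum x)); apply: ler_sum => i _.
  apply: le_trans (HM x Ox).
  rewrite [leRHS]mx_normrE.
  exact: (@le_bigmax _ R _ 0 (fun ij : 'I_1 * 'I_n => `|x ij.1 ij.2|) (ord0, i)).
have S0 : 0 <= \sum_(i < n) M by apply: sumr_ge0 => i _; exact: ltW.
exists (\sum_(i < n) M + \sum_(i < n) M + 1); first by rewrite ltr_pwDr// addr_ge0.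
move=> t Ot i; rewrite tnth_edges.
rewrite (@le_lt_trans _ _ (\sum_(i < n) M + \sum_(i < n) M))//; last by rewrite ltrDl.
apply: (le_trans (enormD _ _)); rewrite enormN.
by rewrite lerD// H//; exact: Ot.
Qed.

Lemma seminorm_domain_short (s : seminorm_kind) Omega (r c : R) : 0 < r ->
  (s = LpM \/ s = LpM_c -> bounded_set Omega) ->
  exists2 r' : R, 0 < r' & seminorm_domain s Omega r c `<=` @near_simplices R n k setT r'.
Proof.
move=> r0; case: s => /= bO.
- have [M M0 HM] := bounded_short_edges (bO (or_introl erefl)).
  by exists M => // t Ot; split => //; apply/forallP => i; exact: HM.
- by exists r => // t [_ h]; split => //; apply/forallP => i; exact: h.
- have [M M0 HM] := bounded_short_edges (bO (or_intror erefl)).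
  by exists M => // t [Ot _]; split => //; apply/forallP => i; exact: HM.
- by exists r => // t [[_ h] _]; split => //; apply/forallP => i; exact: h.
Qed.

(** Boundary points of an open set lie outside it. *)
Lemma dist_boundary_inner Omega m (x : pt) : open Omega -> inner Omega m x ->
  ((m.+1%:R^-1)%:E <= dist_boundary Omega x)%E.
Proof.
move=> oO xi; apply: le_ereal_inf_tmp => _ [y [_ yO] <-].
rewrite lee_fin leNgt; apply/negP => xy; apply: yO.
suff Oy : Omega y by move: oO; rewrite openE => /(_ y Oy).
by apply: xi; rewrite /eball/= enormC.
Qed.

(** A short simplex based well inside [Omega] has its vertices in [Omega], and its edges
    are short in comparison with the distance to the boundary. *)
Lemma inner_near_sub_domain (s : seminorm_kind) Omega (r c : R) m : open Omega ->
  0 < r -> 0 < c ->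
  exists2 d : R, 0 < d & @near_simplices R n k (inner Omega m) d `<=` seminorm_domain s Omega r c.
Proof.
move=> oO r0 c0; pose a : R := m.+1%:R^-1.
have a0 : 0 < a by rewrite invr_gt0.
exists (Num.min r (Num.min a (c * a))); first by rewrite !lt_min r0 a0 mulr_gt0.
move=> t [xi /forallP h].
have hr i : enorm (tnth (edges t) i) < r by apply: (lt_le_trans (h i)); rewrite ge_min lexx.
have ha i : enorm (tnth (edges t) i) < a.
  by apply: (lt_le_trans (h i)); rewrite !ge_min lexx orbT.
have hc i : enorm (tnth (edges t) i) < c * a.
  by apply: (lt_le_trans (h i)); rewrite !ge_min lexx !orbT.
have Ot : pow_set Omega t.
  move=> i; case: (unliftP ord0 i) => [j ->|->]; last exact: inner_sub xi.
  by apply: xi; rewrite /eball/= -tnth_edges; exact: ha.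
have Ct : cone_set Omega c t.
  split=> // i; apply: (@lt_le_trans _ _ (c * a)%:E); first by rewrite lte_fin.
  by rewrite EFinM; apply: lee_wpmul2l; [rewrite lee_fin ltW|exact: dist_boundary_inner].
by case: s => //=; split.
Qed.

End domains.

Section representative.
Local Open Scope ereal_scope.
Variables (R : realType) (n k : nat) (p : R).
Hypothesis p_ge1 : (1 <= p)%R.
Notation pt := 'rV[R]_n.
Notation L := (@lebesgue_rV R n).
Variables (Omega : set pt) (w wB : dform R n k).
Hypotheses (oO : open Omega) (wL : Lp_form Omega p w).
Hypothesis wBP : zero_extension_representative Omega w wB.

Let p_gt0 : (0 < p)%R. Proof. exact: lt_le_trans p_ge1. Qed.
Let p_neq0 : p != 0%R. Proof. by rewrite gt_eqF. Qed.

Let poweR_root (a : \bar R) : 0 <= a -> `|a `^ p^-1| `^ p = a.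
Proof. by move=> a0; rewrite (gee0_abs (poweR_ge0 _ _)) -poweRrM mulVf ?poweRe1. Qed.

Let w0 := zero_extend Omega w.
Let mOmega : measurable Omega. Proof. exact: eopen_measurable (open_eopen oO). Qed.

Let mw0 : measurable_form setT w0.
Proof.
move=> I; have -> : (fun x => w0 x I) = (fun x => w x I) \_ Omega.
  by apply/funext => x; rewrite /w0 /zero_extend /patch; case: ifP => // _; rewrite ffunE.
by case: wL => mw _; exact: ((measurable_restrictT (fun x => w x I) mOmega).1 (mw I)).
Qed.

(** For a [g] that depends on the value of the form at the point only, the representative
    may be replaced by the extension itself, with which it agrees almost everywhere. *)
Lemma integral_representative (g : dform R n k -> pt -> \bar R) (D : set pt) :
  (forall w1 w2 x, w1 x = w2 x -> g w1 x = g w2 x) ->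
  (forall w1, measurable_form setT w1 -> measurable_fun setT (g w1)) ->
  (forall w1 x, 0 <= g w1 x) -> measurable D ->
  \int[L]_(x in D) g wB x = \int[L]_(x in D) g w0 x.
Proof.
move=> g1 mg g0 mD; apply: ge0_ae_eq_integral => //.
- by apply: measurable_funTS; apply: mg; case: wBP.
- by apply: measurable_funTS; exact: mg.
- by case: wBP => _; apply: filterS => x E _; exact: g1.
Qed.

Lemma coef_le_covector_norm (a : covector R n k) I : (`|a I| <= covector_norm a)%R.
Proof.
rewrite -sqrtr_sqr /covector_norm ler_wsqrtr// (bigD1 I)//= lerDl.
by apply: sumr_ge0 => J _; exact: sqr_ge0.
Qed.

Lemma pnorm_representative_lty I : pnorm p (fun x => wB x I) < +oo.
Proof.
have -> : pnorm p (fun x => wB x I) = pnorm p (fun x => w0 x I).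
  apply: (integral_representative (g := fun w1 x => (`|w1 x I| `^ p)%:E)) => //.
  - by move=> w1 w2 x ->.
  - by move=> w1 mw1; exact: measurable_pow (mw1 I).
case: wL => _; rewrite /Lnorm_on => Lfin; have := poweR_lty p Lfin.
rewrite (powR_Lnorm _ _ p_neq0); apply: le_lt_trans.
apply: nonneg_integral_le => // x.
rewrite /w0 /zero_extend /patch; case: ifP => _ /=.
  by rewrite lee_fin powR_homo// [leRHS]ger0_norm ?sqrtr_ge0// coef_le_covector_norm.
by rewrite ffunE normr0 powR0// normr0 powR0.
Qed.

Lemma snorm_pow0 x : snorm_pow p (fun=> [ffun=> 0%R] : covector R n k) x = 0.
Proof.
have [M ME] := sphere_measure_ex R n; rewrite /snorm_pow ME.
rewrite integral0_eq// => u _; rewrite /covector_eval big1 ?normr0 ?powR0//.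
by move=> I _; rewrite ffunE mul0r.
Qed.

Let snorm_pow_ext (w1 w2 : dform R n k) x : w1 x = w2 x -> snorm_pow p w1 x = snorm_pow p w2 x.
Proof. by rewrite /snorm_pow => ->. Qed.

Let snorm_pow_w0 x : ~ Omega x -> snorm_pow p w0 x = 0.
Proof.
move=> nO; rewrite -(snorm_pow0 x); apply: snorm_pow_ext.
by rewrite /w0 /zero_extend /patch memNset.
Qed.

Let integral_snorm_w0 D : measurable D ->
  \int[L]_(x in D) snorm_pow p wB x = \int[L]_(x in D) snorm_pow p w0 x.
Proof.
apply: (@integral_representative (snorm_pow p) D).
- exact: snorm_pow_ext.
- by move=> w1 mw1; exact: measurable_snorm_pow.
- by move=> w1 x; exact: snorm_pow_ge0.
Qed.

Lemma snorm_pow_supported :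
  \int[L]_x snorm_pow p wB x = \int[L]_(x in Omega) snorm_pow p wB x.
Proof.
have E := integral_snorm_w0 mOmega; have ET := integral_snorm_w0 measurableT.
apply: (etrans ET); apply: esym; apply: (etrans E).
rewrite [LHS]integral_mkcond; apply: eq_integral => x _.
rewrite patchE; case: ifPn => [_|/negP nO]; first exact: erefl.
exact: esym (snorm_pow_w0 (fun h => nO (mem_set h))).
Qed.

Lemma Lnorm_on_snorm : Lnorm_on Omega p (fun x => covector_snorm p (w x)) =
  (\int[L]_x snorm_pow p wB x) `^ p^-1.
Proof.
have ET := integral_snorm_w0 measurableT.
have -> : \int[L]_x snorm_pow p wB x = \int[L]_x snorm_pow p w0 x by exact: ET.
rewrite /Lnorm_on Lnorm.unlock; congr (_ `^ _); apply: eq_integral => x _.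
rewrite patchE; case: ifPn => [xO|/negP nO]; last first.
  have -> : snorm_pow p w0 x = 0 by exact: (snorm_pow_w0 (fun h => nO (mem_set h))).
  by rewrite abse0 poweR0r.
have xE : w x = w0 x by rewrite /w0 /zero_extend /patch xO.
have -> : covector_snorm p (w x) = snorm_pow p w0 x `^ p^-1.
  by rewrite -(snorm_pow_ext xE).
have := snorm_pow_ge0 p w0 x; move: (snorm_pow p w0 x) => a a0.
exact: poweR_root.
Qed.

End representative.

Theorem theorem1p6 (R : realType) (n k : nat) (p : R) :
  1 <= p -> (k <= n)%N ->
  exists K : R, 0 < K /\
  forall (Omega : set 'rV[R]_n) (r c : R) (w wB : dform R n k)
    (s : seminorm_kind),
    open Omega -> 0 < r -> 0 < c ->
    Lp_form Omega p w ->
    zero_extension_representative Omega w wB ->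
    (s = LpM \/ s = LpM_c -> bounded_set Omega) ->
    liminf_seminorm s Omega r c p (integration wB)
      = seminorm s Omega r c p (integration wB) /\
    seminorm s Omega r c p (integration wB)
      = (K%:E * Lnorm_on Omega p (fun x => covector_snorm p (w x)))%E.
Proof.
move=> p1 kn; have [K [C [K0 C0 KC]]] := const_factor_limit p1 kn.
(* [K] is the constant for the [p]-th powers *)
exists (K `^ p^-1); split; first exact: powR_gt0.
move=> Omega r c w wB s oO r0 c0 wL wBP bO.
have mwB : measurable_form setT wB by case: wBP.
have wB_fin := pnorm_representative_lty p1 oO wL wBP.
have [r' r'0 Hup] := seminorm_domain_short k c r0 bO.
have Hlow m := @inner_near_sub_domain R n k s Omega r c m oO r0 c0.
have sq := Ntheta_squeeze p1 kn mwB wB_fin K0 C0 KC oO (snorm_pow_supported p1 oO wL wBP) r'0 Hup Hlow.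
have [sup inf] := limf_squeeze _ sq.
rewrite /liminf_seminorm /seminorm sup inf; split => //.
rewrite (Lnorm_on_snorm p1 oO wL wBP) EFinM poweRM ?lee_fin ?(ltW K0)//; last first.
  by rewrite fine_ge0//; apply: integral_ge0 => x _; exact: snorm_pow_ge0.
rewrite poweR_EFin fineK// ge0_fin_numE; first exact: snorm_pow_integral_lty.
by apply: integral_ge0 => x _; exact: snorm_pow_ge0.
Qed.
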